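(* Let $N$ be a positive integer and let $(a_n)_{n\ge 0}$, $(b_n)_{n\ge0}$ be Jacobi parameters. Suppose that $$\lim_{n\to\infty}\frac{a_{n-1}}{a_n}=1,\qquad\lim_{n\to\infty}\frac{b_n}{a_n}=q,\qquad\lim_{n\to\infty}a_n=\infty,\qquad\lim_{n\to\infty}(a_{n+N}-a_n)=0,$$ for some $$q\in\big\{2\cos\big(j\tfrac{\pi}{N}\big):j=1,2,\ldots,N-1\big\}.$$ If $$\big(a_n-a_{n-1}:n\in\mathbb{N}\big),\quad\big(b_n-qa_n:n\in\mathbb{N}\big),\quad\Big(\frac1{a_n}:n\in\mathbb{N}\Big)\in\mathcal{D}_1^N(\mathbb{R}),$$ then $$\lim_{n\to\infty}\Big(\sum_{j=0}^n\frac{1}{a_j}\Big)^{-1}\sum_{j=0}^np_j^2(x)=\frac{\upsilon(x)}{\mu'(x)}$$ locally uniformly with respect to $x\in\Lambda$.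
   Context: $\mathbb{N}=\{1,2,\ldots\}$, $\mathbb{N}_0=\mathbb{N}\cup\{0\}$. Jacobi parameters are real sequences $(a_n)_{n\ge0}$, $(b_n)_{n\ge0}$ with $a_n>0$ for all $n$. A real sequence $(x_n:n\in\mathbb{N})$ belongs to $\mathcal{D}_1(\mathbb{R})$ if it is bounded and $\sum_n|x_{n+1}-x_n|<\infty$; it belongs to $\mathcal{D}_1^N(\mathbb{R})$ if $(x_{nN+i}:n\in\mathbb{N})\in\mathcal{D}_1(\mathbb{R})$ for each $i\in\{0,1,\ldots,N-1\}$. Polynomials: $p_0(x)=1$, $p_1(x)=\frac{x-b_0}{a_0}$, $xp_n(x)=a_np_{n+1}(x)+b_np_n(x)+a_{n-1}p_{n-1}(x)$ for $n\ge1$. By Favard's theorem there is a probability measure on $\mathbb{R}$ for which $(p_n)$ is orthonormal; when it is unique (as is the case here, since the hypotheses imply the Carleman condition $\sum_n1/a_n=\infty$) it is denoted $\mu$, and $\mu'$ denotes the continuous positive version of its density on $\Lambda$. For $n\ge1$, $B_n(x)=\begin{pmatrix}0&1\\-\frac{a_{n-1}}{a_n}&\frac{x-b_n}{a_n}\end{pmatrix}$, $X_n(x)=\prod_{j=n}^{n+N-1}B_j(x)=B_{n+N-1}(x)\cdots B_n(x)$. The parameters are $N$-periodically modulated with reference sequences $\alpha_n\equiv1$, $\beta_n\equiv q$ (i.e. $a_n\to\infty$, $a_{n-1}/a_n\to\alpha_{n-1}/\alpha_n$, $b_n/a_n\to\beta_n/\alpha_n$), and $\sigma\in\{-1,1\}$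 is the sign for which $\begin{pmatrix}0&1\\-1&-q\end{pmatrix}^N=\sigma\operatorname{Id}$. For $i\in\mathbb{N}_0$ put $\mathcal{R}_i(x)=\lim_{n\to\infty}a_{(n+1)N+i-1}\big(X_{nN+i}(x)-\sigma\operatorname{Id}\big)$ (these limits exist under the present hypotheses). For a $2\times2$ matrix $Y$, $[Y]_{k,l}$ is its $(k,l)$ entry and $\operatorname{discr}Y=(\operatorname{tr}Y)^2-4\det Y$. Then $$\Lambda=\bigcap_{i=0}^{N-1}\{x\in\mathbb{R}:\operatorname{discr}\mathcal{R}_i(x)<0\},\qquad\upsilon(x)=\frac1{N\pi}\sum_{i=0}^{N-1}\frac{1}{\alpha_{i-1}}\frac{\big|[\mathcal{R}_i(x)]_{2,1}\big|}{\sqrt{-\operatorname{discr}\mathcal{R}_i(x)}}\quad(x\in\Lambda),$$ with $\alpha_{i-1}=1$ here. *)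

(* Defs.v *)
From HB Require Import structures.
From mathcomp Require Import all_boot all_order all_algebra.
From mathcomp Require Import all_classical all_reals all_analysis.

Set Implicit Arguments.
Unset Strict Implicit.
Unset Printing Implicit Defensive.

Import Order.TTheory GRing.Theory Num.Theory.
Import numFieldNormedType.Exports.

Local Open Scope classical_set_scope.
Local Open Scope ring_scope.

(* The sequences in D1 and D1N are indexed by n = 1, 2, ...; the value of u at
   0 plays no role. *)
Definition D1 (R : realType) (u : R^nat) : Prop :=
  [bounded u n | n in [set n | (0 < n)%N]] /\
  (\sum_(1 <= n <oo) `|u n.+1 - u n|%:E < +oo)%E.

Definition D1N (R : realType) (N : nat) (u : R^nat) : Prop :=
  forall i, (i < N)%N -> D1 (fun n => u (n * N + i)%N).

Fixpoint orthpoly (R : realType) (a b : R^nat) (n : nat) : {poly R} :=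
  match n with
  | 0 => 1
  | 1 => (a 0%N)^-1 *: ('X - (b 0%N)%:P)
  | (m.+1 as k).+1 =>
      (a k)^-1 *: (('X - (b k)%:P) * orthpoly a b k - a m *: orthpoly a b m)
  end.

Definition orthonormal_polys (R : realType)
    (mu : probability (measurableTypeR R) R) (p : nat -> {poly R}) : Prop :=
  forall m n,
    mu.-integrable setT (fun x => ((p m).[x] * (p n).[x])%:E) /\
    (\int[mu]_x ((p m).[x] * (p n).[x])%:E = ((m == n)%:R : R)%:E)%E.

Definition mx2 (R : realType) (y00 y01 y10 y11 : R) : 'M[R]_2 :=
  \matrix_(i, j) if i == 0 then (if j == 0 then y00 else y01)
                 else (if j == 0 then y10 else y11).

Definition transfer_mx (R : realType) (a b : R^nat) (n : nat) (x : R) :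
    'M[R]_2 :=
  mx2 0 1 (- (a n.-1 / a n)) ((x - b n) / a n).

(* B_(n+N-1)(x) * ... * B_n(x): the largest index is leftmost. *)
Definition step_mx (R : realType) (N : nat) (a b : R^nat) (n : nat) (x : R) :
    'M[R]_2 :=
  \prod_(j <- rev (index_iota n (n + N))) transfer_mx a b j x.

Definition discr (R : realType) (Y : 'M[R]_2) : R := \tr Y ^+ 2 - 4 * \det Y.

(* In the natural-number index (n+1)N+i-1 the predecessor does not truncate
   when 0 < N. *)
Definition limit_mx (R : realType) (N : nat) (a b : R^nat) (sigma : R)
    (i : nat) (x : R) : 'M[R]_2 :=
  lim ((fun n : nat => a (n.+1 * N + i).-1 *:
          (step_mx N a b (n * N + i) x - sigma%:M)) @ \oo).

Definition Lambda (R : realType) (N : nat) (a b : R^nat) (sigma : R) : set R :=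
  \bigcap_(i in [set i | (i < N)%N])
    [set x | discr (limit_mx N a b sigma i x) < 0].

(* The weights 1 / alpha_(i-1) are all equal to 1 here; the (2,1) entry is the
   entry at the 0-based position (1,0). *)
Definition upsilon (R : realType) (N : nat) (a b : R^nat) (sigma : R) (x : R) :
    R :=
  (N%:R * pi)^-1 *
  \sum_(0 <= i < N)
    `|limit_mx N a b sigma i x 1 0|
      / Num.sqrt (- discr (limit_mx N a b sigma i x)).

(* mu is absolutely continuous on L with density f. If L is open, f is uniquely
   determined on L by this predicate; its values outside L are irrelevant. *)
Definition continuous_positive_density (R : realType)
    (mu : probability (measurableTypeR R) R) (L : set R) (f : R -> R) : Prop :=
  [/\ {within L, continuous f},
      forall x, L x -> 0 < f x &
      forall A : set (measurableTypeR R), measurable A -> A `<=` L ->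
        mu A = (\int[@lebesgue_measure R]_(x in A) (f x)%:E)%E].

Definition locally_uniform_cvg (R : realType) (L : set R)
    (F : nat -> R -> R) (g : R -> R) : Prop :=
  forall x, L x ->
    exists2 U : set R, nbhs x U & {uniform U `&` L, F @ \oo --> g}.

(* Main.v *)
Require Import Defs.
From HB Require Import structures.
From mathcomp Require Import all_boot all_order all_algebra.
From mathcomp Require Import all_classical all_reals all_analysis.
From mathcomp Require Import measurable_realfun ring lra.
From mathcomp.real_closed Require Import complex.

Set Implicit Arguments.
Unset Strict Implicit.
Unset Printing Implicit Defensive.

Import Order.TTheory GRing.Theory Num.Theory.
Import numFieldNormedType.Exports.

Local Open Scope classical_set_scope.
Local Open Scope ring_scope.

(** Put K_n = p_0^2 + ... + p_(n-1)^2 and rho_n = 1/a_0 + ... + 1/a_(n-1). Near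
    every point of Lambda, K_n / rho_n converges uniformly to an explicit
    function [growth] and mu has an explicit continuous density [density_at 0];
    the product of the two is upsilon ([growthE]).

    Let V_m = (p_m, p_(m+1)) and T_m = a_(m+N-1) (X_m - sigma), so that
    V_(m+N) = sigma V_m + T_(m+1) V_m / a_(m+N). A transfer matrix is a constant
    matrix, whose N-th power is sigma, plus 1/a_n times a matrix with entries
    a_n - a_(n-1) and x - (b_n - q a_n). Hence T_m is a polynomial in sequences
    of summable N-step variation ([scaled_step_bv]) and it converges along each
    residue class modulo N, locally uniformly, to a matrix R_i. The determinant
    of X_m tells that R_i is traceless ([limit_mx_trace]); on Lambda its
    determinant is positive, so that R_i generates a group of rotations for the
    definite quadratic form det(v, R_i v).

    The Turan determinants a_m det(V_m, T_(m+1) V_m) change over a period only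
    through T ([turan_step]). The change is summable relative to the
    determinants themselves, which therefore converge on Lambda to nonzero
    limits g_i, while a_m |V_m|^2 remains bounded ([turan_local]).

    Growth of K_n. From one period to the next V_m moves, up to the sign sigma,
    by a rotation of size 1/a_m on the ellipse det(v, R v) = g / a_m. Over such a
    rotation the second coordinate squared has mean R_10 g / (2 a_m det R), the
    rest being a difference of bounded boundary terms ([residual_bound]). Since
    sum 1/a_n diverges ([carleman_condition]), summation gives K_n ~ growth rho_n
    ([CDkernel_asymptotics]).

    The density. The Gauss quadratures, with nodes the zeros of p_m and weights
    1/K_m, converge to mu: on a Poisson kernel quadrature and measure differ by
    at most 2 / (y sum_k |p_k(z)|^2) ([gauss_poisson]), and Poisson kernels
    generate bump functions. This bound tends to 0 because sum 1/a_n diverges, and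
    yields the masses of intervals without solving a moment problem. The zeros
    are spaced by the angle of (p_m, p_(m+1)) on the ellipse above: by the
    confluent Christoffel-Darboux formula it turns at the rate
    sqrt(det R) K_(m+1) / |g|, which is now known asymptotically. Counting zeros
    in a short interval and multiplying by the weights, K_m cancels and the mass
    per unit length is sqrt(det R) / (pi |g|) ([gauss_mass_bounds]). It follows
    that the distribution function of mu is differentiable on Lambda with this
    derivative ([mass_local]); the fundamental theorem of calculus and the
    uniqueness of measures make it a density ([mass_density]).

    The zeros of p_m may be taken with m in any residue class, so the value
    sqrt(det R) / (pi |g|) does not depend on the class ([density_at_residue]).
    Expressing |g_i| by it in the mean value above turns growth into upsilon
    divided by the density. *)

(** * Orthogonal polynomials and Christoffel-Darboux formulas *)

Definition ceval (R : realType) (z : R[i]) (q : {poly R}) : R[i] :=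
  (map_poly (real_complex R) q).[z].

Section ComplexEvaluation.
Variables (R : realType) (z : R[i]).

Lemma cevalX : ceval z 'X = z.
Proof. by rewrite /ceval map_polyX hornerX. Qed.

Lemma cevalC (c : R) : ceval z c%:P = c%:C%C.
Proof. by rewrite /ceval map_polyC hornerC. Qed.

Lemma cevalD (q r : {poly R}) : ceval z (q + r) = ceval z q + ceval z r.
Proof. by rewrite /ceval rmorphD hornerD. Qed.

Lemma cevalM (q r : {poly R}) : ceval z (q * r) = ceval z q * ceval z r.
Proof. by rewrite /ceval rmorphM hornerM. Qed.

Lemma cevalN (q : {poly R}) : ceval z (- q) = - ceval z q.
Proof. by rewrite /ceval rmorphN hornerN. Qed.

Lemma cevalZ (c : R) (q : {poly R}) : ceval z (c *: q) = c%:C%C * ceval z q.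
Proof. by rewrite -mul_polyC cevalM cevalC. Qed.

End ComplexEvaluation.

Definition csqnorm (R : realType) (z : R[i]) : R :=
  complex.Re z ^+ 2 + complex.Im z ^+ 2.

Section OrthogonalPolynomials.
Variables (R : realType) (a b : R^nat).
Hypothesis a_gt0 : forall n, 0 < a n.
Notation p := (orthpoly a b).

Let a_neq0 n : a n != 0. Proof. by rewrite gt_eqF. Qed.

Lemma orthpoly_rec n :
  ('X - (b n.+1)%:P) * p n.+1 = a n.+1 *: p n.+2 + a n *: p n.
Proof. by rewrite /= scalerA divff // scale1r subrK. Qed.

Lemma orthpoly_rec0 : 'X - (b 0)%:P = a 0 *: p 1.
Proof. by rewrite /= scalerA divff // scale1r. Qed.

Lemma size_orthpoly n : size (p n) = n.+1.
Proof.
elim/ltn_ind: n => -[|[|n]] IH; first by rewrite size_poly1.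
  by rewrite /= size_scale ?invr_eq0 // size_XsubC.
rewrite /= size_scale ?invr_eq0 //.
have pn0 : p n.+1 != 0 by rewrite -size_poly_eq0 IH.
have sz : size (('X - (b n.+1)%:P) * p n.+1) = n.+3.
  by rewrite size_proper_mul ?IH // ?size_XsubC // lead_coefXsubC mul1r lead_coef_eq0.
by rewrite -/(p n.+1) -/(p n) size_polyDl sz // size_polyN size_scale // IH.
Qed.

(** The diagonal of the Christoffel-Darboux kernel. *)
Definition CDkernel m x : R := \sum_(k < m) (p k).[x] ^+ 2.

Lemma CDkernelS m x : CDkernel m.+1 x = CDkernel m x + (p m).[x] ^+ 2.
Proof. by rewrite /CDkernel big_ord_recr. Qed.

Lemma CDkernel_ge1 m x : 1 <= CDkernel m.+1 x.
Proof.
rewrite /CDkernel big_ord_recl /= hornerC expr1n lerDl.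
by apply: sumr_ge0 => i _; exact: sqr_ge0.
Qed.

Lemma CDkernel_gt0 m x : (0 < m)%N -> 0 < CDkernel m x.
Proof. by case: m => // m _; apply: lt_le_trans (CDkernel_ge1 m x). Qed.

Lemma horner_orthpoly_rec n x :
  a n.+1 * (p n.+2).[x] = (x - b n.+1) * (p n.+1).[x] - a n * (p n).[x].
Proof.
have /(congr1 (fun q : {poly R} => q.[x])) := orthpoly_rec n.
by rewrite hornerM hornerD hornerN hornerX hornerC hornerD !hornerZ => ->; rewrite addrK.
Qed.

Lemma horner_orthpoly_rec0 x : a 0 * (p 1).[x] = x - b 0.
Proof. by have /(congr1 (fun q : {poly R} => q.[x])) := orthpoly_rec0; rewrite !hornerE. Qed.

Lemma christoffel_darboux m x y :
  (x - y) * \sum_(k < m.+1) (p k).[x] * (p k).[y] =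
  a m * ((p m.+1).[x] * (p m).[y] - (p m).[x] * (p m.+1).[y]).
Proof.
have distr c (u v u' v' : R) : c * (u * v' - v * u') = c * u * v' - v * (c * u').
  by ring.
elim: m => [|m IH].
  by rewrite big_ord_recl big_ord0 distr !horner_orthpoly_rec0 !hornerC; ring.
by rewrite big_ord_recr mulrDr IH !distr !horner_orthpoly_rec /=; ring.
Qed.

Lemma deriv_orthpoly_rec n x :
  a n.+1 * (p n.+2)^`().[x] =
  (p n.+1).[x] + (x - b n.+1) * (p n.+1)^`().[x] - a n * (p n)^`().[x].
Proof.
have /(congr1 (fun q : {poly R} => q^`().[x])) := orthpoly_rec n.
rewrite derivM derivB derivX derivC subr0 mul1r derivD !derivZ.
rewrite !hornerD hornerM hornerD hornerN hornerX hornerC !hornerZ => ->.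
by rewrite addrK.
Qed.

Lemma deriv_orthpoly_rec0 x : a 0 * (p 1)^`().[x] = 1.
Proof.
have /(congr1 (fun q : {poly R} => q^`().[x])) := orthpoly_rec0.
by rewrite derivB derivX derivC subr0 derivZ hornerZ hornerC.
Qed.

(** On the diagonal the formula contains the Wronskian of two consecutive
    polynomials; its positivity makes their ratio monotone between poles. *)
Lemma confluent_christoffel_darboux m x :
  CDkernel m.+1 x =
  a m * ((p m.+1)^`().[x] * (p m).[x] - (p m)^`().[x] * (p m.+1).[x]).
Proof.
have distr c (u v u' v' : R) : c * (u * v' - v * u') = c * u * v' - v * (c * u').
  by ring.
elim: m => [|m IH].
  rewrite /CDkernel big_ord_recl big_ord0 distr deriv_orthpoly_rec0.
  by rewrite horner_orthpoly_rec0 [(p 0)^`()]derivC !hornerC expr1n; ring.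
by rewrite CDkernelS IH !distr deriv_orthpoly_rec horner_orthpoly_rec; ring.
Qed.

Lemma orthpoly_wronskian_neq0 m x : (p m).[x] != 0 \/ (p m.+1).[x] != 0.
Proof.
case: (eqVneq (p m).[x] 0) => [z1|]; last by left.
right; apply/eqP => z2; have := CDkernel_ge1 m x.
by rewrite confluent_christoffel_darboux z1 z2 !mulr0 subrr mulr0 ler10.
Qed.

Lemma ceval_orthpoly_rec n z :
  (a n.+1)%:C%C * ceval z (p n.+2) =
  (z - (b n.+1)%:C%C) * ceval z (p n.+1) - (a n)%:C%C * ceval z (p n).
Proof.
have /(congr1 (ceval z)) := orthpoly_rec n.
by rewrite cevalM cevalD cevalN cevalX cevalC cevalD 2!cevalZ => ->; rewrite addrK.
Qed.

Lemma ceval_orthpoly_rec0 z : (a 0)%:C%C * ceval z (p 1) = z - (b 0)%:C%C.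
Proof. by have /(congr1 (ceval z)) := orthpoly_rec0; rewrite cevalZ cevalD cevalN cevalX cevalC. Qed.

Lemma ceval_orthpoly0 z : ceval z (p 0) = 1.
Proof. exact: (cevalC z 1). Qed.

Definition cCDkernel m z : R := \sum_(k < m) csqnorm (ceval z (p k)).

(** Christoffel-Darboux at the pair of a complex point and its conjugate. *)
Lemma christoffel_darboux_im m z :
  complex.Im z * cCDkernel m.+1 z =
  a m * (complex.Im (ceval z (p m.+1)) * complex.Re (ceval z (p m))
         - complex.Re (ceval z (p m.+1)) * complex.Im (ceval z (p m))).
Proof.
elim: m => [|m IH].
  rewrite /cCDkernel big_ord_recl big_ord0 mulrBr !mulrA.
  have := ceval_orthpoly_rec0 z; rewrite ceval_orthpoly0.
  case: (ceval _ _) => u v; case: z => x y [/= E1 E2].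
  rewrite /csqnorm /=; lra.
rewrite /cCDkernel big_ord_recr mulrDr -/(cCDkernel _ _) IH.
have := ceval_orthpoly_rec m z.
move: (ceval z (p m.+2)) (ceval z (p m.+1)) (ceval z (p m)).
move=> [u'' v''] [u' v'] [u v]; case: z {IH} => x y [/= E1 E2].
have F1 : a m.+1 * u'' = (x - b m.+1) * u' - y * v' - a m * u by lra.
have F2 : a m.+1 * v'' = (x - b m.+1) * v' + y * u' - a m * v by lra.
rewrite /csqnorm /=.
have -> : a m.+1 * (v'' * u' - u'' * v') =
  (a m.+1 * v'') * u' - (a m.+1 * u'') * v' by ring.
by rewrite F1 F2; ring.
Qed.

End OrthogonalPolynomials.

(** * Gauss quadrature *)

Section Zeros.
Variables (R : realType) (a b : R^nat).
Hypothesis a_gt0 : forall n, 0 < a n.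
Notation p := (orthpoly a b).

Lemma uniq_simple_roots (w : {poly R}) (s : seq R) :
    (forall x, x \in s -> (w * \prod_(y <- s) ('X - y%:P))^`().[x] != 0) ->
  uniq s.
Proof.
elim: s w => // x s IH w simple /=; apply/andP; split; last first.
  apply: (IH (w * ('X - x%:P))) => y ys.
  by have := simple y; rewrite big_cons mulrA in_cons ys orbT => ->.
apply/negP => xs; have := simple x (mem_head _ _); apply/negP; rewrite negbK.
have : root (\prod_(y <- s) ('X - y%:P)) x by rewrite root_prod_XsubC.
move=> /factor_theorem [u]; rewrite big_cons => ->.
have -> : w * (('X - x%:P) * (u * ('X - x%:P))) =
  (w * u) * ('X - x%:P) ^+ 2 by ring.
rewrite expr2 mulrA derivM derivB derivX derivC subr0 mulr1.
by rewrite hornerD !hornerM !hornerE subrr !mulr0 addr0.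
Qed.

Lemma cCDkernel_ge1 m z : 1 <= cCDkernel a b m.+1 z.
Proof.
rewrite /cCDkernel big_ord_recl ceval_orthpoly0 /csqnorm /= expr1n expr0n addr0.
by rewrite lerDl; apply: sumr_ge0 => i _; rewrite addr_ge0 // sqr_ge0.
Qed.

Lemma orthpoly_complex_root_real m z : ceval z (p m.+1) = 0 -> complex.Im z = 0.
Proof.
move=> pz; have := christoffel_darboux_im b a_gt0 m z.
rewrite pz /= !mul0r subrr mulr0 => /eqP; rewrite mulf_eq0 => /orP [/eqP //|].
by rewrite gt_eqF // (lt_le_trans ltr01) // cCDkernel_ge1.
Qed.

(** All complex zeros are real, because at a zero the Christoffel-Darboux
    formula for a conjugate pair reads Im z * (positive) = 0; they are simple
    because the confluent formula reads (positive) = a_m p_{m+1}' p_m. *)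
Lemma orthpoly_zeros m :
  exists s : seq R, [/\ uniq s, size s = m &
    forall x, (x \in s) = root (p m) x].
Proof.
case: m => [|m]; first by exists [::]; split=> // x; rewrite [p 0]/= rootC oner_eq0.
pose P := map_poly (real_complex R) (p m.+1).
have [r Pr] := closed_field_poly_normal P.
have rreal z : z \in r -> z = (complex.Re z)%:C%C.
  move=> zr; suff : complex.Im z = 0 by case: (z) => x y /= ->.
  apply: (@orthpoly_complex_root_real m); apply/eqP.
  rewrite /ceval -/P -/(root _ _) Pr rootE hornerZ mulf_eq0; apply/orP; right.
  by rewrite -rootE root_prod_XsubC.
pose s := [seq complex.Re z | z <- r].
have rE : r = [seq x%:C%C | x <- s].
  rewrite -map_comp -[LHS]map_id; apply/eq_in_map => z zr /=; exact: rreal.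
have pE : p m.+1 = lead_coef (p m.+1) *: \prod_(y <- s) ('X - y%:P).
  apply: (map_poly_inj (real_complex R)).
  rewrite -/P [LHS]Pr map_polyZ lead_coef_map rE rmorph_prod big_map.
  congr (_ *: _); apply: eq_bigr => y _.
  by rewrite rmorphB /= map_polyX map_polyC.
have lc0 : lead_coef (p m.+1) != 0.
  by rewrite lead_coef_eq0 -size_poly_eq0 size_orthpoly.
have sroot x : (x \in s) = root (p m.+1) x.
  by rewrite pE rootZ // root_prod_XsubC.
exists s; split=> //.
  apply: (@uniq_simple_roots (lead_coef (p m.+1))%:P) => x.
  rewrite mul_polyC -pE sroot => /rootP px0; apply/eqP => dpx0.
  have := CDkernel_ge1 a b m x; rewrite confluent_christoffel_darboux //.
  by rewrite px0 dpx0 mulr0 mul0r subrr mulr0 ler10.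
have := size_orthpoly b a_gt0 m.+1; rewrite pE size_scale // size_prod_XsubC.
by case.
Qed.

Definition zeros m : seq R := sval (cid (orthpoly_zeros m)).

Lemma zeros_uniq m : uniq (zeros m).
Proof. by rewrite /zeros; case: cid => s []. Qed.

Lemma size_zeros m : size (zeros m) = m.
Proof. by rewrite /zeros; case: cid => s []. Qed.

Lemma mem_zeros m x : (x \in zeros m) = root (p m) x.
Proof. by rewrite /zeros; case: cid => s []. Qed.

(** Gauss quadrature, with the Christoffel numbers 1/K_m(x) as weights. *)
Definition gauss m (f : R -> R) : R :=
  \sum_(x <- zeros m) f x / CDkernel a b m x.

Lemma gaussD m f g : gauss m (fun x => f x + g x) = gauss m f + gauss m g.
Proof. by rewrite /gauss -big_split; apply: eq_bigr => x _; rewrite mulrDl. Qed.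

Lemma gaussZ m c f : gauss m (fun x => c * f x) = c * gauss m f.
Proof. by rewrite /gauss mulr_sumr; apply: eq_bigr => x _; rewrite mulrA. Qed.

Lemma eq_gauss m f g : f =1 g -> gauss m f = gauss m g.
Proof. by move=> fg; apply: eq_bigr => x _; rewrite fg. Qed.

Lemma gauss_le m f g : (forall x, f x <= g x) -> gauss m f <= gauss m g.
Proof.
case: m => [|m] fg.
  by rewrite /gauss (size0nil (size_zeros 0)) !big_nil.
rewrite /gauss; apply: ler_sum => x _.
by rewrite ler_wpM2r // invr_ge0 ltW // CDkernel_gt0.
Qed.

(** The square matrix p_k(x_j) / sqrt K_m(x_j) has orthonormal columns by the
    Christoffel-Darboux formula, hence orthonormal rows. *)
Lemma gauss_orthonormal m k l : (k < m)%N -> (l < m)%N ->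
  gauss m (fun x => (p k).[x] * (p l).[x]) = (k == l)%:R.
Proof.
case: m => // m km lm.
pose K := CDkernel a b m.+1; have K0 x : 0 < K x by exact: CDkernel_gt0.
pose t := nth 0 (zeros m.+1).
have troot (j : 'I_m.+1) : (p m.+1).[t j] = 0.
  by apply/rootP; rewrite -mem_zeros mem_nth // size_zeros.
pose U : 'M[R]_m.+1 := \matrix_(i, j) ((p i).[t j] / Num.sqrt (K (t j))).
have UU : U^T *m U = 1%:M.
  apply/matrixP => i j; rewrite !mxE.
  under eq_bigr => h _ do rewrite !mxE mulrACA -invfM.
  rewrite -mulr_suml; case: (eqVneq i j) => [<-|ij].
    rewrite -expr2 sqr_sqrtr ?ltW //.
    under eq_bigr do rewrite -expr2.
    by rewrite divff // gt_eqF // K0.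
  have tij : t i - t j != 0.
    by rewrite subr_eq0 nth_uniq ?size_zeros ?zeros_uniq.
  have := christoffel_darboux b a_gt0 m (t i) (t j).
  rewrite !troot mul0r mulr0 subrr mulr0 => /eqP.
  by rewrite mulf_eq0 (negbTE tij) => /eqP ->; rewrite mul0r.
have := mulmx1C UU => /matrixP /(_ (Ordinal km) (Ordinal lm)).
rewrite !mxE -val_eqE /= => <-.
rewrite /gauss (big_nth 0) size_zeros big_mkord; apply: eq_bigr => j _.
by rewrite !mxE mulrACA -invfM -expr2 sqr_sqrtr // ltW.
Qed.

Lemma orthpoly_span m (q : {poly R}) : (size q <= m)%N ->
  exists c : nat -> R, q = \sum_(k < m) c k *: p k.
Proof.
elim: m q => [|m IH] q.
  by rewrite leqn0 size_poly_eq0 => /eqP ->; exists (fun=> 0); rewrite big_ord0.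
move=> szq; have lc0 : lead_coef (p m) != 0.
  by rewrite lead_coef_eq0 -size_poly_eq0 size_orthpoly.
pose d := q`_m / lead_coef (p m).
have [|c qc] := IH (q - d *: p m).
  apply/leq_sizeP => j; rewrite leq_eqVlt => /predU1P [<-|mj].
    have -> : (q - d *: p m)`_m = q`_m - d * lead_coef (p m).
      by rewrite coefB coefZ lead_coefE size_orthpoly.
    by rewrite /d divfK // subrr.
  rewrite coefB coefZ nth_default ?(leq_trans szq) //.
  by rewrite nth_default ?size_orthpoly // mulr0 subrr.
exists (fun k => if k == m then d else c k).
rewrite big_ord_recr /= eqxx.
under eq_bigr => i _ do rewrite (ltn_eqF (ltn_ord i)).
by rewrite -qc subrK.
Qed.

Variable mu : probability (measurableTypeR R) R.
Hypothesis mu_orth : orthonormal_polys mu p.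

Definition quadrature_exact m (q : {poly R}) : Prop :=
  mu.-integrable setT (fun x => q.[x]%:E) /\
  (\int[mu]_x q.[x]%:E = (gauss m (fun x => q.[x]))%:E)%E.

Lemma quadrature_exact0 m : quadrature_exact m 0.
Proof.
have E : (fun x => (0 : {poly R}).[x]%:E) = cst 0%E.
  by apply/funext => x; rewrite horner0.
split; first by rewrite E; exact: integrable0.
rewrite [X in integral _ _ X]E integral0 /gauss big1 // => x _.
by rewrite horner0 mul0r.
Qed.

Lemma quadrature_exactD m q r : quadrature_exact m q -> quadrature_exact m r ->
  quadrature_exact m (q + r).
Proof.
move=> [qi qe] [ri re].
have E : (fun x => (q + r).[x]%:E) = (fun x => q.[x]%:E + r.[x]%:E)%E.
  by apply/funext => x; rewrite hornerD.
split; first by rewrite E; exact: integrableD.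
rewrite [X in integral _ _ X]E integralD // qe re -EFinD -gaussD.
by congr (_%:E); apply: eq_gauss => x; rewrite hornerD.
Qed.

Lemma quadrature_exactZ m c q : quadrature_exact m q ->
  quadrature_exact m (c *: q).
Proof.
move=> [qi qe].
have E : (fun x => (c *: q).[x]%:E) = (fun x => c%:E * q.[x]%:E)%E.
  by apply/funext => x; rewrite hornerZ.
split; first by rewrite E; exact: integrableZl.
rewrite [X in integral _ _ X]E integralZl // qe -EFinM -gaussZ.
by congr (_%:E); apply: eq_gauss => x; rewrite hornerZ.
Qed.

Lemma quadrature_exact_sum m n (f : nat -> {poly R}) :
    (forall k, (k < n)%N -> quadrature_exact m (f k)) ->
  quadrature_exact m (\sum_(k < n) f k).
Proof.
move=> fk; elim/big_ind: _ => [||i _]; first exact: quadrature_exact0.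
  exact: quadrature_exactD.
exact: fk.
Qed.

Lemma quadrature_exact_mul m (q r : {poly R}) : (size q <= m)%N -> (size r <= m)%N ->
  quadrature_exact m (q * r).
Proof.
move=> /orthpoly_span [c ->] /orthpoly_span [d ->].
rewrite mulr_suml.
apply: (@quadrature_exact_sum m m (fun k => (c k *: p k) * \sum_(l < m) d l *: p l)) => k km.
rewrite mulr_sumr.
apply: (@quadrature_exact_sum m m (fun l => (c k *: p k) * (d l *: p l))) => l lm.
rewrite -scalerAl -scalerAr; do 2!apply: quadrature_exactZ.
have [klI klE] := mu_orth k l.
have E : (fun x => (p k * p l).[x]%:E) = (fun x => ((p k).[x] * (p l).[x])%:E).
  by apply/funext => x; rewrite hornerM.
split; first by rewrite E.
rewrite [X in integral _ _ X]E klE -(gauss_orthonormal km lm).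
by congr (_%:E); apply: eq_gauss => x; rewrite hornerM.
Qed.

(** Division by p_m leaves products of two polynomials of size at most m + 1,
    which orthonormality handles. *)
Lemma quadrature_exact_size m (q : {poly R}) : (size q <= m.*2.+1)%N ->
  quadrature_exact m.+1 q.
Proof.
move=> szq; rewrite (divp_eq q (p m)).
have szp : size (p m) = m.+1 by rewrite size_orthpoly.
have p0 : p m != 0 by rewrite -size_poly_eq0 szp.
apply: quadrature_exactD.
  apply: quadrature_exact_mul; rewrite ?szp //.
  rewrite size_divp // szp /= leq_subLR addnS addnn.
  by apply: leq_trans szq _; rewrite ltnS.
rewrite -[X in quadrature_exact _ X]mulr1; apply: quadrature_exact_mul.
  by apply: ltnW; rewrite -szp ltn_modp.
by rewrite size_poly1.
Qed.

End Zeros.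

(** * Weak convergence of the quadratures *)

Section PoissonApproximation.
Variables (R : realType) (a b : R^nat).
Hypothesis a_gt0 : forall n, 0 < a n.
Notation p := (orthpoly a b).

Definition poisson (y x t : R) : R := y / ((t - x) ^+ 2 + y ^+ 2).

Lemma poisson_den_gt0 (y u : R) : 0 < y -> 0 < u ^+ 2 + y ^+ 2.
Proof. by move=> y0; rewrite ltr_wpDl ?sqr_ge0 // exprn_gt0. Qed.

Lemma poisson_ge0 (y x t : R) : 0 < y -> 0 <= poisson y x t.
Proof. by move=> y0; rewrite divr_ge0 ?ltW // poisson_den_gt0. Qed.

Lemma poisson_le (y x t : R) : 0 < y -> poisson y x t <= y^-1.
Proof.
move=> y0; rewrite ler_pdivrMr ?poisson_den_gt0 //.
by rewrite [leRHS]mulrC ler_pdivlMr // -expr2 lerDr sqr_ge0.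
Qed.

Lemma poisson_lipschitz (y x x' t : R) : 0 < y ->
  `|poisson y x t - poisson y x' t| <= `|x - x'| / y ^+ 2.
Proof.
move=> y0; set u := t - x; set v := t - x'.
have den w : 0 < w ^+ 2 + y ^+ 2 by exact: poisson_den_gt0.
have amgm w : `|w| / (w ^+ 2 + y ^+ 2) <= (2 * y)^-1.
  rewrite ler_pdivrMr // -ler_pdivrMl ?invr_gt0 ?mulr_gt0 // invrK.
  have := sqr_ge0 (`|w| - y); rewrite sqrrB real_normK ?num_real //; lra.
have inv w : (w ^+ 2 + y ^+ 2)^-1 <= (y ^+ 2)^-1.
  by rewrite lef_pV2 ?posrE ?exprn_gt0 // lerDr sqr_ge0.
have -> : poisson y x t - poisson y x' t =
    y * (x - x') * (u + v) / ((u ^+ 2 + y ^+ 2) * (v ^+ 2 + y ^+ 2)).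
  rewrite /poisson -/u -/v; have -> : x - x' = v - u by rewrite /u /v; lra.
  by field; rewrite !gt_eqF.
have D0 : 0 < (u ^+ 2 + y ^+ 2) * (v ^+ 2 + y ^+ 2) by rewrite mulr_gt0.
rewrite normrM normfV (gtr0_norm D0) !normrM (gtr0_norm y0).
have -> : y * `|x - x'| * `|u + v| / ((u ^+ 2 + y ^+ 2) * (v ^+ 2 + y ^+ 2)) =
  (`|x - x'| * y) * (`|u + v| / ((u ^+ 2 + y ^+ 2) * (v ^+ 2 + y ^+ 2))) by ring.
have i0 w : 0 <= (w ^+ 2 + y ^+ 2)^-1 by rewrite invr_ge0 ltW.
have key : `|u + v| / ((u ^+ 2 + y ^+ 2) * (v ^+ 2 + y ^+ 2)) <=
    2 * ((2 * y)^-1 * (y ^+ 2)^-1).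
  apply: (@le_trans _ _ ((`|u| / (u ^+ 2 + y ^+ 2)) * (v ^+ 2 + y ^+ 2)^-1
     + (`|v| / (v ^+ 2 + y ^+ 2)) * (u ^+ 2 + y ^+ 2)^-1)).
    rewrite invfM [X in _ <= X](_ : _ = (`|u| + `|v|) *
       ((u ^+ 2 + y ^+ 2)^-1 * (v ^+ 2 + y ^+ 2)^-1)); last by ring.
    by rewrite ler_wpM2r ?ler_normD // mulr_ge0.
  rewrite mulr2n mulrDl mul1r.
  by apply: lerD; apply: ler_pM; rewrite ?mulr_ge0.
rewrite -mulrA ler_wpM2l //; apply: (@le_trans _ _ (y * (2 * ((2 * y)^-1 * (y ^+ 2)^-1)))).
  by rewrite ler_wpM2l // ltW.
by rewrite le_eqVlt; apply/orP; left; apply/eqP; field; rewrite gt_eqF.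
Qed.

Lemma continuous_poisson (y x : R) : 0 < y -> continuous (poisson y x).
Proof.
move=> y0 t; apply: cvgMr; apply: cvgV; first by rewrite gt_eqF ?poisson_den_gt0.
apply: cvgD; last exact: cvg_cst.
by rewrite expr2; apply: cvgM; apply: cvgB; (exact: cvg_id || exact: cvg_cst).
Qed.

Lemma horner_Im (r : {poly R[i]}) (t : R) :
  complex.Im r.[t%:C%C] = (\poly_(i < size r) complex.Im r`_i).[t].
Proof.
rewrite horner_poly horner_coef (big_morph _ (raddfD (@complex.Im R)) (raddf0 _)).
apply: eq_bigr => i _; rewrite -rmorphXn /=.
by case: (r`_i) => u v /=; rewrite mulr0 add0r.
Qed.

(** Let C be the polynomial of degree m with C(z) = 1 and least L2 norm: with
    z = x + iy and S = sum_k |p_k(z)|^2, it satisfies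
    S C(t) = sum_k p_k(t) conj p_k(z).  Then C^2 - 1 = (t - z) q(t), so that
    Im 1/(t - z), the Poisson kernel, and r = - Im q differ by
    Im (C(t)^2 / (t - z)). *)
Lemma poisson_approx m (x y : R) : 0 < y ->
  exists r : {poly R}, exists c d : nat -> R, [/\ (size r <= m.*2)%N,
    \sum_(k < m.+1) (c k ^+ 2 + d k ^+ 2) =
      (cCDkernel a b m.+1 (x +i* y)%C)^-1 &
    forall t, `|poisson y x t - r.[t]| <=
      ((\sum_(k < m.+1) c k *: p k).[t] ^+ 2 +
       (\sum_(k < m.+1) d k *: p k).[t] ^+ 2) / y].
Proof.
move=> y0; set z := (x +i* y)%C; set S := cCDkernel a b m.+1 z.
have S0 : S != 0 by rewrite gt_eqF // (lt_le_trans ltr01) // cCDkernel_ge1.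
pose c k := complex.Re (ceval z (p k)) / S.
pose d k := - complex.Im (ceval z (p k)) / S.
pose A := \sum_(k < m.+1) c k *: p k; pose B := \sum_(k < m.+1) d k *: p k.
pose C := map_poly (real_complex R) A + 'i%C *: map_poly (real_complex R) B.
have ceval_sum (f : nat -> R) : ceval z (\sum_(k < m.+1) f k *: p k) =
    \sum_(k < m.+1) (f k)%:C%C * ceval z (p k).
  rewrite (big_morph _ (cevalD z) (_ : ceval z 0 = 0)); last first.
    by rewrite -polyC0 cevalC.
  by apply: eq_bigr => k _; rewrite cevalZ.
have Cz : C.[z] = 1.
  rewrite hornerD hornerZ -/(ceval z A) -/(ceval z B) !ceval_sum.
  rewrite mulr_sumr -big_split /=.
  under eq_bigr => k _.
    have -> : (c k)%:C%C * ceval z (p k) + 'i%C * ((d k)%:C%C * ceval z (p k)) =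
      (csqnorm (ceval z (p k)) / S)%:C%C.
      rewrite /c /d /csqnorm; case: (ceval _ _) => u v /=.
      by apply/eqP; rewrite eq_complex /=; apply/andP; split; apply/eqP; field.
    over.
  by rewrite -rmorph_sum -mulr_suml /= -/(cCDkernel _ _ _ _) divff.
have szsum (f : nat -> R) : (size (\sum_(k < m.+1) f k *: p k)%R <= m.+1)%N.
  apply: (leq_trans (size_sum _ _ _)); apply/bigmax_leqP => k _.
  apply: (leq_trans (size_scale_leq _ _)).
  by rewrite size_orthpoly // ltnS -ltnS.
have szC : (size C <= m.+1)%N.
  apply: (leq_trans (size_polyD _ _)); rewrite geq_max.
  rewrite (leq_trans (size_poly _ _)) ?szsum //=.
  by rewrite (leq_trans (size_scale_leq _ _)) // (leq_trans (size_poly _ _)) ?szsum.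
have : root (C ^+ 2 - 1) z.
  by apply/rootP; rewrite hornerD horner_exp hornerN hornerC Cz expr1n subrr.
move=> /factor_theorem [q Cq].
have szq : (size q <= m.*2)%N.
  have [->|q0] := eqVneq q 0; first by rewrite size_poly0.
  have : size (C ^+ 2 - 1) = (size q).+1.
    by rewrite Cq size_Mmonic ?monicXsubC // size_XsubC addn2.
  move=> szE; rewrite -ltnS -szE; apply: (leq_trans (size_polyD _ _)).
  rewrite size_polyN size_poly1 geq_max ltnS leq0n andbT.
  apply: (leq_trans (size_poly_exp_leq _ _)).
  by rewrite ltnS muln2 leq_double -subn1 leq_subLR add1n.
exists (- \poly_(i < size q) complex.Im q`_i), c, d; split.
- by rewrite size_polyN (leq_trans (size_poly _ _)).
- under eq_bigr => k _.
    have -> : c k ^+ 2 + d k ^+ 2 = csqnorm (ceval z (p k)) / S ^+ 2.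
      by rewrite /c /d /csqnorm; field.
    over.
  by rewrite -mulr_suml -/(cCDkernel _ _ _ _) -/S; field.
- move=> t; rewrite -/A -/B hornerN opprK -horner_Im.
  have /(congr1 (fun q : {poly R[i]} => q.[t%:C%C])) := Cq.
  rewrite hornerD horner_exp hornerN hornerC hornerM hornerXsubC.
  rewrite hornerD hornerZ !horner_map /=.
  clear szC szq Cz Cq; move: (A.[t]) (B.[t]) (q.[_]) => aa bb [u v] [E1 E2].
  have /= {}E1 : aa ^+ 2 - bb ^+ 2 - 1 = u * (t - x) + v * y by lra.
  have /= {}E2 : 2 * aa * bb = v * (t - x) - u * y by lra.
  rewrite /poisson; set w := t - x in E1 E2 *.
  have D0 : 0 < w ^+ 2 + y ^+ 2 by exact: poisson_den_gt0.
  have -> : y / (w ^+ 2 + y ^+ 2) + v =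
    (y * (aa ^+ 2 - bb ^+ 2) + 2 * aa * bb * w) / (w ^+ 2 + y ^+ 2).
    have -> : aa ^+ 2 - bb ^+ 2 = u * w + v * y + 1 by lra.
    by rewrite E2; field; rewrite gt_eqF.
  rewrite normrM [`|_^-1|]gtr0_norm ?invr_gt0 // ler_pdivrMr // [leRHS]mulrAC.
  rewrite ler_pdivlMr // -[X in _ * X <= _](gtr0_norm y0) -normrM ler_norml.
  have h1 := sqr_ge0 (aa * w - bb * y); have h2 := sqr_ge0 (aa * y + bb * w).
  have h3 : 0 <= aa ^+ 2 * (w ^+ 2 + y ^+ 2) by rewrite mulr_ge0 ?sqr_ge0 ?ltW.
  have h4 : 0 <= bb ^+ 2 * (w ^+ 2 + y ^+ 2) by rewrite mulr_ge0 ?sqr_ge0 ?ltW.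
  by apply/andP; split; lra.
Qed.

End PoissonApproximation.

Section WeakConvergence.
Variables (R : realType) (a b : R^nat).
Hypothesis a_gt0 : forall n, 0 < a n.
Notation p := (orthpoly a b).
Notation gauss := (gauss b a_gt0).

(** The Carleman condition gives growth off the real axis: by the
    Christoffel-Darboux formula each product |p_k(z) p_(k+1)(z)| is at least
    Im z / a_k. *)
Lemma cCDkernel_ge_sum m z : 0 < complex.Im z ->
  complex.Im z * \sum_(k < m) (a k)^-1 <= cCDkernel a b m.+1 z.
Proof.
move=> z0; pose f k := csqnorm (ceval z (p k)).
have f0 k : 0 <= f k by rewrite /f /csqnorm addr_ge0 ?sqr_ge0.
have step k : complex.Im z / a k <= (f k + f k.+1) / 2.
  rewrite ler_pdivrMr //.
  have h1 : complex.Im z * 1 <= complex.Im z * cCDkernel a b k.+1 z.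
    by rewrite (ler_wpM2l (ltW z0)) // cCDkernel_ge1.
  rewrite -[leLHS]mulr1; apply: (le_trans h1).
  rewrite christoffel_darboux_im // [leRHS]mulrC (ler_wpM2l (ltW (a_gt0 k))) // /f /csqnorm.
  case: (ceval z (p k.+1)) => u v; case: (ceval z (p k)) => u' v' /=.
  have := sqr_ge0 (v - u'); have := sqr_ge0 (u + v'); lra.
rewrite mulr_sumr.
apply: (@le_trans _ _ (\sum_(k < m) (f k + f k.+1) / 2)).
  by apply: ler_sum => k _; exact: step.
rewrite -mulr_suml ler_pdivrMr // big_split /= mulr_natr mulr2n.
apply: lerD; first by rewrite /cCDkernel big_ord_recr lerDl; exact: f0.
by rewrite /cCDkernel big_ord_recl; apply: ler_wpDl => //; exact: f0.
Qed.

Lemma gauss_sum m n (f : nat -> R -> R) :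
  gauss m (fun x => \sum_(k < n) f k x) = \sum_(k < n) gauss m (f k).
Proof.
elim: n => [|n IH].
  by rewrite big_ord0 /gauss big1 // => x _; rewrite big_ord0 mul0r.
rewrite big_ord_recr /= -IH -gaussD.
by apply: eq_gauss => x; rewrite big_ord_recr.
Qed.

Lemma gauss_sqr m (c : nat -> R) :
  gauss m (fun x => (\sum_(k < m) c k *: p k).[x] ^+ 2) =
  \sum_(k < m) c k ^+ 2.
Proof.
have -> : gauss m (fun x => (\sum_(k < m) c k *: p k).[x] ^+ 2) =
  gauss m (fun x => \sum_(k < m) \sum_(l < m)
     (c k * c l) * ((p k).[x] * (p l).[x])).
  apply: eq_gauss => x; rewrite horner_sum expr2 mulr_suml.
  apply: eq_bigr => k _; rewrite mulr_sumr; apply: eq_bigr => l _.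
  by rewrite !hornerZ; ring.
rewrite (gauss_sum m m (fun k x => \sum_(l < m)
     (c k * c l) * ((p k).[x] * (p l).[x]))).
apply: eq_bigr => k _.
rewrite (gauss_sum m m (fun l x => (c k * c l) * ((p k).[x] * (p l).[x]))).
rewrite (bigD1 k) //= gaussZ gauss_orthonormal // eqxx mulr1 -expr2.
rewrite big1 ?addr0 // => l lk.
rewrite gaussZ gauss_orthonormal // (_ : (k == l :> nat) = false) ?mulr0 //.
by apply/negbTE; rewrite eq_sym.
Qed.

Variable mu : probability (measurableTypeR R) R.
Hypothesis mu_orth : orthonormal_polys mu p.

Lemma integrable_poly (q : {poly R}) :
  mu.-integrable setT (EFin \o (fun x => q.[x])).
Proof.
have [] // := @quadrature_exact_size _ _ b a_gt0 mu mu_orth (size q) q.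
by rewrite -addnn -addnS leq_addr.
Qed.

Lemma Rintegral_gauss m (q : {poly R}) : (size q <= m.*2.+1)%N ->
  \int[mu]_x q.[x] = gauss m.+1 (fun x => q.[x]).
Proof.
by move=> /(quadrature_exact_size a_gt0 mu_orth) [_ qE]; rewrite /Rintegral qE.
Qed.

Lemma integrable_poisson y x : 0 < y ->
  mu.-integrable setT (EFin \o poisson y x).
Proof.
move=> y0; apply: measurable_bounded_integrable => //.
- by rewrite (le_lt_trans (probability_le1 mu measurableT)) // ltry.
- by apply: continuous_measurable_fun; exact: continuous_poisson.
- exists y^-1; split => [|M yM t _]; first exact: num_real.
  by rewrite /= ger0_norm ?poisson_ge0 // (le_trans (poisson_le _ _ y0)) // ltW.
Qed.

Lemma gauss_norm_le m f : `|gauss m f| <= gauss m (fun x => `|f x|).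
Proof.
case: m => [|m].
  by rewrite /gauss (size0nil (size_zeros b a_gt0 0)) !big_nil normr0.
apply: (le_trans (ler_norm_sum _ _ _)); apply: ler_sum => x _.
by rewrite normrM [`|_^-1|]ger0_norm // invr_ge0 ltW // CDkernel_gt0.
Qed.

(** The quadrature integrates r exactly, and the error term of [poisson_approx]
    has the same integral 1/(y S) for the quadrature and for the measure. *)
Lemma gauss_poisson m (x y : R) : 0 < y ->
  `|gauss m.+1 (poisson y x) - \int[mu]_t poisson y x t| <=
    2 / (y * cCDkernel a b m.+1 (x +i* y)%C).
Proof.
move=> y0; have [r [c [d [szr cdS rP]]]] := poisson_approx b a_gt0 m x y0.
set A := \sum_(k < m.+1) c k *: p k in rP.
set B := \sum_(k < m.+1) d k *: p k in rP.
set S := cCDkernel _ _ _ _ in cdS *.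
pose W := y^-1 *: (A * A + B * B).
have We t : W.[t] = (A.[t] ^+ 2 + B.[t] ^+ 2) / y.
  by rewrite /W hornerZ hornerD !hornerM -!expr2 mulrC.
have WS : gauss m.+1 (fun t => W.[t]) = (y * S)^-1.
  rewrite (eq_gauss b a_gt0 m.+1 (g := fun t => y^-1 * (A.[t] ^+ 2 + B.[t] ^+ 2))).
    by rewrite gaussZ gaussD !gauss_sqr -big_split /= cdS invfM.
  by move=> t; rewrite We mulrC.
have szAB (f : nat -> R) : (size (\sum_(k < m.+1) f k *: p k)%R <= m.+1)%N.
  apply: (leq_trans (size_sum _ _ _)); apply/bigmax_leqP => k _.
  by apply: (leq_trans (size_scale_leq _ _)); rewrite size_orthpoly.
have szsq (f : nat -> R) :
    (size ((\sum_(k < m.+1) f k *: p k) * (\sum_(k < m.+1) f k *: p k))%R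
       <= m.*2.+1)%N.
  apply: (leq_trans (size_polyMleq _ _)); rewrite -subn1 leq_subLR add1n.
  by rewrite (leq_trans (leq_add (szAB f) (szAB f))) // addnn doubleS.
have WI : \int[mu]_t W.[t] = (y * S)^-1.
  rewrite (@Rintegral_gauss m) //.
  rewrite (leq_trans (size_scale_leq _ _)) // (leq_trans (size_polyD _ _)) //.
  by rewrite geq_max !szsq.
have rE : \int[mu]_t r.[t] = gauss m.+1 (fun t => r.[t]).
  by apply: Rintegral_gauss; rewrite (leq_trans szr).
have near_r : `|\int[mu]_t poisson y x t - \int[mu]_t r.[t]| <= (y * S)^-1.
  rewrite -RintegralB //; [|exact: integrable_poisson|exact: integrable_poly].
  have iB : mu.-integrable setT (EFin \o (fun t => poisson y x t - r.[t])).
    rewrite (_ : _ \o _ = (EFin \o poisson y x) \- (EFin \o (fun t => r.[t])))%E.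
      by apply: integrableB; [|exact: integrable_poisson|exact: integrable_poly].
    by apply/funext.
  apply: (le_trans (le_normr_Rintegral _ iB)) => //.
  rewrite -WI; apply: le_Rintegral => //.
  - exact: integrable_norm.
  - exact: integrable_poly.
  - by move=> t _; rewrite We.
have near_g : `|gauss m.+1 (poisson y x) - gauss m.+1 (fun t => r.[t])| <=
    (y * S)^-1.
  have -> : gauss m.+1 (poisson y x) - gauss m.+1 (fun t => r.[t]) =
    gauss m.+1 (fun t => poisson y x t - r.[t]).
    rewrite -mulN1r -gaussZ -gaussD; apply: eq_gauss => t; by rewrite mulN1r.
  apply: (le_trans (gauss_norm_le _ _)); rewrite -WS.
  by apply: gauss_le => t; rewrite We.
have -> : gauss m.+1 (poisson y x) - \int[mu]_t poisson y x t =
  (gauss m.+1 (poisson y x) - gauss m.+1 (fun t => r.[t])) -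
  (\int[mu]_t poisson y x t - \int[mu]_t r.[t]) by rewrite rE; ring.
apply: (le_trans (ler_normB _ _)).
by rewrite (le_trans (lerD near_g near_r)) // -mulr2n mulr_natl.
Qed.

Hypothesis carleman : \sum_(k < m) (a k)^-1 @[m --> \oo] --> +oo.

(** The functions on which the quadratures converge to mu. *)
Definition weakly_tested (f : R -> R) : Prop :=
  mu.-integrable setT (EFin \o f) /\
  gauss m f @[m --> \oo] --> \int[mu]_x f x.

Lemma weakly_tested_poisson y x : 0 < y -> weakly_tested (poisson y x).
Proof.
move=> y0; split; first exact: integrable_poisson.
rewrite -cvg_shiftS; apply/cvgrPdist_le => e e0.
have /cvgryPge/(_ (2 / (e * y ^+ 2))) := carleman.
apply: filterS => m Hm; rewrite distrC.
apply: (le_trans (gauss_poisson _ _ y0)).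
have h1 := @cCDkernel_ge_sum m (x +i* y)%C y0; rewrite /= in h1.
have S0 : 0 < cCDkernel a b m.+1 (x +i* y)%C.
  exact: lt_le_trans ltr01 (cCDkernel_ge1 _ _ _ _).
rewrite ler_pdivrMr ?mulr_gt0 //.
have : 2 / (e * y ^+ 2) * (e * y ^+ 2) <= cCDkernel a b m.+1 (x +i* y)%C / y * (e * y ^+ 2).
  apply: ler_wpM2r; first by rewrite mulr_ge0 ?sqr_ge0 ?ltW.
  apply: le_trans Hm _.
  by rewrite ler_pdivlMr // mulrC.
rewrite divfK ?mulf_neq0 ?expf_neq0 ?gt_eqF //.
by rewrite (_ : _ / y * _ = e * (y * cCDkernel a b m.+1 (x +i* y)%C)) //; field; rewrite gt_eqF.
Qed.

Lemma weakly_testedD f g : weakly_tested f -> weakly_tested g ->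
  weakly_tested (fun x => f x + g x).
Proof.
move=> [fi fc] [gi gc]; split.
  rewrite (_ : _ \o _ = (EFin \o f) \+ (EFin \o g))%E; first exact: integrableD.
  by apply/funext.
rewrite RintegralD //; under eq_fun do rewrite gaussD; exact: cvgD.
Qed.

Lemma weakly_testedZ c f : weakly_tested f -> weakly_tested (fun x => c * f x).
Proof.
move=> [fi fc]; split.
  rewrite (_ : _ \o _ = (fun x => c%:E * (EFin \o f) x))%E; first exact: integrableZl.
  by apply/funext.
by rewrite RintegralZl //; under eq_fun do rewrite gaussZ; exact: cvgMr.
Qed.

Lemma weakly_tested_sum n (f : nat -> R -> R) :
    (forall k, (k < n)%N -> weakly_tested (f k)) ->
  weakly_tested (fun x => \sum_(k < n) f k x).
Proof.
elim: n => [|n IH] fk.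
  under eq_fun do rewrite big_ord0.
  have := @weakly_testedZ 0 _ (weakly_tested_poisson 0 ltr01).
  by under eq_fun do rewrite mul0r.
under eq_fun do rewrite big_ord_recr /=.
apply: weakly_testedD; last exact: fk.
by apply: IH => k kn; apply: fk; rewrite ltnW.
Qed.

End WeakConvergence.

Lemma cvg_along (R : realType) (f : R^nat) (h : nat -> nat) (F : set_system R) :
  (forall n, n <= h n)%N -> f n @[n --> \oo] --> F -> f (h n) @[n --> \oo] --> F.
Proof.
move=> hn cf P FP; have [n0 _ HP] := cf P FP; exists n0 => // n /= n0n.
by apply: HP => /=; rewrite (leq_trans n0n).
Qed.

Section BumpFunctions.
Variables (R : realType) (a b : R^nat).
Hypothesis a_gt0 : forall n, 0 < a n.
Notation p := (orthpoly a b).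
Notation gauss := (gauss b a_gt0).
Variable mu : probability (measurableTypeR R) R.
Hypothesis mu_orth : orthonormal_polys mu p.
Hypothesis carleman : \sum_(k < m) (a k)^-1 @[m --> \oo] --> +oo.
Notation weakly_tested := (weakly_tested b a_gt0 mu).

Lemma is_derive_atan_poisson (y t x : R) : 0 < y ->
  is_derive x 1 (fun x => atan ((x - t) / y)) (poisson y x t).
Proof.
move=> y0; have D : is_derive x 1 (fun x => (x - t) / y) y^-1.
  by apply: is_derive_eq; rewrite scaler0 add0r subr0 /GRing.scale /= mulr1.
have -> : poisson y x t = (1 + ((x - t) / y) ^+ 2)^-1 * y^-1.
  rewrite /poisson; field.
  by apply/andP; split; rewrite gt_eqF // addrC poisson_den_gt0.
exact: (is_derive1_comp (is_derive1_atan _) D).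
Qed.

Lemma poisson_step (y t x h : R) : 0 < y -> 0 < h ->
  `|h * poisson y x t - (atan ((x + h - t) / y) - atan ((x - t) / y))|
    <= h ^+ 2 / y ^+ 2.
Proof.
move=> y0 h0; have xh : x < x + h by rewrite ltrDl.
have [|c cI ->] := @MVT R (fun x => atan ((x - t) / y)) (fun x => poisson y x t) _ _ xh
  (fun z _ => is_derive_atan_poisson t z y0).
  apply: continuous_subspaceT => z; apply: differentiable_continuous.
  by apply/derivable1_diffP; have [] := is_derive_atan_poisson t z y0.
have {}cI : `|x - c| <= h.
  move: cI; rewrite in_itv /= => /andP [c1 c2].
  by rewrite distrC ger0_norm; lra.
have -> : x + h - x = h by ring.
rewrite [X in _ - X]mulrC -mulrBr normrM (gtr0_norm h0).
rewrite expr2 -mulrA (ler_wpM2l (ltW h0)) //.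
apply: (le_trans (poisson_lipschitz _ _ _ y0)).
by rewrite ler_wpM2r // invr_ge0 sqr_ge0.
Qed.

Lemma poisson_riemann_sum (y t x h : R) n : 0 < y -> 0 < h ->
  `|\sum_(k < n) h * poisson y (x + k%:R * h) t -
     (atan ((x + n%:R * h - t) / y) - atan ((x - t) / y))|
    <= n%:R * (h ^+ 2 / y ^+ 2).
Proof.
move=> y0 h0; elim: n => [|n IH].
  by rewrite big_ord0 mul0r mul0r addr0 subrr subrr normr0.
rewrite big_ord_recr /=.
have E : x + n.+1%:R * h = x + n%:R * h + h by rewrite -natr1; ring.
have S := poisson_step t (x + n%:R * h) y0 h0.
rewrite -E in S.
rewrite [leRHS](_ : _ = n%:R * (h ^+ 2 / y ^+ 2) + h ^+ 2 / y ^+ 2); last first.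
  by rewrite -natr1 mulrDl mul1r.
move: S IH; set S1 := (\sum_(_ < n) _); set A := atan _; set B := atan _.
set C := atan _ => S IH.
have -> : S1 + h * poisson y (x + n%:R * h) t - (A - C) =
   (S1 - (B - C)) + (h * poisson y (x + n%:R * h) t - (A - B)) by ring.
exact: (le_trans (ler_normD _ _) (lerD IH S)).
Qed.

(** A Riemann sum of Poisson kernels is uniformly close to a difference of
    arctangents, which tends to an indicator function as y tends to 0. *)
Lemma weakly_tested_bump (c d eta e : R) : c <= d -> 0 < eta -> 0 < e ->
  exists F : R -> R, [/\ weakly_tested F,
    forall t, 0 <= F t <= 1 + e,
    forall t, c <= t <= d -> 1 - e <= F t &
    forall t, (t < c - eta) || (d + eta < t) -> F t <= e].
Proof.
move=> cd eta0 e0.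
have pi0 : 0 < pi :> R by exact: pi_gt0.
have [M M0 HM] : exists2 M : R, 0 < M & pi / 2 - atan M <= e * pi / 4.
  have e4 : 0 < e * pi / 4 by rewrite divr_gt0 // mulr_gt0.
  have /cvgrPdist_le/(_ _ e4) [M [_ HM]] := @cvgy_atan R.
  exists (`|M| + 1); first by rewrite ltr_wpDl.
  apply: (le_trans (ler_norm _)); apply: HM.
  by rewrite (le_lt_trans (ler_norm M)) // ltrDl.
(* With this y the argument of the arctangents reaches M at the distance
   eta / 2 from their jumps. *)
set y := eta / (2 * M); have y0 : 0 < y by rewrite divr_gt0 // mulr_gt0.
set c' := c - eta / 2; set L := (d - c) + eta.
have L0 : 0 < L by rewrite /L; lra.
have B0 : 0 < e * pi / 2 by rewrite divr_gt0 // mulr_gt0.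
have Q0 : 0 <= L ^+ 2 / y ^+ 2 by rewrite divr_ge0 ?sqr_ge0.
set n := (Num.Def.archi_bound (L ^+ 2 / y ^+ 2 / (e * pi / 2))).+1.
have Hn : n%:R * ((L / n%:R) ^+ 2 / y ^+ 2) <= e * pi / 2.
  have n0 : 0 < n%:R :> R by rewrite ltr0n.
  have -> : n%:R * ((L / n%:R) ^+ 2 / y ^+ 2) = L ^+ 2 / y ^+ 2 / n%:R.
    by field; rewrite !gt_eqF.
  rewrite ler_pdivrMr // [leRHS]mulrC -ler_pdivrMr //; apply: ltW.
  apply: (lt_trans (Num.Theory.archi_boundP _)); first by rewrite divr_ge0 // ltW.
  by rewrite ltr_nat.
have h0 : 0 < L / n%:R by rewrite divr_gt0 ?ltr0n.
pose F t := pi^-1 * \sum_(k < n) (L / n%:R) * poisson y (c' + k%:R * (L / n%:R)) t.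
pose G t := atan ((d + eta / 2 - t) / y) - atan ((c' - t) / y).
have FG t : `|pi * F t - G t| <= e * pi / 2.
  have := poisson_riemann_sum t c' n y0 h0.
  have -> : c' + n%:R * (L / n%:R) = d + eta / 2.
    by rewrite mulrC divfK ?pnatr_eq0 // /c' /L; lra.
  by rewrite /F mulVKf ?gt_eqF // => /le_trans; apply.
have up (u : R) : atan u <= pi / 2 by exact/ltW/atan_ltpi2.
have lo (u : R) : - (pi / 2) <= atan u by exact/ltW/atan_gtNpi2.
have big t : eta / 2 <= t -> pi / 2 - e * pi / 4 <= atan (t / y).
  move=> ht; apply: (@le_trans _ _ (atan M)); first by lra.
  apply: le_atan; rewrite ler_pdivlMr // /y.
  by rewrite (_ : M * _ = eta / 2) //; field; rewrite gt_eqF.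
have small t : t <= - (eta / 2) -> atan (t / y) <= - (pi / 2 - e * pi / 4).
  move=> ht; have := big (- t); rewrite mulNr atanN; lra.
have key t (l : R) : pi * l <= G t - e * pi / 2 -> l <= F t.
  move=> H; rewrite -(ler_pM2l pi0); have := FG t; rewrite ler_norml; lra.
have key' t (l : R) : G t + e * pi / 2 <= pi * l -> F t <= l.
  move=> H; rewrite -(ler_pM2l pi0); have := FG t; rewrite ler_norml; lra.
exists F; split.
- apply: weakly_testedZ; apply: (weakly_tested_sum mu_orth carleman
    (f := fun k t => L / n%:R * poisson y (c' + k%:R * (L / n%:R)) t)) => k _.
  by apply: weakly_testedZ; exact: (weakly_tested_poisson a_gt0 mu_orth carleman).
- move=> t; apply/andP; split.
    apply: mulr_ge0; first by rewrite invr_ge0 ltW.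
    by apply: sumr_ge0 => k _; rewrite mulr_ge0 ?poisson_ge0 // ltW.
  apply: key'; rewrite /G; have := up ((d + eta / 2 - t) / y).
  have := lo ((c' - t) / y); lra.
- move=> t /andP [ct td]; apply: key; rewrite /G.
  have := big (d + eta / 2 - t); have := small (c' - t).
  rewrite /c'; lra.
- move=> t /orP [tc|td]; apply: key'; rewrite /G.
    have := big (c' - t); have := up ((d + eta / 2 - t) / y).
    rewrite /c'; lra.
  have := small (d + eta / 2 - t); have := lo ((c' - t) / y); lra.
Qed.

Lemma affine_indic (A : set (measurableTypeR R)) (u v : R) : measurable A ->
  mu.-integrable setT (EFin \o (fun x => u * \1_A x + v)) /\
  \int[mu]_x (u * \1_A x + v) = u * fine (mu A) + v.
Proof.
move=> mA.
have finmu : (mu setT < +oo)%E.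
  by rewrite (le_lt_trans (probability_le1 mu measurableT)) // ltry.
have ind : mu.-integrable setT (EFin \o (fun x => \1_A x : R)).
  apply: measurable_bounded_integrable => //; first exact: measurable_indic.
  exists 1; split => [|M M1 t _]; first exact: num_real.
  by rewrite /= indicE ger0_norm // (le_trans _ (ltW M1)) // lern1 leq_b1.
have cstv : mu.-integrable setT (EFin \o (fun x : measurableTypeR R => v)).
  apply: measurable_bounded_integrable => //.
  by exists `|v|; split => [|M M1 t _]; [exact: num_real|exact: ltW].
have uind : mu.-integrable setT (EFin \o (fun x => u * \1_A x)).
  have -> : EFin \o (fun x => u * \1_A x) =
      (fun x : measurableTypeR R => (u%:E * (EFin \o (fun x => \1_A x : R)) x)%E).
    by apply/funext.
  exact: integrableZl.
split.
  have -> : EFin \o (fun x => u * \1_A x + v) =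
      ((EFin \o (fun x : measurableTypeR R => (u * \1_A x)%R)) \+
       (EFin \o (fun x : measurableTypeR R => v)))%E.
    by apply/funext.
  exact: integrableD.
rewrite RintegralD // RintegralZl //; congr (u * _ + _).
  by rewrite /Rintegral integral_indic // setIT.
transitivity (v * fine (mu setT)); first exact: Rintegral_cst.
by rewrite probability_setT mulr1.
Qed.

Lemma gauss_cst1 m : gauss m.+1 (cst 1) = 1.
Proof.
rewrite -[RHS](@gauss_orthonormal _ _ b a_gt0 m.+1 0 0) //.
by apply: eq_gauss => x; rewrite !hornerC mulr1.
Qed.

Definition gauss_mass m (c d : R) := gauss m (\1_(`[c, d]%classic : set R)).

(** Half of the portmanteau theorem, along the quadratures of index h n: bump
    functions squeezed between the two intervals compare the masses. *)
Lemma mass_le_limsup (h : nat -> nat) (c d eta B : R) :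
    (forall n, n < h n)%N -> c <= d -> 0 < eta ->
    (\forall n \near \oo, gauss_mass (h n) (c - eta) (d + eta) <= B) ->
  fine (mu `[c, d]%classic) <= B.
Proof.
move=> hn cd eta0 HB.
have B0 : 0 <= B.
  near \oo => m; apply: (@le_trans _ _ (gauss_mass (h m) (c - eta) (d + eta))).
    rewrite -[leLHS](_ : gauss (h m) (fun=> 0 * 0) = 0).
      by apply: gauss_le => t; rewrite mul0r indicE ler0n.
    by rewrite gaussZ mul0r.
  by near: m.
apply/ler_addgt0Pr => e' e'0; set e := Num.min (e' / (B + 2)) 1.
have e0 : 0 < e.
  by rewrite lt_min ltr01 andbT divr_gt0 // ltr_wpDl.
have eB : e * (B + 2) <= e'.
  by rewrite -ler_pdivlMr ?ltr_wpDl // ge_min lexx.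
have [F [[Fi /(cvg_along (fun n => ltnW (hn n))) Fc] F1 Fin Fout]] :=
  weakly_tested_bump cd eta0 e0.
have mcd : measurable (`[c, d]%classic : set (measurableTypeR R)) by [].
have low : (1 - e) * fine (mu `[c, d]%classic) <= \int[mu]_x F x.
  have [iI] := affine_indic (1 - e) 0 mcd; rewrite addr0 => <-.
  apply: le_Rintegral => // t _; rewrite addr0 indicE.
  case: (boolP (t \in _)) => [|_]; last by rewrite mulr0; case/andP: (F1 t).
  by rewrite inE /= in_itv /= mulr1 => /Fin.
have high : \int[mu]_x F x <= (1 + e) * B + e.
  rewrite -(cvg_lim _ Fc) //; apply: limr_le; first exact: cvgP Fc.
  near=> m.
  have hm : h m = (h m).-1.+1 by rewrite prednK // (leq_ltn_trans _ (hn m)).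
  rewrite hm; apply: (@le_trans _ _ (gauss (h m).-1.+1 (fun t =>
     (1 + e) * \1_(`[c - eta, d + eta]%classic : set R) t + e * cst 1 t))).
    apply: gauss_le => t; rewrite indicE; case: (boolP (t \in _)) => [|].
      by rewrite /= !mulr1; have /andP [_] := F1 t; lra.
    rewrite notin_setE /= in_itv /= => /negP; rewrite negb_and -!ltNge => /Fout.
    by rewrite mulr0 add0r mulr1.
  rewrite gaussD !gaussZ gauss_cst1 mulr1 lerD2r ler_wpM2l ?(addr_ge0 ler01 (ltW e0)) //.
  by rewrite -hm; near: m.
have mu0 : 0 <= fine (mu `[c, d]%classic) by exact: fine_ge0.
have mu1 : fine (mu `[c, d]%classic) <= 1.
  have := probability_le1 mu mcd.
  by rewrite -(fineK (fin_num_measure mu _ mcd)) lee_fin.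
have e1 : e <= 1 by rewrite ge_min lexx orbT.
nra.
Unshelve. all: end_near. Qed.

Lemma liminf_le_mass (h : nat -> nat) (c d eta B : R) :
    (forall n, n < h n)%N -> c <= d -> 0 < eta ->
    (\forall n \near \oo, B <= gauss_mass (h n) c d) ->
  B <= fine (mu `[c - eta, d + eta]%classic).
Proof.
move=> hn cd eta0 HB; set I := `[c - eta, d + eta]%classic.
have mI : measurable (I : set (measurableTypeR R)) by exact: measurable_itv.
have mu0 : 0 <= fine (mu I) by exact: fine_ge0.
have mu1 : fine (mu I) <= 1.
  have := probability_le1 mu mI.
  by rewrite -(fineK (fin_num_measure mu _ mI)) lee_fin.
have [B0|B0] := leP B 0; first exact: le_trans B0 mu0.
apply/ler_addgt0Pr => e' e'0; set e := Num.min (e' / (B + 2)) 1.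
have e0 : 0 < e.
  by rewrite lt_min ltr01 andbT divr_gt0 // ltr_wpDl // ltW.
have eB : e * (B + 2) <= e'.
  by rewrite -ler_pdivlMr ?ge_min ?lexx // ltr_wpDl // ltW.
have e1 : e <= 1 by rewrite ge_min lexx orbT.
have [F [[Fi /(cvg_along (fun n => ltnW (hn n))) Fc] F1 Fin Fout]] :=
  weakly_tested_bump cd eta0 e0.
have high : \int[mu]_x F x <= (1 + e) * fine (mu I) + e.
  have [iI <-] := affine_indic (1 + e) e mI.
  apply: le_Rintegral => //.
  move=> t _; rewrite indicE; case: (boolP (t \in _)) => [|].
    by rewrite /= !mulr1; have /andP [_] := F1 t; lra.
  rewrite notin_setE /I /= in_itv /= => /negP; rewrite negb_and -!ltNge => /Fout.
  by rewrite mulr0 add0r.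
have low : (1 - e) * B <= \int[mu]_x F x.
  rewrite -(cvg_lim _ Fc) //; apply: limr_ge; first exact: cvgP Fc.
  near=> m; apply: (@le_trans _ _ ((1 - e) * gauss_mass (h m) c d)).
    by rewrite ler_wpM2l ?subr_ge0 //; near: m.
  rewrite /gauss_mass -gaussZ; apply: gauss_le => t.
  rewrite indicE; case: (boolP (t \in _)) => [|_].
    by rewrite inE /= in_itv /= mulr1 => /Fin.
  by rewrite mulr0; case/andP: (F1 t).
nra.
Unshelve. all: end_near. Qed.

End BumpFunctions.

(** * Sequences of bounded variation modulo a period *)

Lemma bounded_series_is_cvg (R : realType) (e : R^nat) (B : R) :
    (forall n, 0 <= e n) -> (forall n, \sum_(0 <= k < n) e k <= B) ->
  cvgn (series e).
Proof.
move=> e0 HB; apply: nondecreasing_is_cvgn; last first.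
  by exists B => _ [n _ <-]; exact: HB.
by apply/nondecreasing_seqP => n; rewrite /series /= big_nat_recr //= lerDl.
Qed.

Section PeriodicVariation.
Variables (R : realType) (N : nat).
Hypothesis N_gt0 : (0 < N)%N.

(** The uniform version of the class D_1^N: families of continuous functions,
    bounded and of summable N-step variation, both uniformly on bounded sets. *)
Definition periodic_bv (F : nat -> R -> R) : Prop :=
  (forall m, continuous (F m)) /\
  forall M, exists C, exists2 e : R^nat, (forall m, 0 <= e m) /\ cvgn (series e) &
    forall m x, (N <= m)%N -> `|x| <= M ->
      `|F m x| <= C /\ `|F (m + N)%N x - F m x| <= e m.

Lemma periodic_bv_cst (f : R -> R) : continuous f ->
  (forall M, exists C, forall x, `|x| <= M -> `|f x| <= C) ->
  periodic_bv (fun _ => f).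
Proof.
move=> cf bf; split => // M; have [C HC] := bf M; exists C, (fun=> 0).
  split => //; apply/cvg_ex; exists 0; rewrite (_ : series _ = cst 0).
    exact: cvg_cst.
  by apply/funext => n; rewrite /series /= big1.
by move=> m x _ /HC xC; rewrite subrr normr0.
Qed.

Lemma periodic_bv_const (c : R) : periodic_bv (fun _ _ => c).
Proof.
apply: (@periodic_bv_cst (fun=> c)); first by move=> x; exact: cvg_cst.
by move=> M; exists `|c|.
Qed.

Lemma periodic_bv_id : periodic_bv (fun _ x => x).
Proof.
by apply: (@periodic_bv_cst id) => [x|M]; [exact: cvg_id|exists M].
Qed.

Lemma periodic_bvD F G : periodic_bv F -> periodic_bv G ->
  periodic_bv (fun m x => F m x + G m x).
Proof.
move=> [cF bF] [cG bG]; split => [m x|M]; first by apply: cvgD; [exact: cF|exact: cG].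
have [C [e [e0 ce] He]] := bF M; have [D [f [f0 cf] Hf]] := bG M.
exists (C + D), (fun m => e m + f m).
  split=> [m|]; first exact: addr_ge0.
  have -> : series (fun m => e m + f m) = series e \+ series f.
    by apply/funext => n; rewrite /series /= big_split.
  exact: is_cvgD.
move=> m x mN xM; have [F1 F2] := He m x mN xM; have [G1 G2] := Hf m x mN xM.
split; first exact: (le_trans (ler_normD _ _) (lerD F1 G1)).
rewrite (_ : _ - _ = (F (m + N)%N x - F m x) + (G (m + N)%N x - G m x)); last by ring.
exact: (le_trans (ler_normD _ _) (lerD F2 G2)).
Qed.

Lemma periodic_bvM F G : periodic_bv F -> periodic_bv G ->
  periodic_bv (fun m x => F m x * G m x).
Proof.
move=> [cF bF] [cG bG]; split => [m x|M]; first by apply: cvgM; [exact: cF|exact: cG].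
have [C [e [e0 ce] He]] := bF M; have [D [f [f0 cf] Hf]] := bG M.
exists (C * D), (fun m => `|C| * f m + `|D| * e m).
  split=> [m|]; first by rewrite addr_ge0 // mulr_ge0.
  have -> : series (fun m => `|C| * f m + `|D| * e m) =
      (fun n => `|C| * series f n + `|D| * series e n).
    by apply/funext => n; rewrite /series /= big_split !mulr_sumr.
  by apply: is_cvgD; apply: is_cvgMr.
move=> m x mN xM; have [F1 F2] := He m x mN xM; have [G1 G2] := Hf m x mN xM.
split; first by rewrite normrM ler_pM.
rewrite (_ : _ - _ = F (m + N)%N x * (G (m + N)%N x - G m x) +
   G m x * (F (m + N)%N x - F m x)); last by ring.
have [F1' _] := He (m + N)%N x (leq_trans mN (leq_addr _ _)) xM.
apply: (le_trans (ler_normD _ _)); rewrite !normrM.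
by apply: lerD; apply: ler_pM => //; apply: (le_trans _ (ler_norm _)).
Qed.

Lemma periodic_bvN F : periodic_bv F -> periodic_bv (fun m x => - F m x).
Proof.
move=> bF; have := periodic_bvM (periodic_bv_const (-1)) bF.
by congr (periodic_bv _); apply/funext => m; apply/funext => x; rewrite mulN1r.
Qed.

Lemma periodic_bv_sum n (F : nat -> nat -> R -> R) :
  (forall k, periodic_bv (F k)) ->
  periodic_bv (fun m x => \sum_(k < n) F k m x).
Proof.
move=> bF; elim: n => [|n IH].
  have := periodic_bv_const 0; congr (periodic_bv _).
  by apply/funext => m; apply/funext => x; rewrite big_ord0.
have := periodic_bvD IH (bF n); congr (periodic_bv _).
by apply/funext => m; apply/funext => x; rewrite big_ord_recr.
Qed.

Lemma periodic_bv_shift l F : periodic_bv F ->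
  periodic_bv (fun m x => F (m + l)%N x).
Proof.
move=> [cF bF]; split => [m|M]; first exact: cF.
have [C [e [e0 ce] He]] := bF M; exists C, (fun m => e (m + l)%N).
  split => //; have [B HB] := cvg_has_ub ce.
  apply: (@bounded_series_is_cvg _ _ B) => // n.
  apply: (@le_trans _ _ (series e (n + l)%N)); last first.
    by apply: (le_trans (ler_norm _)); apply: HB; exists (n + l)%N.
  rewrite /series /= (@big_cat_nat _ _ _ l 0 (n + l)) ?leq_addl //=.
  have -> : \sum_(l <= i < n + l) e i = \sum_(0 <= i < n) e (i + l)%N.
    by rewrite -{1}[l]add0n big_addn addnK.
  by rewrite lerDr sumr_ge0.
move=> m x mN xM; have [F1 F2] := He (m + l)%N x (leq_trans mN (leq_addr _ _)) xM.
by rewrite addnAC.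
Qed.

Lemma D1N_periodic_bv (u : R^nat) : D1N N u -> periodic_bv (fun m _ => u m).
Proof.
move=> uD; split => [m x|M]; first exact: cvg_cst.
have bnd i : exists C, (i < N)%N -> forall n, (0 < n)%N -> `|u (n * N + i)%N| <= C.
  have [iN|] := boolP (i < N)%N; last by exists 0.
  have [[B [_ HB]] _] := uD i iN; exists (B + 1) => _ n n0.
  by apply: HB => //; rewrite ltrDl.
have [Cf HC] := choice bnd.
pose e m := if (N <= m)%N then `|u (m + N)%N - u m| else 0.
have e0 m : 0 <= e m by rewrite /e; case: ifP.
have vari i : exists S, (i < N)%N -> forall n, \sum_(0 <= j < n) e (j * N + i)%N <= S.
  have [iN|] := boolP (i < N)%N; last by exists 0.
  have [_] := uD i iN; set S := (\sum_(1 <= n <oo) _)%E => Soo.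
  have S0 : (0 <= S)%E by apply: nneseries_ge0.
  exists (fine S) => _ [|n]; first by rewrite big_geq // fine_ge0.
  rewrite -lee_fin fineK ?ge0_fin_numE // big_ltn // {1}/e mul0n add0n.
  rewrite leqNgt iN /= add0r -sumEFin.
  rewrite (eq_big_nat _ _ (F2 := fun j =>
      `|u (j.+1 * N + i)%N - u (j * N + i)%N|%:E)); last first.
    move=> j /andP [j0 _]; rewrite /e (leq_trans (leq_pmull N j0)) ?leq_addr //.
    by rewrite addnAC -mulSnr.
  exact: (nneseries_lim_ge n.+1).
have [Sf HS] := choice vari.
exists (\sum_(i < N) `|Cf i|), e.
  split=> //; apply: (@bounded_series_is_cvg _ _ (\sum_(i < N) Sf i)) => // n.
  apply: (@le_trans _ _ (\sum_(0 <= m < n * N) e m)).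
    rewrite [leRHS](@big_cat_nat _ _ _ n) ?leq_pmulr //=.
    by rewrite lerDl sumr_ge0.
  have -> : \sum_(0 <= m < n * N) e m = \sum_(0 <= j < n) \sum_(i < N) e (j * N + i)%N.
    elim: n => [|n IH]; first by rewrite mul0n !big_geq.
    rewrite big_nat_recr //= -IH mulSn addnC.
    rewrite (@big_cat_nat _ _ _ (n * N)) ?leq_addr //=; congr (_ + _).
    rewrite -{1}[(n * N)%N]add0n big_addn addKn big_mkord.
    by apply: eq_bigr => i _; rewrite addnC.
  by rewrite exchange_big /=; apply: ler_sum => i _; apply: HS.
move=> m x mN _; split; last by rewrite /e mN.
have iN : (m %% N < N)%N by rewrite ltn_mod.
rewrite (divn_eq m N); apply: (@le_trans _ _ `|Cf (m %% N)%N|).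
  by apply: le_trans (ler_norm _); apply: HC => //; rewrite divn_gt0.
by rewrite (bigD1 (Ordinal iN)) //= lerDl sumr_ge0.
Qed.

Lemma sum_progression_le (e : R^nat) m k : (forall n, 0 <= e n) ->
  \sum_(0 <= j < k) e (m + j * N)%N <= series e (m + k * N)%N - series e m.
Proof.
move=> e0; elim: k => [|k IH]; first by rewrite mul0n addn0 subrr big_geq.
rewrite big_nat_recr //= mulSnr addnA; set n := (m + k * N)%N.
apply: le_trans (lerD IH (lexx _)) _; rewrite -/n addrAC lerD2r.
rewrite /series /= (@big_cat_nat _ _ _ n 0 (n + N)) ?leq_addr //= lerD2l.
rewrite [leRHS]big_ltn ?lerDl ?sumr_ge0 //.
by rewrite -[X in (X < _)%N]addn0 ltn_add2l.
Qed.

Lemma series_tail_le (e : R^nat) d : cvgn (series e) -> 0 < d ->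
  exists m0, forall m k, (m0 <= m)%N -> series e (m + k)%N - series e m <= d.
Proof.
move=> ce d0; have /cvg_cauchy /cauchy_ballP /(_ _ d0) := ce.
rewrite near_map2 => -[[A B] /= [[m1 _ Hm1] [m2 _ Hm2]] HAB].
exists (maxn m1 m2) => m k; rewrite geq_max => /andP [mm1 mm2].
have : ball (series e (m + k)%N) d (series e m).
  by apply: (HAB (_, _)); split; [apply: Hm1|apply: Hm2] => //=; rewrite (leq_trans mm1) ?leq_addr.
by rewrite /ball /= => /ltW; apply: le_trans (ler_norm _).
Qed.

(** Convergence along the residue classes, uniform on K, stated without naming
    the limits. *)
Definition progression_cauchy (K : set R) (F : nat -> R -> R) : Prop :=
  forall d, 0 < d -> exists m0, forall m k x, (m0 <= m)%N -> K x ->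
    `|F (m + k * N)%N x - F m x| <= d.

Lemma periodic_bv_cauchy F M : periodic_bv F ->
  progression_cauchy [set x | `|x| <= M] F.
Proof.
move=> [_ /(_ M) [C [e [e0 ce] He]]] d d0.
have [m1 Hm1] := series_tail_le ce d0.
exists (maxn N m1) => m k x; rewrite geq_max => /andP [mN mm1] /= xM.
apply: le_trans (Hm1 m (k * N)%N mm1).
apply: le_trans (sum_progression_le m k e0).
elim: k => [|k IH]; first by rewrite mul0n addn0 subrr normr0 big_geq.
have -> : F (m + k.+1 * N)%N x - F m x =
  (F (m + k * N)%N x - F m x) + (F (m + k * N + N)%N x - F (m + k * N)%N x).
  by rewrite mulSnr addnA; ring.
rewrite big_nat_recr //=; apply: (le_trans (ler_normD _ _)); apply: lerD => //.
by have [] := He (m + k * N)%N x (leq_trans mN (leq_addr _ _)) xM.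
Qed.

Definition periodic_lim (F : nat -> R -> R) (i : nat) (x : R) : R :=
  lim (F (n * N + i)%N x @[n --> \oo]).

Lemma periodic_lim_cvg K F i x : progression_cauchy K F -> K x ->
  F (n * N + i)%N x @[n --> \oo] --> periodic_lim F i x.
Proof.
move=> cF Kx; apply/cauchy_cvgP; apply/cauchy_ballP => d d0.
have d4 : 0 < d / 4 by rewrite divr_gt0.
have [m0 Hm0] := cF _ d4.
have near_m0 p : (m0 <= p)%N ->
    `|F (p * N + i)%N x - F (m0 * N + i)%N x| <= d / 4.
  move=> mp; rewrite -(subnKC mp) mulnDl addnAC.
  by apply: Hm0 => //; rewrite (leq_trans (leq_pmulr _ N_gt0)) ?leq_addr.
exists ([set r | `|r - F (m0 * N + i)%N x| <= d / 4],
        [set r | `|r - F (m0 * N + i)%N x| <= d / 4]).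
  by split; exists m0 => // p /= /near_m0.
move=> [r s] [/= rP sP]; rewrite /ball /=.
apply: (@le_lt_trans _ _ (d / 4 + d / 4)); last by lra.
have -> : r - s = (r - F (m0 * N + i)%N x) - (s - F (m0 * N + i)%N x) by ring.
exact: (le_trans (ler_normB _ _) (lerD rP sP)).
Qed.

Lemma periodic_lim_uniform K F d : progression_cauchy K F -> 0 < d ->
  exists m0, forall m x, (m0 <= m)%N -> K x ->
    `|F m x - periodic_lim F (m %% N)%N x| <= d.
Proof.
move=> cF d0; have [m0 Hm0] := cF _ d0.
exists m0 => m x m0m Kx.
have cFx := @periodic_lim_cvg K F (m %% N)%N x cF Kx.
have : `|F m x - F (n * N + m %% N)%N x| @[n --> \oo] -->
   `|F m x - periodic_lim F (m %% N) x|.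
  by apply: cvg_norm; apply: cvgB => //; exact: cvg_cst.
move=> /[dup] c; move/cvg_lim => <- //; apply: limr_le; first exact: cvgP c.
exists (m %/ N)%N => // n /= mn.
rewrite distrC -(subnKC mn) mulnDl addnAC -divn_eq; exact: Hm0.
Qed.

Lemma continuous_periodic_lim K F i x : (i < N)%N ->
    (forall m, continuous (F m)) -> progression_cauchy K F -> nbhs x K ->
  {for x, continuous (periodic_lim F i)}.
Proof.
move=> iN cF bF Kx; apply/cvgrPdist_le => d d0.
have d3 : 0 < d / 3 by rewrite divr_gt0.
have [m0 Hm0] := periodic_lim_uniform bF d3.
pose m := (m0 * N + i)%N.
have mi : (m %% N = i)%N by rewrite /m modnMDl modn_small.
have mm0 : (m0 <= m)%N by rewrite (leq_trans (leq_pmulr _ N_gt0)) ?leq_addr.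
have /cvgrPdist_le/(_ _ d3) Fx := cF m x.
near=> y.
have h1 := Hm0 m x mm0 (nbhs_singleton Kx).
have Ky : K y by near: y; exact: Kx.
have h2 := Hm0 m y mm0 Ky.
have h3 : `|F m x - F m y| <= d / 3 by near: y.
rewrite mi in h1 h2.
rewrite (_ : _ - _ = (F m x - F m y) - (F m x - periodic_lim F i x)
   + (F m y - periodic_lim F i y)); last by ring.
apply: (le_trans (ler_normD _ _)).
by have := ler_normB (F m x - F m y) (F m x - periodic_lim F i x); lra.
Unshelve. all: end_near. Qed.

Lemma nbhs_bounded (x : R) : nbhs x [set y | `|y| <= `|x| + 1].
Proof.
have /cvgrPdist_le/(_ _ ltr01) := @cvg_id _ (nbhs x).
apply: filterS => y xy /=.
have := ler_normB x (x - y); rewrite opprB addrC subrK; lra.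
Qed.

End PeriodicVariation.

(** * Spacing of zeros *)

Lemma near_right (R : realType) (P : R -> Prop) (x y : R) :
  (\forall u \near x, P u) -> x < y -> exists u, [/\ x < u, u < y & P u].
Proof.
move=> /nbhs_ballP [e /= e0 H] xy; exists (x + Num.min e (y - x) / 2).
have m0 : 0 < Num.min e (y - x) by rewrite lt_min e0 subr_gt0.
have me : Num.min e (y - x) <= e by rewrite ge_min lexx.
have my : Num.min e (y - x) <= y - x by rewrite ge_min lexx orbT.
split; [by lra|by lra|apply: H].
by rewrite /ball /= opprD addNKr normrN gtr0_norm ?divr_gt0 //; lra.
Qed.

Lemma near_left (R : realType) (P : R -> Prop) (x y : R) :
  (\forall u \near x, P u) -> y < x -> exists u, [/\ u < x, y < u & P u].
Proof.
move=> /nbhs_ballP [e /= e0 H] xy; exists (x - Num.min e (x - y) / 2).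
have m0 : 0 < Num.min e (x - y) by rewrite lt_min e0 subr_gt0.
have me : Num.min e (x - y) <= e by rewrite ge_min lexx.
have my : Num.min e (x - y) <= x - y by rewrite ge_min lexx orbT.
split; [by lra|by lra|apply: H].
by rewrite /ball /= opprB addrC subrK gtr0_norm ?divr_gt0 //; lra.
Qed.

Section ZeroSpacing.
Variables (R : realType) (P Q : {poly R}) (al be ga de : R).
Hypothesis al0 : 0 < al.
Hypothesis de0 : 0 < de.
Hypothesis disc : al * ga - be ^+ 2 = de ^+ 2.

Definition poly_wronskian x : R := Q^`().[x] * P.[x] - P^`().[x] * Q.[x].
Hypothesis wronskian_gt0 : forall x, 0 < poly_wronskian x.

Definition poly_form x : R :=
  al * P.[x] ^+ 2 + 2 * be * P.[x] * Q.[x] + ga * Q.[x] ^+ 2.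

(** The angle of (P, Q), in coordinates that make the form a multiple of the
    Euclidean norm. *)
Definition angle x : R := atan ((al * (P.[x] / Q.[x]) + be) / de).

Lemma is_derive_angle x : Q.[x] != 0 ->
  is_derive x 1 angle (- (de * poly_wronskian x / poly_form x)).
Proof.
move=> Qx.
have dV : is_derive x 1 (fun y => Q.[y]^-1) (- Q.[x] ^- 2 *: Q^`().[x]).
  exact: is_deriveV.
have D : is_derive x 1 (fun y => (al * (P.[y] / Q.[y]) + be) / de)
    (- (al * poly_wronskian x / Q.[x] ^+ 2 / de)).
  apply: is_derive_eq; rewrite !scaler0 ?addr0 ?add0r /GRing.scale /= /poly_wronskian.
  by field; rewrite Qx gt_eqF.
have key : al * poly_form x = (al * P.[x] + be * Q.[x]) ^+ 2 + de ^+ 2 * Q.[x] ^+ 2.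
  by rewrite -disc /poly_form; ring.
have pos : 0 < (al * P.[x] + be * Q.[x]) ^+ 2 + de ^+ 2 * Q.[x] ^+ 2.
  by rewrite ltr_wpDl ?sqr_ge0 // mulr_gt0 // exprn_even_gt0 //= gt_eqF.
have -> : - (de * poly_wronskian x / poly_form x) =
    (1 + ((al * (P.[x] / Q.[x]) + be) / de) ^+ 2)^-1 *
    - (al * poly_wronskian x / Q.[x] ^+ 2 / de).
  have -> : poly_form x = ((al * P.[x] + be * Q.[x]) ^+ 2 + de ^+ 2 * Q.[x] ^+ 2) / al.
    by rewrite -key mulrAC divff ?mul1r // gt_eqF.
  field; rewrite Qx !gt_eqF //=.
  by rewrite addrC exprMn [X in _ + X]mulrC.
exact: is_derive1_comp.
Qed.

Lemma poly_form_gt0 x : 0 < poly_form x.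
Proof.
have key : al * poly_form x = (al * P.[x] + be * Q.[x]) ^+ 2 + de ^+ 2 * Q.[x] ^+ 2.
  by rewrite -disc /poly_form; ring.
rewrite -(pmulr_rgt0 _ al0) key; have [Qx|Qx] := eqVneq Q.[x] 0.
  rewrite Qx !mulr0 addr0 expr0n mulr0 addr0 exprn_even_gt0 //=.
  rewrite mulf_eq0 gt_eqF //=; apply/eqP => Px; have := wronskian_gt0 x.
  by rewrite /poly_wronskian Px Qx !mulr0 subrr ltxx.
by rewrite ltr_wpDl ?sqr_ge0 // mulr_gt0 // exprn_even_gt0 //= gt_eqF.
Qed.

Variables (A B L H : R).
Hypothesis L_ge0 : 0 <= L.
Hypothesis speed : forall x, A <= x <= B ->
  L <= de * poly_wronskian x / poly_form x <= H.

Lemma angle_mvt x y : A <= x -> y <= B -> x < y ->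
    (forall z, x <= z <= y -> Q.[z] != 0) ->
  L * (y - x) <= angle x - angle y <= H * (y - x).
Proof.
move=> Ax yB xy Q0.
have dz z : z \in `]x, y[%R -> is_derive z 1 angle (- (de * poly_wronskian z / poly_form z)).
  rewrite in_itv /= => /andP [xz zy]; apply: is_derive_angle.
  by apply: Q0; rewrite !ltW.
have ca : {within `[x, y], continuous angle}.
  apply: continuous_in_subspaceT => z; rewrite inE /= in_itv /= => zxy.
  apply: differentiable_continuous; apply/derivable1_diffP.
  by have [] := is_derive_angle (Q0 z zxy).
have [c] := MVT xy dz ca.
rewrite in_itv /= => /andP [xc cy] E.
have yx : 0 <= y - x by rewrite subr_ge0 ltW.
have cAB : A <= c <= B.
  by rewrite (le_trans Ax (ltW xc)) (le_trans (ltW cy) yB).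
have /andP [s1 s2] := speed cAB.
have -> : angle x - angle y = de * poly_wronskian c / poly_form c * (y - x) by lra.
by rewrite !ler_wpM2r.
Qed.

(** While Q has no zero, the angle stays in an interval of length pi. *)
Lemma zero_free_gap x y : A <= x -> y <= B -> x < y ->
  (forall z, x <= z <= y -> Q.[z] != 0) -> L * (y - x) < pi.
Proof.
move=> Ax yB xy Q0; have /andP [h _] := angle_mvt Ax yB xy Q0.
apply: (le_lt_trans h); rewrite /angle.
set u := _ / de; set v := _ / de.
have := atan_ltpi2 u; have := atan_gtNpi2 v; lra.
Qed.

(** Where Q vanishes, P and Q' have the same sign, so that P / Q jumps from
    minus infinity to plus infinity. *)
Lemma ratio_near_zero z M : Q.[z] = 0 -> \forall y \near z,
  (z < y -> M <= P.[y] / Q.[y]) /\ (y < z -> P.[y] / Q.[y] <= M).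
Proof.
move=> Qz; have /factor_theorem [G QG] : root Q z by apply/rootP.
have W0 := wronskian_gt0 z; rewrite /poly_wronskian Qz mulr0 subr0 in W0.
have Gz : G.[z] = Q^`().[z].
  rewrite QG derivM derivB derivX derivC subr0 mulr1 hornerD hornerM.
  by rewrite !hornerE subrr mulr0 add0r.
have PG0 : 0 < P.[z] * G.[z] by rewrite Gz mulrC.
have G0 : G.[z] != 0 by apply/eqP => G0; rewrite G0 mulr0 ltxx in PG0.
have cf : {for z, continuous (fun y => P.[y] / G.[y] - (`|M| * (y - z) + `|M| * (z - y)))}.
  apply: cvgB.
    by apply: cvgM; [exact: continuous_horner|apply: cvgV => //; exact: continuous_horner].
  by apply: cvgD; apply: cvgM; (try exact: cvg_cst); apply: cvgB; (exact: cvg_cst || exact: cvg_id).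
pose c := P.[z] / G.[z].
have c0 : 0 < c.
  have : 0 < P.[z] * G.[z] / G.[z] ^+ 2 by rewrite divr_gt0 // exprn_even_gt0.
  by rewrite /c (_ : P.[z] * G.[z] / G.[z] ^+ 2 = P.[z] / G.[z]) //; field.
have c20 : 0 < c / 2 by rewrite divr_gt0.
have cPG : P.[y] / G.[y] @[y --> z] --> c.
  by apply: cvgM; [exact: continuous_horner|apply: cvgV => //; exact: continuous_horner].
have /cvgrPdist_le/(_ _ c20) near1 := cPG.
have r0 : 0 < c / 2 / (`|M| + 1) by rewrite divr_gt0 // ltr_wpDl.
have /cvgrPdist_le/(_ _ r0) near2 := @cvg_id _ (nbhs z).
near=> y.
have h1 : `|c - P.[y] / G.[y]| <= c / 2 by near: y.
have h2 : `|z - y| <= c / 2 / (`|M| + 1) by near: y.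
have h3 : c / 2 <= P.[y] / G.[y] by move: h1; rewrite ler_norml; lra.
have ratioE : P.[y] / Q.[y] = (P.[y] / G.[y]) / (y - z).
  by rewrite QG hornerM hornerXsubC invfM mulrA.
have h4 : (`|M| + 1) * `|z - y| <= c / 2.
  by rewrite mulrC -ler_pdivlMr // ltr_wpDl.
have := ler_norm M; have := ler_norm (- M); rewrite normrN => m1 m2.
split=> yz; rewrite ratioE.
  rewrite ler_pdivlMr ?subr_gt0 //; apply: le_trans h3; apply: le_trans h4.
  have -> : `|z - y| = y - z by rewrite distrC ger0_norm // subr_ge0 ltW.
  by apply: ler_wpM2r; [rewrite subr_ge0 ltW|lra].
rewrite ler_ndivrMr ?subr_lt0 //; apply: le_trans h3; apply: le_trans h4.
have -> : `|z - y| = z - y by rewrite ger0_norm // subr_ge0 ltW.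
have -> : M * (y - z) = (- M) * (z - y) by ring.
by apply: ler_wpM2r; [rewrite subr_ge0 ltW|lra].
Unshelve. all: end_near. Qed.

(** From one zero of Q to the next the angle decreases from pi/2 to -pi/2. *)
Lemma consecutive_zeros_gap x y : A <= x -> y <= B -> x < y ->
  Q.[x] = 0 -> Q.[y] = 0 -> (forall z, x < z < y -> Q.[z] != 0) ->
  pi <= H * (y - x).
Proof.
move=> Ax yB xy Qx Qy Q0; apply/ler_addgt0Pr => e e0.
have [M HM] : exists M : R, pi / 2 - atan M <= e / 2.
  have e2 : 0 < e / 2 by rewrite divr_gt0.
  have /cvgrPdist_le/(_ _ e2) [M [_ HM]] := @cvgy_atan R.
  exists (`|M| + 1); apply: (le_trans (ler_norm _)); apply: HM.
  by rewrite (le_lt_trans (ler_norm M)) // ltrDl.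
have ang_ge u : (M * de - be) / al <= u -> atan M <= atan ((al * u + be) / de).
  move=> hu; apply: le_atan; rewrite ler_pdivlMr //.
  by move: hu; rewrite ler_pdivrMr //; lra.
have ang_le u : u <= (- M * de - be) / al -> atan ((al * u + be) / de) <= - atan M.
  move=> hu; rewrite -atanN; apply: le_atan; rewrite ler_pdivrMr //.
  by move: hu; rewrite ler_pdivlMr //; lra.
have [u [xu uxy [/(_ _) hu _]]] := near_right
  (ratio_near_zero ((M * de - be) / al) Qx) (midf_lt xy).1.
have [v [vy xyv [_ /(_ _) hv]]] := near_left
  (ratio_near_zero ((- M * de - be) / al) Qy) (midf_lt xy).2.
have uv : u < v by exact: lt_trans uxy xyv.
have Q0' z : u <= z <= v -> Q.[z] != 0.
  by move=> /andP [uz zv]; apply: Q0; rewrite (lt_le_trans xu uz) (le_lt_trans zv vy).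
have /andP [_ h] := angle_mvt (le_trans Ax (ltW xu)) (le_trans (ltW vy) yB) uv Q0'.
have := ang_ge _ (hu xu); have := ang_le _ (hv vy); rewrite -!/(angle _) => k1 k2.
have H0 : 0 <= H.
  have /andP [s1 s2] := @speed x ltac:(by rewrite Ax (le_trans (ltW xy) yB)).
  exact: le_trans L_ge0 (le_trans s1 s2).
have k3 : H * (v - u) <= H * (y - x) by rewrite ler_wpM2l //; lra.
lra.
Qed.

Lemma seq_min (s : seq R) x : x \in s ->
  exists2 m, m \in s & forall y, y \in s -> m <= y.
Proof.
elim: s x => // w s IH x _; case: s IH => [_|w' s' IH].
  by exists w; rewrite ?mem_head // => y; rewrite inE => /eqP ->.
have [m ms mmin] := IH w' (mem_head _ _).
have [wm|mw] := leP w m.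
  exists w; first exact: mem_head.
  move=> y; rewrite inE => /predU1P [-> //|/mmin]; exact: le_trans.
exists m; first by rewrite inE ms orbT.
by move=> y; rewrite inE => /predU1P [->|/mmin //]; exact: ltW.
Qed.

Lemma zeros_gap (s : seq R) x y : (forall z, (z \in s) = root Q z) ->
  A <= x -> y <= B -> x < y -> Q.[x] = 0 -> Q.[y] = 0 -> pi <= H * (y - x).
Proof.
move=> sQ Ax yB xy Qx Qy.
have [|z] := @seq_min [seq z <- s | x < z] y.
  by rewrite mem_filter xy sQ; apply/rootP.
rewrite mem_filter sQ => /andP [xz /rootP Qz] zmin.
have zy : z <= y by apply: zmin; rewrite mem_filter xy sQ; apply/rootP.
have H0 : 0 <= H.
  have /andP [s1 s2] := @speed x ltac:(by rewrite Ax (le_trans (ltW xy) yB)).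
  exact: le_trans L_ge0 (le_trans s1 s2).
apply: (@le_trans _ _ (H * (z - x))); last by rewrite ler_wpM2l //; lra.
apply: consecutive_zeros_gap => //; first exact: le_trans zy yB.
move=> t /andP [xt tz]; apply/eqP => Qt.
have : z <= t by apply: zmin; rewrite mem_filter xt sQ; apply/rootP.
by rewrite leNgt tz.
Qed.

End ZeroSpacing.

Section Counting.
Variable R : realType.

Lemma count_upper (l : R) (s : seq R) c d : 0 <= l -> sorted <=%R s -> uniq s ->
    (forall z, z \in s -> c <= z <= d) -> c <= d ->
    (forall x y, x \in s -> y \in s -> x < y -> l <= y - x) ->
  (size s)%:R * l <= (d - c) + l.
Proof.
move=> l0; elim: s c => [|x s IH] c; first by rewrite mul0r => _ _ _ cd _; lra.
move=> /= so /andP [xs us] scd cd gap; have /andP [cx xd] := scd x (mem_head _ _).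
rewrite -natr1 mulrDl mul1r lerD2r.
case: s IH so xs us scd gap => [|y s] IH so xs us scd gap; first by rewrite mul0r; lra.
have xy : x < y.
  move: so => /= /andP [xy _]; rewrite lt_neqAle xy andbT.
  by apply: contraNneq xs => ->; rewrite mem_head.
have ly := gap x y (mem_head _ _) ltac:(by rewrite !inE eqxx orbT) xy.
have mem_up z : z \in y :: s -> y <= z <= d.
  move=> zs; have /andP [_ zd] := scd z ltac:(by rewrite inE zs orbT).
  rewrite zd andbT; move: zs; rewrite inE => /predU1P [-> //|zs].
  move: so => /= /andP [_ so]; have := order_path_min le_trans so.
  by move=> /allP /(_ z zs).
have yd : y <= d by have /andP [_] := mem_up y (mem_head _ _).
have := IH y (path_sorted so) us mem_up yd.
have gap' u v : u \in y :: s -> v \in y :: s -> u < v -> l <= v - u.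
  by move=> us' vs'; apply: gap; rewrite inE ?us' ?vs' orbT.
by move=> /(_ gap'); lra.
Qed.

Lemma count_lower (l : R) (s : seq R) c d : 0 <= l -> sorted <=%R s ->
    (forall z, z \in s -> c <= z) ->
    (forall x y, c < x -> x < y -> y <= d -> l < y - x ->
       exists2 z, z \in s & x <= z <= y) ->
  d - c <= (size s)%:R * l + l.
Proof.
move=> l0; elim: s c => [|z s IH] c so sc hit.
  rewrite mul0r add0r leNgt; apply/negP => h.
  by have [||||w] := hit ((c + (d - l)) / 2) d; rewrite ?in_nil //; lra.
have after w : w \in s -> z <= w.
  by have := order_path_min le_trans so => /allP /(_ w).
have sl0 : 0 <= (size s)%:R * l by rewrite mulr_ge0.
rewrite /= -natr1 mulrDl mul1r.
have [cd|cd] := leP (d - c) l; first by lra.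
have zc : z - c <= l.
  rewrite leNgt; apply/negP => h; have [zd|dz] := ltP z d.
    have [||||w ws /andP [w1 w2]] := hit (c + (z - c - l) / 3) (z - (z - c - l) / 3); try lra.
    by move: ws; rewrite inE => /predU1P [wz|/after]; lra.
  have [||||w ws /andP [w1 w2]] := hit (c + (d - c - l) / 3) (d - (d - c - l) / 3); try lra.
  by move: ws; rewrite inE => /predU1P [wz|/after]; lra.
have cz : c <= z by apply: sc; exact: mem_head.
suff : d - z <= (size s)%:R * l + l by lra.
apply: IH => //; first exact: path_sorted so.
move=> x y zx xy yd lxy.
have [|w] := hit x y _ xy yd lxy; first by lra.
rewrite inE => /predU1P [-> /andP [xz _]|ws xwy]; first by lra.
by exists w.
Qed.

End Counting.

(** * Transfer over one period *)

Lemma det_mx22 (R : realType) (Y : 'M[R]_2) : \det Y = Y 0 0 * Y 1 1 - Y 0 1 * Y 1 0.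
Proof.
rewrite (expand_det_row _ 0) !big_ord_recl big_ord0 /cofactor !det_mx11 !mxE /=.
have -> : lift 0 0 = 1 :> 'I_2 by apply/val_inj.
have -> : lift 1 0 = 0 :> 'I_2 by apply/val_inj.
by rewrite expr0 expr1; ring.
Qed.

Section TransferMatrices.
Variables (R : realType) (N : nat) (a b : R^nat) (q sigma : R).
Hypothesis N_gt0 : (0 < N)%N.
Hypothesis a_gt0 : forall n, 0 < a n.
Hypothesis D1N_a : D1N N (fun n => a n - a n.-1).
Hypothesis D1N_b : D1N N (fun n => b n - q * a n).
Hypothesis D1N_inv : D1N N (fun n => (a n)^-1).
Hypothesis sigma_mx : mx2 0 1 (-1) (- q) ^+ N = sigma%:M.

Let a_neq0 n : a n != 0. Proof. by rewrite gt_eqF. Qed.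

Definition mx_periodic_bv (A : nat -> R -> 'M[R]_2) : Prop :=
  forall i j, periodic_bv N (fun m x => A m x i j).

Lemma mx_periodic_bvM A B : mx_periodic_bv A -> mx_periodic_bv B ->
  mx_periodic_bv (fun m x => A m x *m B m x).
Proof.
move=> bA bB i j.
have := periodic_bv_sum 2 (fun k => periodic_bvM (bA i (inord k)) (bB (inord k) j)).
congr (periodic_bv _ _); apply/funext => m; apply/funext => x.
by rewrite mxE; apply: eq_bigr => k _; rewrite inord_val.
Qed.

Lemma mx_periodic_bvD A B : mx_periodic_bv A -> mx_periodic_bv B ->
  mx_periodic_bv (fun m x => A m x + B m x).
Proof.
move=> bA bB i j; have := periodic_bvD (bA i j) (bB i j).
by congr (periodic_bv _ _); apply/funext => m; apply/funext => x; rewrite mxE.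
Qed.

Lemma mx_periodic_bvZ f A : periodic_bv N f -> mx_periodic_bv A ->
  mx_periodic_bv (fun m x => f m x *: A m x).
Proof.
move=> bf bA i j; have := periodic_bvM bf (bA i j).
by congr (periodic_bv _ _); apply/funext => m; apply/funext => x; rewrite mxE.
Qed.

Lemma mx_periodic_bv_const (A : 'M[R]_2) : mx_periodic_bv (fun _ _ => A).
Proof. by move=> i j; exact: periodic_bv_const. Qed.

Definition base_mx : 'M[R]_2 := mx2 0 1 (-1) (- q).

Definition perturbation_mx n (x : R) : 'M[R]_2 :=
  mx2 0 0 (a n - a n.-1) (x - (b n - q * a n)).

Lemma transfer_mxE n x :
  transfer_mx a b n x = base_mx + (a n)^-1 *: perturbation_mx n x.
Proof.
apply/matrixP => i j; rewrite !mxE.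
by do 2![case: eqP => _]; rewrite ?mulr0 ?addr0 //; field.
Qed.

(** Since base_mx ^ N = sigma, the product of N transfer matrices is sigma up to
    a multiple of 1/a_m; the cofactor, [step_coef N m], is a polynomial in the
    sequences of the class D_1^N. *)
Fixpoint step_coef (L m : nat) (x : R) : 'M[R]_2 :=
  if L is L'.+1 then
    base_mx *m step_coef L' m x
    + (a m / a (m + L')%N) *: (perturbation_mx (m + L') x *m (base_mx ^+ L'))
    + (a (m + L')%N)^-1 *: (perturbation_mx (m + L') x *m step_coef L' m x)
  else 0.

Lemma iota_rcons m n : iota m n.+1 = rcons (iota m n) (m + n)%N.
Proof. by rewrite -addn1 iotaD cats1. Qed.

Lemma step_mx_coef L m x : \prod_(j <- rev (index_iota m (m + L))) transfer_mx a b j x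
  = base_mx ^+ L + (a m)^-1 *: step_coef L m x.
Proof.
elim: L => [|L IH].
  by rewrite addn0 /index_iota subnn big_nil expr0 /= scaler0 addr0.
rewrite addnS /index_iota subSn ?leq_addr // addKn iota_rcons rev_rcons.
rewrite big_cons; move: IH; rewrite /index_iota addKn => ->.
rewrite transfer_mxE exprS -mulmxE mulmxDl !mulmxDr -!addrA; congr (_ + _).
rewrite !scalerDr -!scalemxAl -!scalemxAr -!addrA; congr (_ + (_ + _)).
  by rewrite scalerA mulrA mulVf // mul1r.
by rewrite !scalerA mulrC.
Qed.

Lemma periodic_bv_inv : periodic_bv N (fun m _ => (a m)^-1).
Proof. exact: D1N_periodic_bv D1N_inv. Qed.

Lemma periodic_bv_increment L : periodic_bv N (fun m _ => a (m + L)%N - a m).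
Proof.
have bs l : periodic_bv N (fun m _ => a (m + l.+1)%N - a (m + l)%N).
  have := periodic_bv_shift l.+1 (D1N_periodic_bv N_gt0 D1N_a).
  by congr (periodic_bv _ _); apply/funext => m; apply/funext => x; rewrite addnS.
have := periodic_bv_sum L bs.
congr (periodic_bv _ _); apply/funext => m; apply/funext => x.
rewrite -(big_mkord xpredT (fun l => a (m + l.+1)%N - a (m + l)%N)).
by rewrite telescope_sumr // addn0.
Qed.

Lemma periodic_bv_ratio L : periodic_bv N (fun m _ => a (m + L)%N / a m).
Proof.
have := periodic_bvD (periodic_bv_const N 1)
  (periodic_bvM (periodic_bv_increment L) periodic_bv_inv).
by congr (periodic_bv _ _); apply/funext => m; apply/funext => x; field.
Qed.

Lemma periodic_bv_ratioV L : periodic_bv N (fun m _ => a m / a (m + L)%N).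
Proof.
have := periodic_bvD (periodic_bv_const N 1)
  (periodic_bvN (periodic_bvM (periodic_bv_increment L) (periodic_bv_shift L periodic_bv_inv))).
by congr (periodic_bv _ _); apply/funext => m; apply/funext => x; field.
Qed.

Lemma perturbation_mx_bv L : mx_periodic_bv (fun m => perturbation_mx (m + L)).
Proof.
have bu := periodic_bv_shift L (D1N_periodic_bv N_gt0 D1N_a).
have bw := periodic_bvD (periodic_bv_id R N)
  (periodic_bvN (periodic_bv_shift L (D1N_periodic_bv N_gt0 D1N_b))).
move=> i j; case: (eqVneq i 0) => [->|i0].
  have := periodic_bv_const N (0 : R); congr (periodic_bv _ _).
  by apply/funext => m; apply/funext => x; rewrite mxE eqxx; case: ifP.
case: (eqVneq j 0) => [->|j0].
  by move: bu; congr (periodic_bv _ _); apply/funext => m; apply/funext => x;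
    rewrite mxE (negbTE i0) eqxx.
by move: bw; congr (periodic_bv _ _); apply/funext => m; apply/funext => x;
  rewrite mxE (negbTE i0) (negbTE j0).
Qed.

Lemma step_coef_bv L : mx_periodic_bv (step_coef L).
Proof.
elim: L => [|L IH]; first exact: mx_periodic_bv_const.
apply: mx_periodic_bvD; first apply: mx_periodic_bvD.
- by apply: mx_periodic_bvM => //; exact: mx_periodic_bv_const.
- apply: mx_periodic_bvZ; first exact: periodic_bv_ratioV.
  by apply: mx_periodic_bvM; [exact: perturbation_mx_bv|exact: mx_periodic_bv_const].
- apply: mx_periodic_bvZ; first exact: (periodic_bv_shift L periodic_bv_inv).
  by apply: mx_periodic_bvM => //; exact: perturbation_mx_bv.
Qed.

(** The limits of this sequence along the residue classes modulo N are the
    matrices R_i. *)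
Definition scaled_step m x : 'M[R]_2 :=
  a (m + N).-1 *: (step_mx N a b m x - sigma%:M).

Lemma scaled_stepE m x :
  scaled_step m x = (a (m + N.-1)%N / a m) *: step_coef N m x.
Proof.
rewrite /scaled_step /step_mx step_mx_coef sigma_mx addrC addKr scalerA.
by rewrite -{1}(prednK N_gt0) addnS.
Qed.

Lemma scaled_step_bv : mx_periodic_bv scaled_step.
Proof.
have := mx_periodic_bvZ (periodic_bv_ratio N.-1) (step_coef_bv N).
congr (mx_periodic_bv _); apply/funext => m; apply/funext => x.
by rewrite scaled_stepE.
Qed.

Lemma step_mxE m x :
  step_mx N a b m x = sigma%:M + (a (m + N).-1)^-1 *: scaled_step m x.
Proof. by rewrite scalerA mulVf // scale1r addrC subrK. Qed.

Lemma limit_mxE i x :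
  limit_mx N a b sigma i x =
  \matrix_(k, l) periodic_lim N (fun m x => scaled_step m x k l) i x.
Proof.
apply: cvg_lim => //.
have -> : (fun n : nat => a (n.+1 * N + i).-1 *:
            (step_mx N a b (n * N + i) x - sigma%:M)) =
    (fun n => scaled_step (n * N + i) x).
  by apply/funext => n; rewrite /scaled_step mulSnr addnAC.
apply/cvgrPdist_le => /= e e0; near=> n.
rewrite /Num.Def.normr /= mx_normrE (bigmax_le _ (ltW e0)) //= => i' _.
rewrite !mxE /=; move: i'; near: n; apply: filter_forall => -[k l] /=.
have := @periodic_lim_cvg R N N_gt0 _ _ i x (periodic_bv_cauchy N_gt0 `|x| (scaled_step_bv k l)) (lexx _).
move/cvgrPdist_le/(_ _ e0); apply: filterS => n /=.
by rewrite /scaled_step !mxE.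
Unshelve. all: end_near. Qed.

Lemma limit_mx_uniform M d : 0 < d ->
  exists m0, forall m x, (m0 <= m)%N -> `|x| <= M ->
    forall k l, `|scaled_step m x k l - limit_mx N a b sigma (m %% N)%N x k l| <= d.
Proof.
move=> d0.
have unif k l := periodic_lim_uniform N_gt0 (periodic_bv_cauchy N_gt0 M (scaled_step_bv k l)) d0.
have /choice [f Hf] : forall kl : 'I_2 * 'I_2, exists m0, forall m x, (m0 <= m)%N ->
   `|x| <= M -> `|scaled_step m x kl.1 kl.2 - periodic_lim N
      (fun m x => scaled_step m x kl.1 kl.2) (m %% N)%N x| <= d.
  by move=> [k l]; exact: unif.
exists (\max_kl f kl) => m x m0m xM k l; rewrite limit_mxE mxE.
by apply: (Hf (k, l)) => //; apply: leq_trans m0m; exact: leq_bigmax.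
Qed.

Lemma continuous_limit_mx i k l : (i < N)%N ->
  continuous (fun x => limit_mx N a b sigma i x k l).
Proof.
move=> iN; have -> : (fun x => limit_mx N a b sigma i x k l) =
    periodic_lim N (fun m x => scaled_step m x k l) i.
  by apply/funext => x; rewrite limit_mxE mxE.
move=> x; apply: (continuous_periodic_lim N_gt0 iN _ _ (nbhs_bounded x)).
  by move=> m; case: (scaled_step_bv k l).
exact: (periodic_bv_cauchy N_gt0 _ (scaled_step_bv k l)).
Qed.

Lemma det_step_mx L m x : \det (\prod_(j <- rev (index_iota m.+1 (m.+1 + L))) transfer_mx a b j x)
  = a m / a (m + L)%N.
Proof.
elim: L => [|L IH].
  by rewrite !addn0 /index_iota subnn big_nil det1 divff.
rewrite addnS /index_iota subSn ?leq_addr // addKn iota_rcons rev_rcons.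
rewrite big_cons; move: IH; rewrite /index_iota addKn det_mulmx => ->.
by rewrite det_mx22 !mxE !addnS addSn /=; field; rewrite !a_neq0.
Qed.

End TransferMatrices.

Section Recurrence.
Variables (R : realType) (N : nat) (a b : R^nat) (sigma : R).
Hypothesis a_gt0 : forall n, 0 < a n.
Hypothesis sigma_sign : sigma = 1 \/ sigma = -1.
Notation p := (orthpoly a b).
Notation T := (scaled_step N a b sigma).

Let a_neq0 n : a n != 0. Proof. by rewrite gt_eqF. Qed.

Lemma sigma_sqr : sigma ^+ 2 = 1.
Proof. by case: sigma_sign => ->; rewrite ?sqrrN expr1n. Qed.

Definition orth_vec m x : 'cV[R]_2 :=
  \col_i (if i == 0 then (p m).[x] else (p m.+1).[x]).

Lemma transfer_orth_vec m x :
  transfer_mx a b m.+1 x *m orth_vec m x = orth_vec m.+1 x.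
Proof.
apply/matrixP => i j; rewrite !mxE !big_ord_recl big_ord0 !mxE /= !addr0.
case: (eqVneq i 0) => _ /=; first by rewrite mul0r add0r mul1r.
have := horner_orthpoly_rec b a_gt0 m x.
move/(congr1 (fun y => (a m.+1)^-1 * y)); rewrite mulKf // => ->.
by ring.
Qed.

Lemma step_orth_vec m L x :
  (\prod_(j <- rev (index_iota m.+1 (m.+1 + L))) transfer_mx a b j x) *m orth_vec m x
  = orth_vec (m + L) x.
Proof.
elim: L => [|L IH].
  by rewrite !addn0 /index_iota subnn big_nil mul1mx.
rewrite addnS /index_iota subSn ?leq_addr // addKn iota_rcons rev_rcons.
rewrite big_cons; move: IH; rewrite /index_iota addKn -mulmxA => ->.
by rewrite addSn transfer_orth_vec addnS.
Qed.

(** The coordinates of V_(m+N) = X_(m+1) V_m. *)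
Lemma orthpoly_step m x : let A := a (m + N)%N in let t := T m.+1 x in
  (p (m + N)).[x] = sigma * (p m).[x]
     + (t 0 0 * (p m).[x] + t 0 1 * (p m.+1).[x]) / A /\
  (p (m + N).+1).[x] = sigma * (p m.+1).[x]
     + (t 1 0 * (p m).[x] + t 1 1 * (p m.+1).[x]) / A.
Proof.
move=> A t; have /matrixP E := step_orth_vec m N x.
move: E; rewrite -/(step_mx N a b m.+1 x) (step_mxE N b sigma a_gt0) addSn /= -/A -/t => E.
have := E 0 0; have := E 1 0.
rewrite !mxE !big_ord_recl !big_ord0 !mxE /= => <- <-.
rewrite !(mulr1n, mulr0n, addr0, add0r).
have -> : lift 0 0 = 1 :> 'I_2 by apply/val_inj.
by split; ring.
Qed.

Lemma det_scaled_step m x : let A := a (m + N)%N in let t := T m.+1 x in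
  (sigma + t 0 0 / A) * (sigma + t 1 1 / A) - t 0 1 * t 1 0 / A ^+ 2 = a m / A.
Proof.
move=> A t; have := det_step_mx b a_gt0 N m x.
rewrite -/(step_mx N a b m.+1 x) (step_mxE N b sigma a_gt0) addSn /= -/A -/t => <-.
rewrite det_mx22 !mxE /= !(mulr1n, mulr0n, addr0, add0r).
by field; rewrite a_neq0.
Qed.

Lemma trace_scaled_step m x : let A := a (m + N)%N in let t := T m.+1 x in
  sigma * (t 0 0 + t 1 1) = a m - A - (t 0 0 * t 1 1 - t 0 1 * t 1 0) / A.
Proof.
move=> A t; have := det_scaled_step m x; rewrite -/A -/t => E.
have A0 : A != 0 by exact: a_neq0.
have s2 := sigma_sqr.
have : A * ((sigma + t 0 0 / A) * (sigma + t 1 1 / A) - t 0 1 * t 1 0 / A ^+ 2) = a m.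
  by rewrite E mulrC divfK.
have -> : A * ((sigma + t 0 0 / A) * (sigma + t 1 1 / A) - t 0 1 * t 1 0 / A ^+ 2)
  = sigma ^+ 2 * A + sigma * (t 0 0 + t 1 1)
    + (t 0 0 * t 1 1 - t 0 1 * t 1 0) / A by field.
by rewrite s2; lra.
Qed.

(** The quadratic form det(v, Y v). *)
Definition wronskian_form (Y : 'M[R]_2) (u v : R) : R :=
  Y 1 0 * u ^+ 2 + (Y 1 1 - Y 0 0) * u * v - Y 0 1 * v ^+ 2.

Lemma discrE (Y : 'M[R]_2) : discr Y = (Y 0 0 - Y 1 1) ^+ 2 + 4 * (Y 0 1 * Y 1 0).
Proof.
rewrite /discr /mxtrace !big_ord_recl big_ord0 det_mx22.
have -> : lift 0 0 = 1 :> 'I_2 by apply/val_inj.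
by ring.
Qed.

(** When the discriminant is negative, completing the square in either variable
    bounds the form from below by v ^+ 2 and by u ^+ 2. *)
Lemma wronskian_form_ge (Y : 'M[R]_2) (eta C u v : R) : 0 < C ->
    discr Y <= - eta -> `|Y 1 0| <= C -> `|Y 0 1| <= C ->
  eta / (8 * C) * (u ^+ 2 + v ^+ 2) <= `|wronskian_form Y u v|.
Proof.
move=> C0; rewrite discrE => dY Y10 Y01; set W := wronskian_form Y u v.
have e1 : 4 * Y 1 0 * W = (2 * Y 1 0 * u + (Y 1 1 - Y 0 0) * v) ^+ 2
    - ((Y 0 0 - Y 1 1) ^+ 2 + 4 * (Y 0 1 * Y 1 0)) * v ^+ 2.
  by rewrite /W /wronskian_form; ring.
have e2 : - 4 * Y 0 1 * W = (2 * Y 0 1 * v - (Y 1 1 - Y 0 0) * u) ^+ 2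
    - ((Y 0 0 - Y 1 1) ^+ 2 + 4 * (Y 0 1 * Y 1 0)) * u ^+ 2.
  by rewrite /W /wronskian_form; ring.
have h1 : eta * v ^+ 2 <= 4 * C * `|W|.
  apply: (@le_trans _ _ (4 * Y 1 0 * W)).
    rewrite e1; have := sqr_ge0 (2 * Y 1 0 * u + (Y 1 1 - Y 0 0) * v).
    have : eta * v ^+ 2 <= - ((Y 0 0 - Y 1 1) ^+ 2 + 4 * (Y 0 1 * Y 1 0)) * v ^+ 2.
      by rewrite ler_wpM2r ?sqr_ge0 //; lra.
    by rewrite mulNr; lra.
  apply: (le_trans (ler_norm _)); rewrite !normrM normr_nat.
  by rewrite ler_wpM2r // ler_wpM2l.
have h2 : eta * u ^+ 2 <= 4 * C * `|W|.
  apply: (@le_trans _ _ (- 4 * Y 0 1 * W)).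
    rewrite e2; have := sqr_ge0 (2 * Y 0 1 * v - (Y 1 1 - Y 0 0) * u).
    have : eta * u ^+ 2 <= - ((Y 0 0 - Y 1 1) ^+ 2 + 4 * (Y 0 1 * Y 1 0)) * u ^+ 2.
      by rewrite ler_wpM2r ?sqr_ge0 //; lra.
    by rewrite mulNr; lra.
  apply: (le_trans (ler_norm _)); rewrite !normrM normrN normr_nat.
  by rewrite ler_wpM2r // ler_wpM2l.
rewrite mulrAC ler_pdivrMr ?mulr_gt0 //; lra.
Qed.

Lemma wronskian_form_sign (Y : 'M[R]_2) (u v : R) :
  discr Y <= 0 -> 0 <= wronskian_form Y u v * Y 1 0.
Proof.
rewrite discrE => dY; have e1 : 4 * (wronskian_form Y u v * Y 1 0) =
    (2 * Y 1 0 * u + (Y 1 1 - Y 0 0) * v) ^+ 2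
    + (- ((Y 0 0 - Y 1 1) ^+ 2 + 4 * (Y 0 1 * Y 1 0))) * v ^+ 2.
  by rewrite /wronskian_form; ring.
have : 0 <= 4 * (wronskian_form Y u v * Y 1 0).
  by rewrite e1 addr_ge0 ?sqr_ge0 // mulr_ge0 ?sqr_ge0 // oppr_ge0.
lra.
Qed.

Lemma wronskian_form_le (Y : 'M[R]_2) (e u v : R) :
    (forall k l, `|Y k l| <= e) ->
  `|wronskian_form Y u v| <= 2 * e * (u ^+ 2 + v ^+ 2).
Proof.
move=> Ye; have := Ye 0 0; have := Ye 0 1; have := Ye 1 0; have := Ye 1 1.
rewrite /wronskian_form !ler_norml => /andP [h1 h2] /andP [h3 h4] /andP [h5 h6] /andP [h7 h8].
have e0 : 0 <= e by apply: le_trans (Ye 0 0).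
have := sqr_ge0 (u - v); have := sqr_ge0 (u + v) => s1 s2.
have g1 : 0 <= (e - Y 1 0) * u ^+ 2 by rewrite mulr_ge0 ?sqr_ge0 ?subr_ge0.
have g2 : 0 <= (e + Y 1 0) * u ^+ 2 by rewrite mulr_ge0 ?sqr_ge0 //; lra.
have g3 : 0 <= (e - Y 0 1) * v ^+ 2 by rewrite mulr_ge0 ?sqr_ge0 ?subr_ge0.
have g4 : 0 <= (e + Y 0 1) * v ^+ 2 by rewrite mulr_ge0 ?sqr_ge0 //; lra.
have g5 : 0 <= (2 * e - (Y 1 1 - Y 0 0)) * (u + v) ^+ 2 by rewrite mulr_ge0 ?sqr_ge0 //; lra.
have g6 : 0 <= (2 * e + (Y 1 1 - Y 0 0)) * (u - v) ^+ 2 by rewrite mulr_ge0 ?sqr_ge0 //; lra.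
have g7 : 0 <= (2 * e - (Y 1 1 - Y 0 0)) * (u - v) ^+ 2 by rewrite mulr_ge0 ?sqr_ge0 //; lra.
have g8 : 0 <= (2 * e + (Y 1 1 - Y 0 0)) * (u + v) ^+ 2 by rewrite mulr_ge0 ?sqr_ge0 //; lra.
have p1 : 0 <= e * (u ^+ 2 + v ^+ 2) by rewrite mulr_ge0 // addr_ge0 ?sqr_ge0.
by apply/andP; split; lra.
Qed.

(** The determinant of (V_m, V_(m+N)), rescaled, where V_m = (p_m, p_(m+1)). *)
Definition turan m x : R :=
  a m * wronskian_form (T m.+1 x) (p m).[x] (p m.+1).[x].

(** The step V_m -> V_(m+N) is sigma + T / a_(m+N), which commutes with T; hence
    it preserves the form of T up to its determinant, and only the change of T
    from one period to the next remains. *)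
Lemma turan_step m x :
  turan (m + N) x - turan m x = a (m + N)%N *
    wronskian_form (T (m + N).+1 x - T m.+1 x) (p (m + N)).[x] (p (m + N).+1).[x].
Proof.
have A0 : a (m + N)%N != 0 by exact: a_neq0.
have inv : turan m x = a (m + N)%N *
    wronskian_form (T m.+1 x) (p (m + N)).[x] (p (m + N).+1).[x].
  have [-> ->] := orthpoly_step m x; have := det_scaled_step m x.
  rewrite /turan /wronskian_form /=.
  set t := T m.+1 x; set A := a (m + N)%N => E.
  have -> : a m = A * (a m / A) by rewrite mulrC divfK.
  by rewrite -E; field.
by rewrite inv /turan -mulrBr /wronskian_form !mxE; ring.
Qed.

End Recurrence.

(** * Convergence of the Turan determinants *)

Section ElementarySequences.
Variable R : realType.

Lemma near_forall_ord n (P : 'I_n -> R -> Prop) (x0 : R) :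
  (forall i, \forall x \near x0, P i x) -> \forall x \near x0, forall i, P i x.
Proof. by move=> H; exact: (@filter_forall R 'I_n P (nbhs x0) _ H). Qed.

Lemma finite_lower_bound n (f : nat -> R) : (forall i, (i < n)%N -> 0 < f i) ->
  exists2 c, 0 < c & forall i, (i < n)%N -> c <= f i.
Proof.
elim: n => [|n IH] f0; first by exists 1.
have [c c0 Hc] := IH (fun i ni => f0 i (ltnW ni)).
exists (Num.min c (f n)); first by rewrite lt_min c0 f0.
move=> i; rewrite ltnS leq_eqVlt => /predU1P [->|ni]; rewrite ge_min ?lexx ?orbT //.
by rewrite Hc.
Qed.

Lemma finite_upper_bound n (f : nat -> R) :
  exists2 C, 0 < C & forall i, (i < n)%N -> f i <= C.
Proof.
elim: n => [|n [C C0 HC]]; first by exists 1.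
exists (C + `|f n|); first by rewrite ltr_pwDl.
move=> i; rewrite ltnS leq_eqVlt => /predU1P [->|ni].
  by apply: (le_trans (ler_norm _)); rewrite lerDr ltW.
by rewrite ler_wpDr // HC.
Qed.

(** The relative increments add up to at most 1/4, so that every term stays
    within a factor 2 of the first one. *)
Lemma stable_sequence (s e : R^nat) : (forall k, 0 <= e k) ->
    (forall n, \sum_(0 <= k < n) e k <= 1 / 4) ->
    (forall k, `|s k.+1 - s k| <= e k * `|s k.+1|) ->
  forall n, `|s n - s 0| <= 2 * `|s 0| * \sum_(0 <= k < n) e k.
Proof.
move=> e0 e4 se; elim=> [|n IH]; first by rewrite subrr normr0 big_geq // mulr0.
have S4 := e4 n; have S40 := e4 n.+1; rewrite !big_nat_recr //= in S40 *.
set S := \sum_(0 <= k < n) e k in IH S4 S40 *.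
have S0 : 0 <= S by apply: sumr_ge0.
have en := e0 n; have sen := se n; have s0 := normr_ge0 (s 0).
have h1 : `|s n| <= `|s 0| + 2 * `|s 0| * S.
  rewrite -(subrK (s 0) (s n)) addrC; apply: (le_trans (ler_normD _ _)).
  by rewrite lerD2l.
have h2 : `|s n.+1| <= `|s n| + e n * `|s n.+1|.
  rewrite -{1}(subrK (s n) (s n.+1)) addrC; apply: (le_trans (ler_normD _ _)).
  by rewrite lerD2l.
have h3 : `|s n.+1| <= 2 * `|s 0|.
  have q1 : e n * `|s n.+1| <= 1 / 4 * `|s n.+1| by rewrite ler_wpM2r //; lra.
  have q2 : 2 * `|s 0| * S <= 2 * `|s 0| * (1 / 4).
    by rewrite ler_wpM2l ?mulr_ge0.
  lra.
have h4 : e n * `|s n.+1| <= e n * (2 * `|s 0|) by rewrite ler_wpM2l.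
rewrite -(subrK (s n) (s n.+1)) -addrA; apply: (le_trans (ler_normD _ _)).
have := lerD (le_trans sen h4) IH; lra.
Qed.

Lemma near_finite_bounds n (f : nat -> R -> R) x0 :
    (forall i, {for x0, continuous (f i)}) ->
    (forall i, (i < n)%N -> f i x0 != 0) ->
  exists c C, [/\ 0 < c, 0 < C & \forall x \near x0,
    forall i, (i < n)%N -> c <= `|f i x| <= C].
Proof.
move=> cf f0.
have [c c0 Hc] : exists2 c, 0 < c & forall i, (i < n)%N -> c <= `|f i x0|.
  by apply: finite_lower_bound => i /f0; rewrite normr_gt0.
have [C C0 HC] := finite_upper_bound n (fun i => `|f i x0|).
exists (c / 2), (C + c); split; rewrite ?divr_gt0 ?addr_gt0 //.
have : \forall x \near x0, forall i : 'I_n, `|f i x0 - f i x| <= c / 2.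
  apply: (near_forall_ord (P := fun (i : 'I_n) x => `|f i x0 - f i x| <= c / 2)).
  move=> i; have /cvgrPdist_le := cf i.
  by apply; rewrite divr_gt0.
apply: filterS => x H i ni; have h1 := H (Ordinal ni) => /=.
have := Hc i ni; have := HC i ni; rewrite /= in h1.
have := ler_normB (f i x0) (f i x0 - f i x).
have -> : f i x0 - (f i x0 - f i x) = f i x by ring.
have := ler_normD (f i x) (f i x0 - f i x).
have -> : f i x + (f i x0 - f i x) = f i x0 by ring.
by move=> *; apply/andP; split; lra.
Qed.

End ElementarySequences.

Section LocalTuran.
Variables (R : realType) (N : nat) (a b : R^nat) (q sigma : R).
Hypothesis N_gt0 : (0 < N)%N.
Hypothesis a_gt0 : forall n, 0 < a n.
Hypothesis D1N_a : D1N N (fun n => a n - a n.-1).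
Hypothesis D1N_b : D1N N (fun n => b n - q * a n).
Hypothesis D1N_inv : D1N N (fun n => (a n)^-1).
Hypothesis sigma_mx : mx2 0 1 (-1) (- q) ^+ N = sigma%:M.
Notation p := (orthpoly a b).
Notation T := (scaled_step N a b sigma).
Notation lmx := (limit_mx N a b sigma).
Notation S := (turan N a b sigma).
Let bvT := scaled_step_bv N_gt0 a_gt0 D1N_a D1N_b D1N_inv sigma_mx.

Lemma scaled_step_cvg i x k l :
  T (n * N + i)%N x k l @[n --> \oo] --> lmx i x k l.
Proof.
rewrite (limit_mxE N_gt0 a_gt0 D1N_a D1N_b D1N_inv sigma_mx) mxE.
have := @periodic_lim_cvg R N N_gt0 _ _ i x
  (periodic_bv_cauchy N_gt0 `|x| (bvT k l)) (lexx _).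
exact.
Qed.

Lemma discr_bv : periodic_bv N (fun m x => discr (T m x)).
Proof.
have bB := periodic_bvD (bvT 0 0) (periodic_bvN (bvT 1 1)).
have := periodic_bvD (periodic_bvM bB bB)
  (periodic_bvM (periodic_bv_const N 4) (periodic_bvM (bvT 0 1) (bvT 1 0))).
congr (periodic_bv _ _); apply/funext => m; apply/funext => x.
by rewrite discrE expr2.
Qed.

Lemma discr_lim i x :
  periodic_lim N (fun m x => discr (T m x)) i x = discr (lmx i x).
Proof.
apply: cvg_lim => //; rewrite discrE; under eq_fun do rewrite discrE expr2.
rewrite expr2; apply: cvgD.
  by apply: cvgM; apply: cvgB; exact: scaled_step_cvg.
by apply: cvgMr; apply: cvgM; exact: scaled_step_cvg.
Qed.

Lemma continuous_discr_lim i : (i < N)%N -> continuous (fun x => discr (lmx i x)).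
Proof.
move=> iN x; have -> : (fun x => discr (lmx i x)) =
    periodic_lim N (fun m x => discr (T m x)) i.
  by apply/funext => y; rewrite discr_lim.
apply: (continuous_periodic_lim N_gt0 iN _ _ (nbhs_bounded x)).
  by move=> m; case: discr_bv.
exact: (periodic_bv_cauchy N_gt0 _ discr_bv).
Qed.

Lemma scaled_step_bounds M : exists C, exists2 e : R^nat,
  [/\ 0 < C, forall m, 0 <= e m & cvgn (series e)] &
  forall m x, (N <= m)%N -> `|x| <= M -> forall k l,
    `|T m x k l| <= C /\ `|(T (m + N) x - T m x) k l| <= e m.
Proof.
have /choice [f Hf] : forall kl : 'I_2 * 'I_2, exists CeB : R * R^nat * R,
    [/\ forall m, 0 <= CeB.1.2 m, forall n, \sum_(0 <= m < n) CeB.1.2 m <= CeB.2 &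
     forall m x, (N <= m)%N -> `|x| <= M -> `|T m x kl.1 kl.2| <= CeB.1.1 /\
     `|T (m + N)%N x kl.1 kl.2 - T m x kl.1 kl.2| <= CeB.1.2 m].
  move=> [k l]; have [_ /(_ M) [C [e [e0 ce] He]]] := bvT k l.
  have [B HB] := cvg_has_ub ce; exists (C, e, B); split => // n.
  by apply: (le_trans (ler_norm _)); apply: HB; exists n.
exists (1 + \sum_kl `|(f kl).1.1|), (fun m => \sum_kl (f kl).1.2 m).
  split; first by rewrite ltr_pwDl // sumr_ge0.
    by move=> m; apply: sumr_ge0 => kl _; case: (Hf kl).
  apply: (@bounded_series_is_cvg _ _ (\sum_kl (f kl).2)) => [m|n].
    by apply: sumr_ge0 => kl _; case: (Hf kl).
  by rewrite exchange_big /=; apply: ler_sum => kl _; case: (Hf kl).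
move=> m x mN xM k l; have [_ _ /(_ m x mN xM) [/= h1 h2]] := Hf (k, l).
split.
  apply: (le_trans h1); apply: (le_trans (ler_norm _)).
  rewrite (bigD1 (k, l)) //= addrCA lerDl addr_ge0 //; exact: sumr_ge0.
rewrite mxE [X in _ + X]mxE; apply: (le_trans h2); rewrite (bigD1 (k, l)) //= lerDl.
by apply: sumr_ge0 => kl _; case: (Hf kl).
Qed.

Lemma near_definite x0 : Lambda N a b sigma x0 ->
  exists eta, exists2 m0, 0 < eta & \forall x \near x0,
    (forall i, (i < N)%N -> discr (lmx i x) <= - eta) /\
    (forall m, (m0 <= m)%N -> discr (T m x) <= - eta).
Proof.
move=> Lx0; have [c c0 Hc] : exists2 c, 0 < c &
    forall i, (i < N)%N -> c <= - discr (lmx i x0).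
  by apply: finite_lower_bound => i iN; rewrite oppr_gt0; exact: Lx0.
have c4 : 0 < c / 4 by rewrite divr_gt0.
have [m0 Hm0] := periodic_lim_uniform N_gt0
  (periodic_bv_cauchy N_gt0 (`|x0| + 1) discr_bv) c4.
exists (c / 2), m0; first by rewrite divr_gt0.
have H1 : \forall x \near x0, forall i : 'I_N,
    `|discr (lmx i x0) - discr (lmx i x)| <= c / 4.
  apply: (near_forall_ord (P := fun (i : 'I_N) x =>
    `|discr (lmx i x0) - discr (lmx i x)| <= c / 4)) => i.
  have /cvgrPdist_le := @continuous_discr_lim i (ltn_ord i) x0.
  exact.
have H2 := nbhs_bounded x0.
near=> x; have lim_le i : (i < N)%N -> discr (lmx i x) <= - (c / 2) - c / 4.
  move=> iN; have : forall i : 'I_N, `|discr (lmx i x0) - discr (lmx i x)| <= c / 4.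
    by near: x.
  by move=> /(_ (Ordinal iN)) /=; have := Hc i iN; rewrite ler_norml; lra.
split=> [i /lim_le|m m0m]; first by lra.
have xM : `|x| <= `|x0| + 1 by near: x.
have := Hm0 m x m0m xM; rewrite discr_lim.
have := lim_le (m %% N)%N (ltn_pmod _ N_gt0); rewrite ler_norml; lra.
Unshelve. all: end_near. Qed.

Lemma turan_neq0 m x : discr (T m.+1 x) < 0 -> S m x != 0.
Proof.
move=> d0; rewrite /turan mulf_eq0 negb_or gt_eqF //=; apply/eqP => W0.
have [C C0 [H1 H2]] : exists2 C : R, 0 < C &
    `|T m.+1 x 1 0| <= C /\ `|T m.+1 x 0 1| <= C.
  exists (1 + `|T m.+1 x 1 0| + `|T m.+1 x 0 1|).
    by rewrite -addrA ltr_pwDl.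
  by have := normr_ge0 (T m.+1 x 1 0); have := normr_ge0 (T m.+1 x 0 1); split; lra.
have := @wronskian_form_ge _ (T m.+1 x) (- discr (T m.+1 x)) C
  (p m).[x] (p m.+1).[x] C0.
rewrite opprK lexx W0 normr0 => /(_ isT H1 H2); apply/negP; rewrite -ltNge.
rewrite mulr_gt0 // ?divr_gt0 ?oppr_gt0 ?mulr_gt0 //.
have [pz|pz] := orthpoly_wronskian_neq0 b a_gt0 m x.
  by rewrite ltr_pwDl ?sqr_ge0 // exprn_even_gt0.
by rewrite ltr_wpDl ?sqr_ge0 // exprn_even_gt0.
Qed.

Lemma continuous_turan m : continuous (S m).
Proof.
have cT k l : continuous (fun x => T m.+1 x k l) by case: (bvT k l).
move=> x; rewrite /turan /wronskian_form; apply: cvgMr; apply: cvgB; first apply: cvgD.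
- by apply: cvgM; [exact: cT|rewrite expr2; apply: cvgM; exact: continuous_horner].
- apply: cvgM; last exact: continuous_horner.
  by apply: cvgM; [apply: cvgB; exact: cT|exact: continuous_horner].
- by apply: cvgM; [exact: cT|rewrite expr2; apply: cvgM; exact: continuous_horner].
Qed.

(** Bounds near a point of Lambda, uniform in m; [kappa] is a definiteness
    constant and [C] bounds everything else. *)
Definition local_bounds (K : set R) (eta kappa C : R) (m1 : nat) : Prop :=
  [/\ 0 < eta, 0 < kappa, 0 < C,
    forall i x, (i < N)%N -> K x -> discr (lmx i x) <= - eta &
    forall m x, (m1 <= m)%N -> K x ->
      [/\ forall k l, `|T m.+1 x k l| <= C, discr (T m.+1 x) <= - eta,
        forall u v, kappa * (u ^+ 2 + v ^+ 2) <= `|wronskian_form (T m.+1 x) u v|,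
        kappa <= `|S m x| <= C &
        a m * ((p m).[x] ^+ 2 + (p m.+1).[x] ^+ 2) <= C]].

(** By [turan_step] and definiteness the relative increments of the Turan
    determinants along a residue class are summable: the determinants converge
    and stay away from 0. Definiteness turns their upper bound into one for
    a_m (p_m^2 + p_(m+1)^2). *)
Lemma turan_local x0 : Lambda N a b sigma x0 ->
  exists K eta kappa C m1, [/\ nbhs x0 K, K `<=` [set x | `|x| <= `|x0| + 1],
    local_bounds K eta kappa C m1 & progression_cauchy N K S].
Proof.
move=> Lx0; have [eta [m0 eta0 Hdef]] := near_definite Lx0.
have [C [e [C0 e0 ce] He]] := scaled_step_bounds (`|x0| + 1).
pose kap := eta / (8 * C); have kap0 : 0 < kap by rewrite divr_gt0 // mulr_gt0.
pose e2 m := 2 / kap * e m.+1.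
have e20 m : 0 <= e2 m by rewrite mulr_ge0 // divr_ge0 // ltW.
have ce2 : cvgn (series e2).
  have [B HB] := cvg_has_ub ce.
  apply: (@bounded_series_is_cvg _ _ (2 / kap * B)) => // n.
  rewrite /e2 -mulr_sumr; apply: ler_wpM2l; first by rewrite divr_ge0 // ltW.
  apply: (@le_trans _ _ (series e n.+1)); last first.
    by apply: (le_trans (ler_norm _)); apply: HB; exists n.+1.
  by rewrite /series /= big_nat_recl //= lerDr.
have [m2 Hm2] := series_tail_le ce2 (divr_gt0 ltr01 (ltr0n R 4)).
(* From m1 on the bounds of T hold, the form is definite and the relative
   increments add up to at most 1/4. *)
pose m1 := maxn N (maxn m0 m2).
have mN : (N <= m1)%N by rewrite leq_maxl.
have m0m1 : (m0 <= m1)%N by rewrite leq_max leq_maxl orbT.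
have m2m1 : (m2 <= m1)%N by rewrite !leq_max leqnn !orbT.
have [c3 [C3 [c30 C30 Hc3]]] : exists c C, [/\ 0 < c, 0 < C & \forall x \near x0,
    forall i, (i < N)%N -> c <= `|S (m1 + i)%N x| <= C].
  apply: near_finite_bounds => [i|i iN]; first exact: continuous_turan.
  apply: turan_neq0; have [_ H] := nbhs_singleton Hdef.
  apply: (le_lt_trans (H _ _)); last by rewrite oppr_lt0.
  by rewrite -addnS (leq_trans m0m1) ?leq_addr.
pose K := [set x | [/\ (forall i, (i < N)%N -> discr (lmx i x) <= - eta) /\
    (forall m, (m0 <= m)%N -> discr (T m x) <= - eta), `|x| <= `|x0| + 1 &
    forall i, (i < N)%N -> c3 <= `|S (m1 + i)%N x| <= C3]].
have nK : nbhs x0 K.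
  by near=> x; split; near: x => //; exact: nbhs_bounded.
have form_ge m x u v : (m1 <= m)%N -> K x ->
    kap * (u ^+ 2 + v ^+ 2) <= `|wronskian_form (T m.+1 x) u v|.
  move=> m1m [[_ Hd] xM _].
  have mN' : (N <= m.+1)%N by rewrite (leq_trans mN) // ltnW.
  apply: wronskian_form_ge => //.
  - by apply: Hd; rewrite (leq_trans m0m1) // ltnW.
  - by have [] := He m.+1 x mN' xM 1 0.
  - by have [] := He m.+1 x mN' xM 0 1.
have step m x : (m1 <= m)%N -> K x ->
    `|S (m + N)%N x - S m x| <= e2 m * `|S (m + N)%N x|.
  move=> m1m Kx; have [_ xM _] := Kx.
  have mN' : (N <= m.+1)%N by rewrite (leq_trans mN) // ltnW.
  rewrite turan_step // /turan !normrM mulrCA ler_wpM2l //.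
  have := @wronskian_form_le _ (T (m + N).+1 x - T m.+1 x) (e m.+1)
    (p (m + N)).[x] (p (m + N).+1).[x].
  have He' k l : `|(T (m + N).+1 x - T m.+1 x) k l| <= e m.+1.
    by have [] := He m.+1 x mN' xM k l.
  move=> /(_ He') h1; apply: (le_trans h1).
  have m1mN : (m1 <= m + N)%N by rewrite (leq_trans m1m) ?leq_addr.
  have := form_ge _ x (p (m + N)).[x] (p (m + N).+1).[x] m1mN Kx.
  move=> h2; rewrite /e2 -ler_pdivlMl // in h2 *.
  have := ler_wpM2l (e0 m.+1) h2; lra.
have stable m x k : (m1 <= m)%N -> K x ->
    `|S (m + k * N)%N x - S m x| <=
      2 * `|S m x| * (series e2 (m + k * N)%N - series e2 m).
  move=> m1m Kx.
  have e4 n : \sum_(0 <= j < n) e2 (m + j * N)%N <= 1 / 4.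
    apply: (le_trans (sum_progression_le N_gt0 m n e20)).
    by apply: Hm2; rewrite (leq_trans m2m1).
  have st j : `|S (m + j.+1 * N)%N x - S (m + j * N)%N x| <=
      e2 (m + j * N)%N * `|S (m + j.+1 * N)%N x|.
    by rewrite mulSnr addnA; apply: step => //; rewrite (leq_trans m1m) ?leq_addr.
  have := @stable_sequence R (fun j => S (m + j * N)%N x)
    (fun j => e2 (m + j * N)%N) (fun=> e20 _) e4 st k.
  rewrite mul0n addn0 => H; apply: (le_trans H).
  by rewrite ler_wpM2l ?mulr_ge0 //; exact: (sum_progression_le N_gt0).
have bounds m x : (m1 <= m)%N -> K x -> c3 / 2 <= `|S m x| <= 2 * C3.
  move=> m1m Kx; have [_ _ /(_ ((m - m1) %% N)%N (ltn_pmod _ N_gt0))] := Kx.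
  have mE : m = (m1 + (m - m1) %% N + (m - m1) %/ N * N)%N.
    by rewrite -addnA [((m - m1) %% N + _)%N]addnC -divn_eq subnKC.
  set i := ((m - m1) %% N)%N in mE *; set k := ((m - m1) %/ N)%N in mE.
  move=> /andP [b1 b2]; have m1i : (m1 <= m1 + i)%N by rewrite leq_addr.
  have := @stable (m1 + i)%N x k m1i Kx; rewrite -mE.
  have := Hm2 (m1 + i)%N (k * N)%N (leq_trans m2m1 m1i); rewrite -mE => t1 t2.
  have t3 : `|S m x - S (m1 + i)%N x| <= 2 * `|S (m1 + i)%N x| * (1 / 4).
    by apply: (le_trans t2); rewrite ler_wpM2l // mulr_ge0.
  have := ler_normB (S m x) (S m x - S (m1 + i)%N x).
  have -> : S m x - (S m x - S (m1 + i)%N x) = S (m1 + i)%N x by ring.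
  have := ler_normD (S (m1 + i)%N x) (S m x - S (m1 + i)%N x).
  have -> : S (m1 + i)%N x + (S m x - S (m1 + i)%N x) = S m x by ring.
  by move=> *; apply/andP; split; lra.
exists K, eta, (Num.min kap (c3 / 2)), (C + 2 * C3 + 2 * C3 / kap), m1; split => //.
- by move=> x [].
- have k30 : 0 < 2 * C3 / kap by rewrite divr_gt0 // mulr_gt0.
  split => //.
  + by rewrite lt_min kap0 divr_gt0.
  + by rewrite !addr_gt0 // mulr_gt0.
  + by move=> i x iN [[H _] _ _]; exact: H.
  move=> m x m1m Kx; have [_ xM _] := Kx; have /andP [b1 b2] := bounds m x m1m Kx.
  have mN' : (N <= m.+1)%N by rewrite (leq_trans mN) // ltnW.
  split.
  + by move=> k l; have [h _] := He m.+1 x mN' xM k l; lra.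
  + have [[_ Hd] _ _] := Kx; apply: Hd.
    by rewrite (leq_trans m0m1) // ltnW.
  + move=> u v; apply: le_trans (form_ge m x u v m1m Kx).
    by rewrite ler_wpM2r ?ge_min ?lexx // addr_ge0 ?sqr_ge0.
  + by rewrite ge_min b1 orbT /=; lra.
  + apply: (@le_trans _ _ (2 * C3 / kap)); last by lra.
    rewrite ler_pdivlMr //; apply: le_trans b2.
    rewrite /turan normrM (gtr0_norm (a_gt0 m)) -mulrA ler_wpM2l ?(ltW (a_gt0 m)) //.
    by rewrite mulrC; exact: form_ge.
- move=> d d0; have d40 : 0 < d / (4 * C3) by rewrite divr_gt0 // mulr_gt0.
  have [m3 Hm3] := series_tail_le ce2 d40.
  exists (maxn m1 m3) => m k x; rewrite geq_max => /andP [m1m m3m] Kx.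
  apply: (le_trans (@stable m x k m1m Kx)).
  have /andP [_ b2] := bounds m x m1m Kx.
  apply: (@le_trans _ _ (2 * (2 * C3) * (d / (4 * C3)))).
    apply: ler_pM; rewrite ?mulr_ge0 //.
    + apply: le_trans (sum_progression_le N_gt0 m k e20); exact: sumr_ge0.
    + by rewrite ler_wpM2l.
    + exact: Hm3.
  by rewrite le_eqVlt; apply/orP; left; apply/eqP; field; rewrite gt_eqF.
Unshelve. all: end_near. Qed.

End LocalTuran.

(** * Weighted means *)

Section CesaroMeans.
Variables (R : realType) (N : nat) (a : R^nat).
Hypothesis N_gt0 : (0 < N)%N.
Hypothesis a_gt0 : forall n, 0 < a n.
Hypothesis a_ratio : a n.-1 / a n @[n --> \oo] --> (1 : R).
Hypothesis a_infty : a n @[n --> \oo] --> +oo.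
Hypothesis carleman : \sum_(k < m) (a k)^-1 @[m --> \oo] --> +oo.

Definition inv_sum n : R := \sum_(k < n) (a k)^-1.

Lemma inv_sum_ge0 n : 0 <= inv_sum n.
Proof. by apply: sumr_ge0 => k _; rewrite invr_ge0 ltW. Qed.

Lemma inv_sumS n : inv_sum n.+1 = inv_sum n + (a n)^-1.
Proof. by rewrite /inv_sum big_ord_recr. Qed.

Lemma inv_sum_large (B : R) : exists n0, forall n, (n0 <= n)%N -> B <= inv_sum n.
Proof.
have /cvgryPge/(_ B) [n0 _ H] := carleman.
by exists n0 => n; exact: H.
Qed.

Lemma inv_small d : 0 < d -> exists n0, forall n, (n0 <= n)%N -> (a n)^-1 <= d.
Proof.
move=> d0; have /cvgryPge/(_ d^-1) [n0 _ H] := a_infty.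
exists n0 => n /H /= h; rewrite -[d]invrK lef_pV2 ?posrE ?invr_gt0 //.
Qed.

Lemma inv_bounded : exists2 B, 0 < B & forall n, (a n)^-1 <= B.
Proof.
have [n0 H] := inv_small ltr01.
have [C C0 HC] := finite_upper_bound n0 (fun n => (a n)^-1).
exists (C + 1); first by rewrite addr_gt0.
move=> n; have [nn0|nn0] := ltnP n n0; first by have := HC n nn0; lra.
by have := H n nn0; lra.
Qed.

Lemma cesaro_negligible (I : Type) (K : I -> Prop) (u : nat -> I -> R) C :
    (forall m x, K x -> `|u m x| <= C / a m) ->
    (forall d, 0 < d -> exists m0, forall m x, (m0 <= m)%N -> K x ->
      `|u m x| <= d / a m) ->
  forall d, 0 < d -> exists n0, forall n x, (n0 <= n)%N -> K x ->
    `|\sum_(m < n) u m x| <= d * inv_sum n.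
Proof.
move=> uC usmall d d0; have d2 : 0 < d / 2 by rewrite divr_gt0.
have [m0 Hm0] := usmall _ d2.
have [n1 Hn1] := inv_sum_large (C * inv_sum m0 / (d / 2)).
exists (maxn m0 n1) => n x; rewrite geq_max => /andP [m0n /Hn1].
rewrite ler_pdivrMr // => Hn Kx.
rewrite -(big_mkord xpredT (fun m => u m x)) (@big_cat_nat _ _ _ m0) //=.
apply: (le_trans (ler_normD _ _)).
have h1 : `|\sum_(0 <= m < m0) u m x| <= C * inv_sum m0.
  apply: (le_trans (ler_norm_sum _ _ _)).
  rewrite /inv_sum mulr_sumr -(big_mkord xpredT (fun m => C * (a m)^-1)).
  by apply: ler_sum => m _; exact: uC.
have h2 : `|\sum_(m0 <= m < n) u m x| <= d / 2 * inv_sum n.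
  apply: (le_trans (ler_norm_sum _ _ _)).
  apply: (@le_trans _ _ (\sum_(m0 <= m < n) d / 2 * (a m)^-1)).
    rewrite !big_nat; apply: ler_sum => m /andP [mm0 _]; exact: Hm0.
  rewrite /inv_sum mulr_sumr -(big_mkord xpredT (fun m => d / 2 * (a m)^-1)).
  rewrite [leRHS](@big_cat_nat _ _ _ m0) //= lerDr sumr_ge0 // => m _.
  by rewrite mulr_ge0 ?(ltW d2) // invr_ge0 ltW.
lra.
Qed.

Lemma ratio_small d : 0 < d -> exists m0, forall m, (m0 <= m)%N ->
  `|(a m)^-1 - (a m.+1)^-1| <= d / a m.
Proof.
move=> d0; have : a m / a m.+1 @[m --> \oo] --> (1 : R).
  by rewrite (cvg_shiftS (fun n => a n.-1 / a n)).
move=> /cvgrPdist_le /(_ _ d0) [m0 _ H]; exists m0 => m /H /= h.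
have -> : (a m)^-1 - (a m.+1)^-1 = (1 - a m / a m.+1) / a m.
  by field; rewrite !gt_eqF.
by rewrite normrM [`|_^-1|]gtr0_norm ?invr_gt0 // ler_wpM2r // invr_ge0 ltW.
Qed.

Lemma ratio_bounded : exists2 C, 0 < C & forall m,
  `|(a m)^-1 - (a m.+1)^-1| <= C / a m.
Proof.
have [m0 H] := ratio_small ltr01.
have [C C0 HC] := finite_upper_bound m0 (fun m => `|(a m)^-1 - (a m.+1)^-1| * a m).
exists (C + 1); first by rewrite addr_gt0.
move=> m; rewrite ler_pdivlMr //; have [nn0|nn0] := ltnP m m0.
  by have := HC m nn0; lra.
by have := H m nn0; rewrite ler_pdivlMr //; lra.
Qed.

(** As consecutive weights are asymptotically equal, shifting an N-periodic
    sequence by one index changes its weighted sum by a negligible amount; the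
    N shifts add up to a constant sequence. *)
Lemma cesaro_periodic (C d : R) : 0 < C -> 0 < d ->
  exists n0, forall n (f : nat -> R), (n0 <= n)%N -> (forall i, `|f i| <= C) ->
    `|\sum_(m < n) f (m %% N)%N / a m - (\sum_(i < N) f i) / N%:R * inv_sum n|
      <= d * inv_sum n.
Proof.
move=> C0 d0; have N0 : 0 < N%:R :> R by rewrite ltr0n.
pose A (f : nat -> R) l n := \sum_(m < n) f ((m + l) %% N)%N / a m.
have [n0 Hshift] : exists n0, forall n f l, (n0 <= n)%N -> (forall i, `|f i| <= C) ->
    `|A f l.+1 n - A f l n| <= d / N%:R * inv_sum n.
  have d' : 0 < d / N%:R / 2 by rewrite !divr_gt0.
  pose K (fl : (nat -> R) * nat) := forall i, `|fl.1 i| <= C.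
  pose u m (fl : (nat -> R) * nat) :=
    fl.1 ((m + fl.2.+1) %% N)%N * ((a m)^-1 - (a m.+1)^-1).
  have [D D0 HD] := ratio_bounded.
  have [n1 Hn1] : exists n1, forall n fl, (n1 <= n)%N -> K fl ->
      `|\sum_(m < n) u m fl| <= d / N%:R / 2 * inv_sum n.
    apply: (@cesaro_negligible _ K u (C * D)) d' => [m fl Kfl|e e0].
      by rewrite normrM -mulrA ler_pM.
    have [m0 Hm0] := ratio_small (divr_gt0 e0 C0).
    exists m0 => m fl m0m Kfl; rewrite normrM.
    apply: (@le_trans _ _ (C * (e / C / a m))).
      by rewrite ler_pM // Hm0.
    by rewrite le_eqVlt; apply/orP; left; apply/eqP; field; rewrite !gt_eqF.
  have [B B0 HB] := inv_bounded.
  have [n2 Hn2] := inv_sum_large (2 * C * B / (d / N%:R / 2)).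
  exists (maxn n1 n2) => n f l; rewrite geq_max => /andP [n1n /Hn2].
  rewrite ler_pdivrMr // => Hn Kf.
  have -> : A f l.+1 n - A f l n = \sum_(m < n) u m (f, l) +
     (f ((n + l) %% N)%N / a n - f (l %% N)%N / a 0).
    rewrite /A /u /= -sumrB.
    have -> : f ((n + l) %% N)%N / a n - f (l %% N)%N / a 0 =
      \sum_(m < n) (f ((m.+1 + l) %% N)%N / a m.+1 - f ((m + l) %% N)%N / a m).
      rewrite -(big_mkord xpredT (fun m => f ((m.+1 + l) %% N)%N / a m.+1 - f ((m + l) %% N)%N / a m)).
      by rewrite telescope_sumr.
    by rewrite -big_split; apply: eq_bigr => m _ /=; rewrite addSnnS; ring.
  apply: (le_trans (ler_normD _ _)).
  have h1 := Hn1 n (f, l) n1n Kf.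
  have bd i m : `|f i / a m| <= C * B.
    rewrite normrM ler_pM // [`|_^-1|]gtr0_norm ?invr_gt0 //.
  have h2 := le_trans (ler_normB (f ((n + l) %% N)%N / a n) (f (l %% N)%N / a 0))
    (lerD (bd _ _) (bd _ _)).
  lra.
exists n0 => n f n0n Kf; have r0 := inv_sum_ge0 n.
have far l : `|A f l n - A f 0 n| <= l%:R * (d / N%:R * inv_sum n).
  elim: l => [|l IH]; first by rewrite subrr normr0 mul0r.
  have -> : A f l.+1 n - A f 0 n = (A f l.+1 n - A f l n) + (A f l n - A f 0 n) by ring.
  apply: (le_trans (ler_normD _ _)); rewrite -natr1 mulrDl mul1r addrC.
  by apply: lerD => //; exact: Hshift.
have period m : \sum_(l < N) f ((m + l) %% N)%N = \sum_(i < N) f i.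
  elim: m => [|m IH]; first by apply: eq_bigr => i _; rewrite add0n modn_small.
  rewrite -IH; case: (N) N_gt0 => // n' _.
  rewrite big_ord_recr /= [RHS]big_ord_recl /= addn0 addrC addSnnS modnDr.
  by congr (_ + _); apply: eq_bigr => i _; rewrite /bump /= add1n addSnnS.
have sumA : \sum_(l < N) A f l n = (\sum_(i < N) f i) * inv_sum n.
  rewrite /A exchange_big /= mulr_sumr; apply: eq_bigr => m _.
  by rewrite -mulr_suml period.
have -> : \sum_(m < n) f (m %% N)%N / a m = A f 0 n.
  by apply: eq_bigr => m _; rewrite addn0.
have -> : A f 0 n - (\sum_(i < N) f i) / N%:R * inv_sum n =
  - (\sum_(l < N) (A f l n - A f 0 n)) / N%:R.
  rewrite sumrB sumA sumr_const card_ord -mulr_natl; field.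
  by rewrite gt_eqF.
rewrite normrM normrN [`|_^-1|]gtr0_norm ?invr_gt0 // ler_pdivrMr //.
apply: (le_trans (ler_norm_sum _ _ _)).
apply: (@le_trans _ _ (\sum_(l < N) N%:R * (d / N%:R * inv_sum n))).
  apply: ler_sum => l _; apply: (le_trans (far l)).
  rewrite ler_wpM2r ?mulr_ge0 ?divr_ge0 ?(ltW d0) //.
  by rewrite ler_nat ltnW.
rewrite sumr_const card_ord -mulr_natl.
by rewrite le_eqVlt; apply/orP; left; apply/eqP; field; rewrite gt_eqF.
Qed.

End CesaroMeans.

Section Residual.
Variable R : realType.

(** Let Y be traceless with determinant D > 0 and w = (u, v).  Along the flow
    w' = Y w, which is a rotation, v^2 is the constant (Y10 / 2D) det(w, Y w)
    minus the derivative of v (Y w)_2 / 2D, because Y^2 = - D.  One period of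
    the recurrence is a step of size 1/A of this flow, up to the sign sigma and
    errors controlled by [d]. *)
Lemma residual_bound (Y T : 'M[R]_2) (sigma u v A am g C d eta : R) :
    let u' := sigma * u + (T 0 0 * u + T 0 1 * v) / A in
    let v' := sigma * v + (T 1 0 * u + T 1 1 * v) / A in
    let D := Y 0 0 * Y 1 1 - Y 0 1 * Y 1 0 in
    let z am u v := sigma / (2 * D) * (am * (v * (Y 1 0 * u + Y 1 1 * v))) in
    sigma ^+ 2 = 1 -> 0 < A -> 0 < am -> 0 < eta -> 0 <= d -> 1 <= C ->
    Y 0 0 + Y 1 1 = 0 -> eta <= D ->
    (forall k l, `|Y k l| <= C) -> (forall k l, `|T k l| <= C) ->
    (forall k l, `|(T - Y) k l| <= d) ->
    am * (u ^+ 2 + v ^+ 2) <= C ->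
    `|am * wronskian_form T u v - g| <= d -> `|A - am| <= d -> A^-1 <= d ->
  `|v ^+ 2 + (z A u' v' - z am u v) - Y 1 0 * g / (2 * D) / am|
    <= 10 * C ^+ 4 / eta * d / am.
Proof.
move=> u' v' D z s2 A0 am0 eta0 d0 C1 trY etaD Yle Tle TY ww Sg Aam Ad.
have D0 : 0 < D by exact: lt_le_trans eta0 etaD.
have C0 : 0 <= C by lra.
have D0' : Y 0 0 * Y 1 1 - Y 0 1 * Y 1 0 != 0 by rewrite gt_eqF.
have Y00 : Y 0 0 = - Y 1 1 by lra.
pose E k l := T k l - Y k l.
have Ele k l : `|E k l| <= d by have := TY k l; rewrite mxE [X in _ + X]mxE.
pose w := `|u| + `|v|; have w0 : 0 <= w by rewrite addr_ge0.
have vw : `|v| <= w by rewrite lerDr.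
have lin c x y (k l x' : R) : 0 <= c -> `|k| <= c -> `|l| <= c ->
    `|x| <= x' -> `|y| <= x' -> `|k * x + l * y| <= 2 * (c * x').
  move=> c0 kc lc xx' yx'; apply: (le_trans (ler_normD _ _)).
  by rewrite !normrM mulr2n mulrDl mul1r; apply: lerD; apply: ler_pM.
have lin' c k l : 0 <= c -> `|k| <= c -> `|l| <= c -> `|k * u + l * v| <= c * w.
  move=> c0 kc lc; apply: (le_trans (ler_normD _ _)).
  by rewrite !normrM mulrDr; apply: lerD; apply: ler_wpM2r.
have ww2 : w ^+ 2 <= 2 * (C / am).
  have h : u ^+ 2 + v ^+ 2 <= C / am by rewrite ler_pdivlMr // mulrC.
  have := sqr_ge0 (`|u| - `|v|); rewrite /w.
  have := real_normK (num_real u); have := real_normK (num_real v); lra.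
pose rho := Y 1 0 * u + Y 1 1 * v.
have rhole : `|rho| <= C * w by exact: lin'.
pose T1 := T 0 0 * u + T 0 1 * v; pose T2 := T 1 0 * u + T 1 1 * v.
pose E1 := E 0 0 * u + E 0 1 * v; pose E2 := E 1 0 * u + E 1 1 * v.
have T1le : `|T1| <= C * w by exact: lin'.
have T2le : `|T2| <= C * w by exact: lin'.
have E1le : `|E1| <= d * w by exact: lin'.
have E2le : `|E2| <= d * w by exact: lin'.
pose WE := E 1 0 * u ^+ 2 + (E 1 1 - E 0 0) * u * v - E 0 1 * v ^+ 2.
pose x1 := Y 1 0 * (am * wronskian_form T u v - g) / am.
pose x2 := Y 1 0 * (u * E2 - v * E1).
pose x3 := v * (Y 1 0 * E1 + Y 1 1 * E2) + E2 * rho.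
pose x4 := sigma * ((A - am) * (v * rho)).
pose x5 := sigma * (A^-1 * (T2 * (Y 1 0 * T1 + Y 1 1 * T2))).
have main : v ^+ 2 + (z A u' v' - z am u v) - Y 1 0 * g / (2 * D) / am =
    (x1 - x2 + x3 + x4 + x5) / (2 * D).
  have Ez : z A u' v' = (A * (v * rho) + sigma * (v * (Y 1 0 * T1 + Y 1 1 * T2) + T2 * rho)
      + A^-1 * (T2 * (Y 1 0 * T1 + Y 1 1 * T2))) * (sigma / (2 * D)).
    have -> : z A u' v' = (sigma ^+ 2 * (A * (v * rho))
      + sigma * (v * (Y 1 0 * T1 + Y 1 1 * T2) + T2 * rho)
      + A^-1 * (T2 * (Y 1 0 * T1 + Y 1 1 * T2))) * (sigma / (2 * D)).
      rewrite /z /u' /v' /rho -/T1 -/T2; field.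
      by rewrite !gt_eqF.
    by rewrite s2 mul1r.
  have Es : sigma * (v * (Y 1 0 * T1 + Y 1 1 * T2) + T2 * rho) * sigma =
      v * (Y 1 0 * T1 + Y 1 1 * T2) + T2 * rho.
    by rewrite mulrAC -expr2 s2 mul1r.
  have -> : z A u' v' = ((A * (v * rho)) * sigma +
      sigma * (v * (Y 1 0 * T1 + Y 1 1 * T2) + T2 * rho) * sigma +
      sigma * (A^-1 * (T2 * (Y 1 0 * T1 + Y 1 1 * T2)))) / (2 * D).
    by rewrite Ez; ring.
  rewrite Es /x1 /x2 /x3 /x4 /x5 /z /E1 /E2 /E /wronskian_form -/rho.
  have TE1 : T1 = E1 + (Y 0 0 * u + Y 0 1 * v) by rewrite /T1 /E1 /E; ring.
  move: D0'; rewrite -/D /D /rho /T1 /T2 Y00 => D0'.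
  by field; rewrite D0' !gt_eqF.
have b1 : `|x1| <= C * d / am.
  rewrite /x1 !normrM [`|am^-1|]gtr0_norm ?invr_gt0 //.
  by rewrite ler_wpM2r ?invr_ge0 ?(ltW am0) // ler_pM.
have pw c e x : 0 <= c -> 0 <= e -> x <= (c * w) * (e * w) -> x <= 2 * (c * e) * (C / am).
  move=> c0 e0 h; apply: (le_trans h).
  have -> : (c * w) * (e * w) = (c * e) * w ^+ 2 by ring.
  have -> : 2 * (c * e) * (C / am) = (c * e) * (2 * (C / am)) by ring.
  by rewrite ler_wpM2l // mulr_ge0.
have q0 : 0 <= C / am by rewrite divr_ge0 ?(ltW am0).
have uw : `|u| <= w by rewrite lerDl.
have b2 : `|x2| <= 4 * (C * d) * (C / am).
  have h : `|u * E2 - v * E1| <= 2 * (w * (d * w)).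
    apply: (le_trans (ler_normB _ _)); rewrite !normrM mulr2n mulrDl mul1r.
    by apply: lerD; apply: ler_pM.
  rewrite /x2 normrM; apply: (le_trans (ler_pM _ _ (Yle 1 0) h)) => //.
  have := pw C d (C * w * (d * w)) C0 d0 (lexx _); lra.
have b3 : `|x3| <= 6 * (C * d) * (C / am).
  have h1 := lin C E1 E2 (Y 1 0) (Y 1 1) (d * w) C0 (Yle 1 0) (Yle 1 1) E1le E2le.
  have h2 : `|v * (Y 1 0 * E1 + Y 1 1 * E2)| <= 2 * ((C * w) * (d * w)).
    rewrite normrM; apply: (le_trans (ler_pM _ _ vw h1)) => //.
    by rewrite le_eqVlt; apply/orP; left; apply/eqP; ring.
  have h3 : `|E2 * rho| <= (C * w) * (d * w).
    by rewrite normrM mulrC; apply: ler_pM.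
  have h4 := pw C d (C * w * (d * w)) C0 d0 (lexx _).
  rewrite /x3; apply: (le_trans (ler_normD _ _)); lra.
have s1 : `|sigma| = 1.
  by apply/eqP; rewrite -(@pexpr_eq1 _ _ 2) // real_normK ?num_real // s2.
have b4 : `|x4| <= 2 * (C * d) * (C / am).
  rewrite /x4 normrM s1 mul1r normrM; apply: pw => //.
  apply: (@le_trans _ _ (d * (w * (C * w)))).
    by apply: ler_pM => //; rewrite normrM; apply: ler_pM.
  by rewrite le_eqVlt; apply/orP; left; apply/eqP; ring.
have b5 : `|x5| <= 4 * (C ^+ 3 * d) * (C / am).
  have h1 := lin C T1 T2 (Y 1 0) (Y 1 1) (C * w) C0 (Yle 1 0) (Yle 1 1) T1le T2le.
  rewrite /x5 normrM s1 mul1r normrM.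
  have h2 : `|T2 * (Y 1 0 * T1 + Y 1 1 * T2)| <= C * w * (2 * (C * (C * w))).
    by rewrite normrM; apply: ler_pM.
  have h3 : `|A^-1| <= d by rewrite gtr0_norm // invr_gt0.
  apply: (le_trans (ler_pM _ _ h3 h2)) => //.
  have := pw d (C ^+ 3) (d * w * (C ^+ 3 * w)) d0 (exprn_ge0 3 C0) (lexx _).
  have -> : d * (C * w * (2 * (C * (C * w)))) = 2 * (d * w * (C ^+ 3 * w)) by ring.
  lra.
rewrite main normrM [`|_^-1|]gtr0_norm ?invr_gt0 ?mulr_gt0 //.
rewrite ler_pdivrMr ?mulr_gt0 //.
have c12 : C <= C ^+ 4.
  by rewrite -[X in X <= _]expr1; apply: ler_weXn2l.
have c22 : C ^+ 2 <= C ^+ 4 by apply: ler_weXn2l.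
have total : `|x1 - x2 + x3 + x4 + x5| <= 17 * C ^+ 4 * (d / am).
  have t1 := ler_normD (x1 - x2 + x3 + x4) x5.
  have t2 := ler_normD (x1 - x2 + x3) x4.
  have t3 := ler_normD (x1 - x2) x3.
  have t4 := ler_normB x1 x2.
  have e0 : 0 <= d / am by rewrite divr_ge0 ?(ltW am0).
  have f1 : C * d / am <= C ^+ 4 * (d / am) by rewrite -mulrA ler_wpM2r.
  have f2 : (C * d) * (C / am) <= C ^+ 4 * (d / am).
    have -> : (C * d) * (C / am) = C ^+ 2 * (d / am) by ring.
    by rewrite ler_wpM2r.
  have f3 : (C ^+ 3 * d) * (C / am) = C ^+ 4 * (d / am) by ring.
  lra.
apply: (le_trans total).
have -> : 10 * C ^+ 4 / eta * d / am * (2 * D) = 20 * C ^+ 4 * (d / am) * (D / eta).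
  by field; rewrite !gt_eqF.
have De : 1 <= D / eta by rewrite ler_pdivlMr // mul1r.
have e0 : 0 <= C ^+ 4 * (d / am) by rewrite mulr_ge0 ?exprn_ge0 // divr_ge0 ?(ltW am0).
have := ler_wpM2l e0 De; lra.
Qed.

End Residual.

(** * Finite sums *)

Lemma continuous_sum (R : realType) n (f : nat -> R -> R) (x : R) :
    (forall i, (i < n)%N -> {for x, continuous (f i)}) ->
  {for x, continuous (fun y => \sum_(i < n) f i y)}.
Proof.
elim: n => [|n IH] cf.
  rewrite (_ : (fun y => _) = cst 0); first exact: cvg_cst.
  by apply/funext => y; rewrite big_ord0.
rewrite (_ : (fun y => _) = (fun y => \sum_(i < n) f i y + f n y)); last first.
  by apply/funext => y; rewrite big_ord_recr.
apply: cvgD; last exact: cf.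
by apply: IH => i ni; apply: cf; rewrite ltnW.
Qed.

Lemma sum_succ_mod (R : realType) N (f : R^nat) : (0 < N)%N ->
  \sum_(i < N) f (i.+1 %% N)%N = \sum_(i < N) f i.
Proof.
case: N => // n _; rewrite big_ord_recr big_ord_recl /= addrC; congr (f _ + _).
  by rewrite modnn.
by apply: eq_bigr => i _; rewrite modn_small // ltnS.
Qed.

Lemma sumr_const_seq (R : realType) (s : seq R) (v : R) : \sum_(z <- s) v = v *+ size s.
Proof. by rewrite big_const_seq count_predT iter_addr_0. Qed.

(** * From local estimates of a measure to its density *)

Section LocalDensity.
Variables (R : realType) (mu : probability (measurableTypeR R) R).
Variables (L : set R) (w : R -> R).
Hypothesis w_cont : {in L, continuous w}.
Hypothesis w_ge0 : forall x, L x -> 0 <= w x.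
Hypothesis mu_local : forall x e, L x -> 0 < e -> exists2 r, 0 < r &
  forall c d, x - r <= c -> c <= d -> d <= x + r ->
    `|fine (mu `[c, d]%classic) - w x * (d - c)| <= e * (d - c).

Lemma local_density_atomless x : L x -> mu [set x] = 0%E.
Proof.
move=> Lx; have [r r0 /(_ x x)] := mu_local Lx ltr01.
rewrite subrr !mulr0 subr0 normr_le0 set_itv1 => H.
have /eqP : fine (mu [set x]) == 0 by apply: H; rewrite ?lexx ?lerBlDr ?lerDl ?ltW.
by move=> h; rewrite -(fineK (fin_num_measure mu _ _)) ?h // -set_itv1.
Qed.

Lemma mass_itvoc x y : L x -> x <= y -> mu `]x, y]%classic = mu `[x, y]%classic.
Proof.
move=> Lx xy; transitivity (mu [set x] + mu `]x, y]%classic)%E.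
  by rewrite (local_density_atomless Lx) add0e.
rewrite -set_itv1 -measureU //; last first.
  by apply/seteqP; split => z //= []; rewrite !in_itv /= => /andP [_ zx] /andP []; rewrite ltNge zx.
by rewrite -itv_bndbnd_setU // bnd_simp.
Qed.

Let G c x := fine (mu `[c, x]%classic).

Lemma cdf_increment c x y : L x -> c <= x -> x <= y ->
  G c y - G c x = fine (mu `[x, y]%classic).
Proof.
move=> Lx cx xy; have fin i : mu [set` i : interval R] \is a fin_num by exact: fin_num_measure.
have E1 : mu `[c, y]%classic = (mu `[c, x]%classic + mu `]x, y]%classic)%E.
  rewrite -measureU //; last first.
    by apply/seteqP; split => z //= []; rewrite !in_itv /= => /andP [_ zx] /andP []; rewrite ltNge zx.
  by rewrite -itv_bndbnd_setU // bnd_simp.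
by rewrite -mass_itvoc // /G E1 fineD // addrAC subrr add0r.
Qed.

Lemma cdf_slope c d x e : `[c, d] `<=` L -> c <= x <= d -> 0 < e ->
  \forall z \near x, c <= z <= d -> `|G c z - G c x - w x * (z - x)| <= e * `|z - x|.
Proof.
move=> cdL cxd e0; have Lin z : c <= z <= d -> L z by move=> h; apply: cdL; rewrite /= in_itv.
have Lx := Lin x cxd; have [r r0 H] := mu_local Lx e0.
have /andP [cx xd] := cxd.
have nr : \forall z \near x, `|x - z| <= r.
  by have /cvgrPdist_le/(_ _ r0) : z @[z --> x] --> x by exact: cvg_id.
near=> z; move=> /[dup] czd /andP [cz zd].
have : `|x - z| <= r by near: z.
rewrite ler_norml => /andP [h1 h2].
have [xz|/ltW zx] := leP x z.
  by rewrite cdf_increment // [`|z - x|]ger0_norm ?subr_ge0 // H //; lra.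
rewrite (_ : G c z - _ - _ = - (G c x - G c z - w x * (x - z))); last by ring.
rewrite normrN [`|z - x|]distrC cdf_increment //; last exact: Lin.
by rewrite [`|x - z|]ger0_norm ?subr_ge0 // H //; lra.
Unshelve. all: end_near. Qed.

(** The local estimate makes x |-> mu [c, x] differentiable with derivative w,
    so the fundamental theorem of calculus gives the mass of an interval. *)
Lemma mass_interval c d : `[c, d] `<=` L -> c <= d ->
  mu `]c, d]%classic = (\int[@lebesgue_measure R]_(x in `]c, d]) (w x)%:E)%E.
Proof.
move=> cdL; rewrite le_eqVlt => /predU1P [->|cd].
  by rewrite set_itvoc0 measure0 integral_set0.
have Lin z : c <= z <= d -> L z by move=> h; apply: cdL; rewrite /= in_itv.
have Lc : L c by apply: Lin; rewrite lexx ltW.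
have cw : {within `[c, d], continuous w}.
  by apply: continuous_in_subspaceT => z /set_mem /cdL Lz; apply: w_cont; rewrite inE.
rewrite integral_itv_obnd_cbnd; last first.
  apply/measurable_EFinP; apply: measurable_funS (subspace_continuous_measurable_fun _ cw) => //.
  by apply: subset_itvr; rewrite bnd_simp.
have atom : mu [set c] = 0%E by exact: local_density_atomless.
rewrite (mass_itvoc Lc (ltW cd)).
have cont x e : c <= x <= d -> 0 < e ->
    \forall z \near x, c <= z <= d -> `|G c x - G c z| <= e.
  move=> cxd e0; have w1 : 0 < w x + 1 by rewrite ltr_wpDl // w_ge0 //; exact: Lin.
  have ew : 0 < e / (w x + 1) by rewrite divr_gt0.
  have nr : \forall z \near x, `|x - z| <= e / (w x + 1).
    by have /cvgrPdist_le/(_ _ ew) : z @[z --> x] --> x by exact: cvg_id.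
  have sl := cdf_slope cdL cxd ltr01.
  near=> z => czd.
  have /(_ czd) : c <= z <= d -> `|G c z - G c x - w x * (z - x)| <= 1 * `|z - x| by near: z.
  rewrite mul1r => h1; have h2 : `|x - z| <= e / (w x + 1) by near: z.
  rewrite ler_pdivlMr // in h2; apply: le_trans h2.
  rewrite (_ : G c x - _ = - (G c z - G c x - w x * (z - x) + w x * (z - x))); last by ring.
  rewrite normrN (le_trans (ler_normD _ _)) // normrM (ger0_norm (w_ge0 _)); last exact: Lin.
  rewrite [`|x - z|]distrC; lra.
have deriv x : x \in `]c, d[ -> h^-1 *: (G c (h *: 1 + x) - G c x) @[h --> 0^'] --> w x.
  rewrite in_itv /= => /andP [cx xd].
  have cxd : c <= x <= d by rewrite !ltW.
  apply/cvgrPdist_le => e e0.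
  have sl := cdf_slope cdL cxd e0.
  have sl0 : \forall h \near (0 : R), c <= h + x <= d ->
      `|G c (h + x) - G c x - w x * (h + x - x)| <= e * `|h + x - x|.
    have : h + x @[h --> (0 : R)] --> x.
      by rewrite -[X in _ --> X]add0r; apply: cvgD; [exact: cvg_id|exact: cvg_cst].
    by move=> /(_ _ sl).
  have nin : \forall h \near (0 : R), c <= h + x <= d.
    have r0 : 0 < Num.min (x - c) (d - x) by rewrite lt_min !subr_gt0 cx.
    have /cvgrPdist_le/(_ _ r0) : z @[z --> (0 : R)] --> (0 : R) by exact: cvg_id.
    apply: filterS => h /=; rewrite sub0r normrN ler_norml le_min => /andP [h1 h2].
    by move: h2 h1; rewrite lerNl le_min => ? ?; lra.
  have /= sl1 := nbhs_dnbhs sl0; have /= nin1 := nbhs_dnbhs nin.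
  near=> h; have h0 : h != 0 by near: h; exact: nbhs_dnbhs_neq.
  have hin : c <= h + x <= d by near: h.
  have /(_ hin) : c <= h + x <= d ->
    `|G c (h + x) - G c x - w x * (h + x - x)| <= e * `|h + x - x| by near: h.
  rewrite addrK => H.
  rewrite /= scaler1 /GRing.scale /= (_ : w x - _ = - (h^-1 * (G c (h + x) - G c x - w x * h))).
    by rewrite normrN normrM normfV ler_pdivrMl ?normr_gt0 // [leRHS]mulrC.
  by move: (G c (h + x)) (G c x) (w x) => ? ? ?; field.
have der x : x \in `]c, d[ -> derivable (G c) x 1 /\ (G c)^`()%classic x = w x.
  move=> xcd; have H := deriv x xcd.
  have dG : derivable (G c) x 1 by exact: cvgP H.
  by split => //; rewrite derive1E; exact: cvg_lim H.
have ccd : c <= c <= d by rewrite lexx ltW.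
have dcd : c <= d <= d by rewrite lexx ltW.
rewrite (@continuous_FTC2 _ _ (G c)) //.
- by rewrite /G set_itv1 atom /= sube0 fineK // fin_num_measure.
- split.
  + by move=> x /der [].
  + apply/cvgrPdist_le => e e0; have cc : \forall z \near c^'+,
        c <= z <= d -> `|G c c - G c z| <= e by apply: cvg_within; exact: cont.
    near=> z; have : c <= z <= d.
      by apply/andP; split; apply: ltW; near: z; [exact: nbhs_right_gt|exact: nbhs_right_lt].
    by near: z.
  + apply/cvgrPdist_le => e e0; have cc : \forall z \near d^'-,
        c <= z <= d -> `|G c d - G c z| <= e by apply: cvg_within; exact: cont.
    near=> z; have : c <= z <= d.
      by apply/andP; split; apply: ltW; near: z; [exact: nbhs_left_gt|exact: nbhs_left_lt].
    by near: z.
- by move=> x /der [].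
Unshelve. all: end_near. Qed.

End LocalDensity.

Section DensityUnique.
Variables (R : realType) (mu : probability (measurableTypeR R) R).
Variables (L : set R) (w : R -> R).
Hypothesis openL : open L.
Hypothesis w_cont : {in L, continuous w}.
Hypothesis w_ge0 : forall x, L x -> 0 <= w x.
Hypothesis mu_itv : forall c d, `[c, d] `<=` L -> c <= d ->
  mu `]c, d]%classic = (\int[@lebesgue_measure R]_(x in `]c, d]) (w x)%:E)%E.

Let f : R -> \bar R := fun x => ((w \_ L) x)%:E.

Let f_ge0 x : (0 <= f x)%E.
Proof. by rewrite lee_fin patchE; case: ifP => // /set_mem; exact: w_ge0. Qed.

Let mf : measurable_fun setT f.
Proof.
apply/measurable_EFinP.
have mL : measurable (L : set (measurableTypeR R)) by exact: open_measurable.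
apply: (iffLR (measurable_restrictT w mL)).
exact: open_continuous_measurable_fun.
Qed.

Let dens (A : set (measurableTypeR R)) := (\int[@lebesgue_measure R]_(x in A) f x)%E.

Let dens0 : dens set0 = 0%E. Proof. exact: integral_set0. Qed.
Let dens_ge0 A : (0 <= dens A)%E. Proof. by apply: integral_ge0. Qed.
Let dens_additive : semi_sigma_additive dens.
Proof. exact: semi_sigma_additive_nng_induced. Qed.
HB.instance Definition _ := isMeasure.Build _ _ _ dens dens0 dens_ge0 dens_additive.

Let densE A : A `<=` L -> dens A = (\int[@lebesgue_measure R]_(x in A) (w x)%:E)%E.
Proof.
by move=> AL; apply: eq_integral => x /set_mem /AL Lx; rewrite /f patchE mem_set.
Qed.

(** The two measures restricted to ]c, d] agree on half-open intervals, which
    generate the Borel sets. *)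
Lemma mass_in_interval c d A : `[c, d] `<=` L -> measurable A -> A `<=` `]c, d] ->
  mu A = dens A.
Proof.
move=> cdL mA Acd.
have mD : measurable (`]c, d]%classic : set (measurableTypeR R)) by exact: measurable_itv.
have AD : A `&` `]c, d] = A by apply: setIidl.
pose m1 : {measure set (measurableTypeR R) -> \bar R} := mrestr mu mD.
pose m2 : {measure set (measurableTypeR R) -> \bar R} := mrestr dens mD.
suff : m1 A = m2 A by rewrite /m1 /m2 /= /mrestr AD.
apply: (@measure_unique _ R (measurableTypeR R) (@ocitv R)
  (fun k : nat => `](- k%:R), k%:R]%classic)) => //.
- exact: ocitvI.
- by move=> k; exact: is_ocitv.
- exact: bigcup_itvT.
- move=> _ [[x y] _ <-] /=; rewrite /mrestr.
  have -> : `]x, y] `&` `]c, d] = `]Num.max x c, Num.min y d]%classic.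
    apply/seteqP; split => z /=; rewrite !in_itv /= gt_max le_min.
      by move=> [/andP [-> ->] /andP [-> ->]].
    by move=> /andP [/andP [-> ->] /andP [-> ->]].
  have [lu|ul] := leP (Num.max x c) (Num.min y d); last first.
    by rewrite set_itv_ge ?bnd_simp -?leNgt ?(ltW ul) // dens0 measure0.
  have luL : `[Num.max x c, Num.min y d] `<=` L.
    apply: subset_trans cdL; apply: subset_itv; rewrite bnd_simp ?le_max ?ge_min lexx ?orbT //.
  rewrite mu_itv // densE // => z zlu; apply: luL.
  by move: zlu; rewrite /= !in_itv /= => /andP [/ltW -> ->].
- move=> k; rewrite /mrestr; apply: le_lt_trans (probability_le1 _ _) _ => //.
    by apply: measurableI => //; exact: measurable_itv.
  by rewrite ltry.
Qed.

(** The open set L is a countable disjoint union of subsets of intervals to which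
    [mass_in_interval] applies. *)
Lemma mass_density (A : set (measurableTypeR R)) : measurable A -> A `<=` L ->
  mu A = (\int[@lebesgue_measure R]_(x in A) (w x)%:E)%E.
Proof.
move=> mA AL; rewrite -densE //.
(* The half-open intervals with rational ends whose closure lies in L. *)
pose F n : set (measurableTypeR R) := if unpickle n is Some (s, t) then
  if `[< `[ratr s, ratr t] `<=` L >] then `]ratr s, ratr t]%classic else set0 else set0.
have mF n : measurable (F n).
  rewrite /F; case: unpickle => [[s t]|]; last exact: measurable0.
  by case: asboolP => _; [exact: measurable_itv|exact: measurable0].
have AF : A `<=` \bigcup_n F n.
  move=> x /AL Lx; have /nbhs_ballP [r /= r0 rL] := open_nbhs_nbhs (conj openL Lx).
  have [|s] := @rat_in_itvoo R (x - r) x; first by rewrite ltrBlDr ltrDl.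
  have [|t] := @rat_in_itvoo R x (x + r); first by rewrite ltrDl.
  rewrite !in_itv /= => /andP [xt tr] /andP [rs sx].
  have [n nE] : exists n, unpickle n = Some (s, t) by exists (pickle (s, t)); exact: pickleK.
  exists n; first by [].
  rewrite /F nE; case: asboolP => [stL|[]]; first by rewrite /= in_itv /= sx ltW.
  move=> z; rewrite /= in_itv /= => /andP [sz zt]; apply: rL.
  by rewrite /ball /= ltr_norml; apply/andP; split; lra.
pose E n := seqDU F n `&` A.
have mE n : measurable (E n) by apply: measurableI => //; exact: seqDU_measurable.
have tE : trivIset setT E by exact: trivIset_setIr.
have AE : A = \bigcup_n E n.
  by rewrite /E -setI_bigcupl -seqDU_bigcup_eq setIidr.
rewrite {1}AE [in RHS]AE !measure_semi_bigcup //; try by rewrite -AE.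
apply: eq_eseriesr => n _; have EF : E n `<=` F n.
  by apply: subset_trans (@subIsetl _ _ _) _; exact: subset_seqDU.
have E0 : F n = set0 -> mu (E n) = dens (E n).
  by move=> F0; have -> : E n = set0; [rewrite -subset0 -F0|rewrite dens0 measure0].
move: EF E0; rewrite /F; case: (unpickle n) => [[s t]|]; last by move=> _ /(_ erefl).
case: asboolP => [stL Est _|_ _ /(_ erefl)] //.
by apply: (mass_in_interval stL); [exact: mE|exact: Est].
Qed.

End DensityUnique.

(** * Growth of the Christoffel-Darboux kernel *)

(** Along a progression of step N the a_n grow at most linearly, so the sum is
    bounded below by a multiple of the harmonic series. *)
Lemma carleman_condition (R : realType) (N : nat) (a : R^nat) : (0 < N)%N ->
    (forall n, 0 < a n) -> a (n + N)%N - a n @[n --> \oo] --> (0 : R) ->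
  \sum_(k < m) (a k)^-1 @[m --> \oo] --> +oo.
Proof.
move=> N_gt0 a_gt0 a_diff; pose u m := \sum_(k < m) (a k)^-1.
have uS m : u m.+1 = u m + (a m)^-1 by rewrite /u big_ord_recr.
have u_nd : nondecreasing_seq u.
  by apply/nondecreasing_seqP => m; rewrite uS lerDl invr_ge0 ltW.
apply: (nondecreasing_dvgn_lt u_nd) => u_cvg; apply: (@dvg_harmonic R).
have /cvgr0Pnorm_le /(_ _ ltr01) [n0 _ H] := a_diff.
have lin k : a (n0 + k * N)%N <= a n0 + k%:R.
  elim: k => [|k IH]; first by rewrite mul0n addn0 addr0.
  have := H (n0 + k * N)%N (leq_addr _ _); rewrite ler_norml => /andP [_].
  by rewrite -addnA -mulSnr -natr1; lra.
pose A := a n0 + 1; have A0 : 0 < A by rewrite addr_gt0.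
have below m : (series harmonic m : R) <= A * u (n0 + m * N)%N.
  elim: m => [|m IH].
    rewrite /series /= big_geq // mulr_ge0 ?(ltW A0) // sumr_ge0 // => i _.
    by rewrite invr_ge0 ltW.
  have -> : series harmonic m.+1 = series harmonic m + harmonic m :> R.
    by rewrite seriesSr.
  have h1 : harmonic m <= A * (a (n0 + m * N)%N)^-1.
    rewrite /harmonic /= ler_pdivlMr // ler_pdivrMl ?ltr0n //.
    have := lin m; have := a_gt0 n0; rewrite /A -natr1 => ? ?.
    have : 0 <= m%:R * a n0 by rewrite mulr_ge0 // ltW.
    lra.
  have h2 : u (n0 + m * N)%N.+1 <= u (n0 + m.+1 * N)%N.
    by apply: u_nd; rewrite mulSnr addnA -[X in (X < _)%N]addn0 ltn_add2l.
  have h3 := ler_wpM2l (ltW A0) h2; rewrite uS mulrDr in h3; lra.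
apply: nondecreasing_is_cvgn.
  by apply: nondecreasing_series => n _ _; exact: harmonic_ge0.
exists (A * limn u) => _ [m _ <-]; apply: (le_trans (below m)).
by rewrite ler_wpM2l ?(ltW A0) //; exact: nondecreasing_cvgn_le.
Qed.

Section KernelGrowth.
Variables (R : realType) (N : nat) (a b : R^nat) (q sigma : R).
Hypothesis N_gt0 : (0 < N)%N.
Hypothesis a_gt0 : forall n, 0 < a n.
Hypothesis a_ratio : a n.-1 / a n @[n --> \oo] --> (1 : R).
Hypothesis a_infty : a n @[n --> \oo] --> +oo.
Hypothesis a_diff : a (n + N)%N - a n @[n --> \oo] --> (0 : R).
Hypothesis carleman : \sum_(k < m) (a k)^-1 @[m --> \oo] --> +oo.
Hypothesis sigma_sign : sigma = 1 \/ sigma = -1.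
Hypothesis D1N_a : D1N N (fun n => a n - a n.-1).
Hypothesis D1N_b : D1N N (fun n => b n - q * a n).
Hypothesis D1N_inv : D1N N (fun n => (a n)^-1).
Hypothesis sigma_mx : mx2 0 1 (-1) (- q) ^+ N = sigma%:M.
Notation p := (orthpoly a b).
Notation T := (scaled_step N a b sigma).
Notation lmx := (limit_mx N a b sigma).
Notation turan := (turan N a b sigma).
Notation rho := (inv_sum a).

Let Tcvg := scaled_step_cvg N_gt0 a_gt0 D1N_a D1N_b D1N_inv sigma_mx.
Let turan_local' := turan_local N_gt0 a_gt0 D1N_a D1N_b D1N_inv sigma_mx.
Let limit_mx_uniform' := limit_mx_uniform N_gt0 a_gt0 D1N_a D1N_b D1N_inv sigma_mx.

Lemma leq_progression n i : (n <= n * N + i)%N.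
Proof. by rewrite (leq_trans (leq_pmulr _ N_gt0)) ?leq_addr. Qed.

(** The determinant of X_m is a_(m-1) / a_(m+N-1), and a_(m+N) - a_m tends to 0. *)
Lemma limit_mx_trace i x : lmx i x 0 0 + lmx i x 1 1 = 0.
Proof.
pose m n := (n * N + (N + i).-1)%N.
have mS n : (m n).+1 = (n.+1 * N + i)%N.
  by rewrite /m -addnS prednK ?addn_gt0 ?N_gt0 // addnA mulSnr.
have Tm k l : T (m n).+1 x k l @[n --> \oo] --> lmx i x k l.
  under eq_fun do rewrite mS.
  by apply: (cvg_along (f := fun n => T (n * N + i)%N x k l) (h := S)); [exact: leqnSn|exact: Tcvg].
have inv0 : (a (n + N)%N)^-1 @[n --> \oo] --> (0 : R).
  apply/cvgr0Pnorm_le => e e0; have [n0 H] := inv_small a_gt0 a_infty e0.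
  exists n0 => // n /= n0n; rewrite gtr0_norm ?invr_gt0 //.
  by apply: H; rewrite (leq_trans n0n) ?leq_addr.
have lim_s : sigma * (T (m n).+1 x 0 0 + T (m n).+1 x 1 1) @[n --> \oo] -->
    sigma * (lmx i x 0 0 + lmx i x 1 1).
  by apply: cvgMr; apply: cvgD; exact: Tm.
have lim_r : (a (m n) - a (m n + N)%N) - (T (m n).+1 x 0 0 * T (m n).+1 x 1 1 -
     T (m n).+1 x 0 1 * T (m n).+1 x 1 0) * (a (m n + N)%N)^-1 @[n --> \oo] -->
   - 0 - (lmx i x 0 0 * lmx i x 1 1 - lmx i x 0 1 * lmx i x 1 0) * 0.
  apply: cvgB.
    under eq_fun do rewrite -opprB.
    by apply: cvgN; exact: (cvg_along (leq_progression^~ (N + i).-1) a_diff).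
  apply: cvgM; last exact: (cvg_along (leq_progression^~ (N + i).-1) inv0).
  by apply: cvgB; apply: cvgM; exact: Tm.
have E : (fun n => sigma * (T (m n).+1 x 0 0 + T (m n).+1 x 1 1)) =
  (fun n => (a (m n) - a (m n + N)%N) - (T (m n).+1 x 0 0 * T (m n).+1 x 1 1 -
     T (m n).+1 x 0 1 * T (m n).+1 x 1 0) * (a (m n + N)%N)^-1).
  by apply/funext => n; rewrite trace_scaled_step.
rewrite E in lim_s; have : sigma * (lmx i x 0 0 + lmx i x 1 1) = 0.
  by rewrite (cvg_unique _ lim_s lim_r) // mulr0 subr0 oppr0.
move=> /eqP; rewrite mulf_eq0 => /orP [/eqP s0|/eqP //].
by have := sigma_sqr sigma_sign; rewrite s0 expr0n /= => /eqP; rewrite eq_sym oner_eq0.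
Qed.

Definition limit_det i x : R :=
  lmx i x 0 0 * lmx i x 1 1 - lmx i x 0 1 * lmx i x 1 0.

Lemma discr_limit_mx i x : discr (lmx i x) = - (4 * limit_det i x).
Proof.
rewrite discrE /limit_det; have : lmx i x 0 0 = - lmx i x 1 1.
  by have := limit_mx_trace i x; lra.
by move=> ->; ring.
Qed.

Definition turan_lim i x : R := periodic_lim N turan i x.

(** The determinant turan m is built from T (m + 1), hence the shift by one
    between its residue and that of the limit matrix. *)
Definition succ_residue i := (i.+1 %% N)%N.

Lemma succ_residue_mod m : succ_residue (m %% N) = (m.+1 %% N)%N.
Proof. by rewrite /succ_residue -addn1 modnDml addn1. Qed.

Lemma succ_residue_lt i : (succ_residue i < N)%N. Proof. by rewrite ltn_mod. Qed.

Lemma scaled_step_next_cvg i x k l : (i < N)%N ->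
  T (n * N + i).+1 x k l @[n --> \oo] --> lmx (succ_residue i) x k l.
Proof.
move=> iN; have [iN1|iN1] := ltnP i.+1 N.
  by rewrite /succ_residue modn_small //; under eq_fun do rewrite -addnS; exact: Tcvg.
have -> : succ_residue i = 0%N.
  by rewrite /succ_residue (_ : i.+1 = N) ?modnn //; apply/eqP; rewrite eqn_leq iN iN1.
under eq_fun => n.
  rewrite -addnS (_ : i.+1 = N); last by apply/eqP; rewrite eqn_leq iN iN1.
  rewrite -mulSnr -[(n.+1 * N)%N]addn0.
  over.
by apply: (cvg_along (f := fun n => T (n * N + 0)%N x k l) (h := S)); [exact: leqnSn|exact: Tcvg].
Qed.

Lemma local_bounds_lim K eta kappa C m1 : local_bounds N a b sigma K eta kappa C m1 ->
    progression_cauchy N K turan ->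
  forall i x, (i < N)%N -> K x ->
   [/\ forall k l, `|lmx i x k l| <= C, eta / 4 <= limit_det i x,
     kappa <= `|turan_lim i x|, `|turan_lim i x| <= C &
     0 <= lmx (succ_residue i) x 1 0 * turan_lim i x].
Proof.
move=> [eta0 kappa0 C0 Hd Hb] cS i x iN Kx.
have Sc := @periodic_lim_cvg R N N_gt0 K turan i x cS Kx.
have large n : (m1 <= n)%N -> (m1 <= n * N + i)%N.
  by move=> m1n; rewrite (leq_trans m1n) // (leq_trans (leq_pmulr _ N_gt0)) ?leq_addr.
split.
- move=> k l; have := Tcvg (i := i) (x := x) (k := k) (l := l) => /cvg_norm c.
  rewrite -(cvg_lim _ c) //; apply: limr_le; first exact: cvgP c.
  exists m1.+1 => // n /= m1n.
  have : (m1 <= (n * N + i).-1)%N.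
    rewrite -ltnS prednK ?(leq_trans m1n) //; rewrite ?addn_gt0 ?muln_gt0 ?N_gt0 ?(leq_ltn_trans _ m1n) //.
    by rewrite (leq_trans (leq_pmulr _ N_gt0)) ?leq_addr.
  move=> /(Hb _ x) /(_ Kx) [H _ _ _ _]; have := H k l.
  by rewrite prednK // addn_gt0 muln_gt0 N_gt0 (leq_ltn_trans _ m1n).
- by have := Hd i x iN Kx; rewrite discr_limit_mx; lra.
- rewrite -(cvg_lim _ (cvg_norm Sc)) //; apply: limr_ge; first exact: cvgP (cvg_norm Sc).
  by exists m1 => // n /= /large m1n; have [_ _ _ /andP []] := Hb _ x m1n Kx.
- rewrite -(cvg_lim _ (cvg_norm Sc)) //; apply: limr_le; first exact: cvgP (cvg_norm Sc).
  by exists m1 => // n /= /large m1n; have [_ _ _ /andP []] := Hb _ x m1n Kx.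
- have c : T (n * N + i).+1 x 1 0 * turan (n * N + i)%N x @[n --> \oo] -->
      lmx (succ_residue i) x 1 0 * turan_lim i x.
    by apply: cvgM => //; exact: scaled_step_next_cvg.
  rewrite -(cvg_lim _ c) //; apply: limr_ge; first exact: cvgP c.
  exists m1 => // n /= /large m1n; set m := (n * N + i)%N in m1n *.
  have [_ dT _ _ _] := Hb _ x m1n Kx.
  rewrite mulrCA pmulr_rge0 // mulrC; apply: wronskian_form_sign.
  by apply: (le_trans dT); rewrite oppr_le0 ltW.
Qed.

(** The mean of a_m p_(m+1)^2 over the rotations of the limit matrix, for m of
    residue i, as computed in [residual_bound]. *)
Definition growth_coef i x : R :=
  lmx (succ_residue i) x 1 0 * turan_lim i x / (2 * limit_det (succ_residue i) x).

Definition growth x : R := (\sum_(i < N) growth_coef i x) / N%:R.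

Lemma sum_shift_telescope (f : R^nat) m k :
  \sum_(m <= j < m + k) (f (j + N)%N - f j) =
  \sum_(i < N) (f (m + k + i)%N - f (m + i)%N).
Proof.
elim: k => [|k IH].
  rewrite addn0 big_geq // big1 // => i _; by rewrite subrr.
rewrite addnS big_nat_recr ?leq_addr //= IH.
have -> : f (m + k + N)%N - f (m + k)%N =
    \sum_(i < N) (f (m + k + i.+1)%N - f (m + k + i)%N).
  rewrite -(big_mkord xpredT (fun i => f (m + k + i.+1)%N - f (m + k + i)%N)).
  by rewrite telescope_sumr // addn0.
by rewrite -big_split; apply: eq_bigr => i _ /=; rewrite addSnnS; ring.
Qed.

Lemma continuous_CDkernel m : continuous (CDkernel a b m).
Proof.
move=> x; elim: m => [|m IH].
  rewrite (_ : CDkernel a b 0 = cst 0); first exact: cvg_cst.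
  by apply/funext => y; rewrite /CDkernel big_ord0.
rewrite (_ : CDkernel a b m.+1 = fun y => CDkernel a b m y + (p m).[y] ^+ 2).
  by apply: cvgD => //; rewrite expr2; apply: cvgM; exact: continuous_horner.
by apply/funext => y; rewrite CDkernelS.
Qed.

Lemma CDkernel_split m k x :
  CDkernel a b (m + k) x = CDkernel a b m x + \sum_(m <= j < m + k) (p j).[x] ^+ 2.
Proof.
elim: k => [|k IH]; first by rewrite addn0 big_geq // addr0.
by rewrite addnS CDkernelS IH big_nat_recr ?leq_addr //= addrA.
Qed.

(** The function z of [residual_bound] along the recurrence. *)
Definition boundary_term m x : R :=
  let Y := lmx (m.+1 %% N)%N x in
  sigma / (2 * limit_det (m.+1 %% N)%N x) *
    (a m * ((p m.+1).[x] * (Y 1 0 * (p m).[x] + Y 1 1 * (p m.+1).[x]))).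

Definition residual m x : R :=
  (p m.+1).[x] ^+ 2 + (boundary_term (m + N) x - boundary_term m x)
  - growth_coef (m %% N) x / a m.

Lemma local_residual x0 : Lambda N a b sigma x0 ->
  exists K B, [/\ nbhs x0 K, 0 < B,
    forall i x, (i < N)%N -> K x -> `|growth_coef i x| <= B,
    exists m1, forall m x, (m1 <= m)%N -> K x -> `|boundary_term m x| <= B &
    forall d, 0 < d -> exists m0, forall m x, (m0 <= m)%N -> K x ->
      `|residual m x| <= d / a m].
Proof.
move=> Lx0; have [K [eta [kappa [C' [m1 [nK KM Hloc cS]]]]]] :=
  turan_local' Lx0.
have [eta0 kappa0 C'0 Hd Hb] := Hloc.
pose C := C' + 1; have C1 : 1 <= C by rewrite lerDr ltW.
have C'C : C' <= C by rewrite lerDl.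
have Hlim := local_bounds_lim Hloc cS.
have D0 i x : (i < N)%N -> K x -> 0 < limit_det i x.
  by move=> iN Kx; have [_ h _ _ _] := Hlim i x iN Kx; apply: lt_le_trans h; rewrite divr_gt0.
have DV i x : (i < N)%N -> K x -> (2 * limit_det i x)^-1 <= 2 / eta.
  move=> iN Kx; have [_ h _ _ _] := Hlim i x iN Kx.
  rewrite -[leLHS]mul1r ler_pdivrMr ?mulr_gt0 ?D0 // mulrAC ler_pdivlMr //; lra.
exists K, (4 * C ^+ 2 / eta); split => //.
- by rewrite divr_gt0 // mulr_gt0 // exprn_gt0 // (lt_le_trans ltr01).
- move=> i x iN Kx; rewrite /growth_coef !normrM.
  have [_ _ _ h2 _] := Hlim i x iN Kx; have [h1 _ _ _ _] := Hlim _ x (succ_residue_lt i) Kx.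
  rewrite [`|_^-1|]gtr0_norm ?invr_gt0 ?mulr_gt0 ?D0 ?succ_residue_lt //.
  apply: (@le_trans _ _ (C * C * (2 / eta))).
    apply: ler_pM; rewrite ?mulr_ge0 ?invr_ge0 ?mulr_ge0 ?(ltW (D0 _ _ _ _)) ?succ_residue_lt //.
    + by apply: ler_pM => //; [exact: le_trans C'C|exact: le_trans C'C].
    + by apply: DV => //; rewrite succ_residue_lt.
  have e1 : 0 <= C ^+ 2 / eta by rewrite divr_ge0 ?sqr_ge0 // ltW.
  by rewrite (_ : C * C * (2 / eta) = 2 * (C ^+ 2 / eta)); [lra|ring].
- exists m1 => m x m1m Kx; have iN : (m.+1 %% N < N)%N by rewrite ltn_mod.
  rewrite /boundary_term; set i := (m.+1 %% N)%N in iN *.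
  have [h1 _ _ _ _] := Hlim i x iN Kx; have [_ _ _ _ h2] := Hb m x m1m Kx.
  have s1 : `|sigma| = 1.
    apply/eqP; rewrite -(@pexpr_eq1 _ _ 2) // real_normK ?num_real //.
    by rewrite sigma_sqr.
  rewrite !normrM s1 mul1r [`|_^-1|]gtr0_norm ?invr_gt0 ?mulr_gt0 ?D0 //.
  rewrite (gtr0_norm (a_gt0 m)).
  have h3 : a m * (`|(p m.+1).[x]| * `|lmx i x 1 0 * (p m).[x] + lmx i x 1 1 * (p m.+1).[x]|)
     <= 2 * C ^+ 2.
    have h4 : `|(p m.+1).[x]| * `|lmx i x 1 0 * (p m).[x] + lmx i x 1 1 * (p m.+1).[x]|
       <= C * (2 * ((p m).[x] ^+ 2 + (p m.+1).[x] ^+ 2)).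
      set u := (p m).[x]; set v := (p m.+1).[x].
      apply: (@le_trans _ _ (`|v| * (C * `|u| + C * `|v|))).
        rewrite ler_wpM2l //; apply: (le_trans (ler_normD _ _)); rewrite !normrM.
        by apply: lerD; apply: ler_wpM2r => //; exact: le_trans C'C.
      rewrite -mulrDr mulrCA ler_wpM2l ?(le_trans ler01 C1) //.
      have := sqr_ge0 (`|u| - `|v|); have := sqr_ge0 u; have := sqr_ge0 v.
      have := real_normK (num_real u); have := real_normK (num_real v); lra.
    apply: (le_trans (ler_wpM2l (ltW (a_gt0 m)) h4)).
    have h5 : a m * ((p m).[x] ^+ 2 + (p m.+1).[x] ^+ 2) <= C by exact: le_trans C'C.
    rewrite (_ : a m * _ = 2 * C * (a m * ((p m).[x] ^+ 2 + (p m.+1).[x] ^+ 2))).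
      have -> : 2 * C ^+ 2 = 2 * C * C by ring.
      by apply: ler_wpM2l h5; rewrite mulr_ge0 // (le_trans ler01 C1).
    by ring.
  apply: (le_trans (ler_pM _ _ (DV i x iN Kx) h3)).
  + by rewrite invr_ge0 mulr_ge0 // ltW // D0.
  + by rewrite mulr_ge0 ?mulr_ge0 // ltW.
  + by rewrite le_eqVlt; apply/orP; left; apply/eqP; ring.
- move=> d d0.
  (* The constant of residual_bound: limit determinants are at least eta / 4. *)
  pose M := 10 * C ^+ 4 / (eta / 4).
  have M0 : 0 < M by rewrite !divr_gt0 ?mulr_gt0 ?exprn_gt0 // (lt_le_trans ltr01).
  have d1 : 0 < d / M by rewrite divr_gt0.
  have [n1 H1] := limit_mx_uniform' (`|x0| + 1) d1.
  have [n2 H2] := periodic_lim_uniform N_gt0 cS d1.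
  have [n3 H3] := inv_small a_gt0 a_infty d1.
  have /cvgr0Pnorm_le /(_ _ d1) [n4 _ H4] := a_diff.
  exists (maxn (maxn m1 n1) (maxn n2 (maxn n3 n4))) => m x.
  rewrite !geq_max => /andP [/andP [m1m n1m] /and3P [n2m n3m n4m]] Kx.
  have iN : (m.+1 %% N < N)%N by rewrite ltn_mod.
  have mN : (m %% N < N)%N by rewrite ltn_mod.
  have [Yle Dge _ _ _] := Hlim _ x iN Kx; have [Tle _ _ _ ww] := Hb m x m1m Kx.
  have TY k l : `|(T m.+1 x - lmx (m.+1 %% N)%N x) k l| <= d / M.
    rewrite mxE [X in _ + X]mxE; apply: H1; first by rewrite ltnW.
    exact: KM.
  have := @residual_bound R (lmx (m.+1 %% N)%N x) (T m.+1 x) sigma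
    (p m).[x] (p m.+1).[x] (a (m + N)%N) (a m) (turan_lim (m %% N)%N x) C (d / M) (eta / 4).
  have [<- <-] := orthpoly_step N b sigma a_gt0 m x.
  rewrite -/(limit_det (m.+1 %% N)%N x) /=.
  rewrite -succ_residue_mod -/(growth_coef (m %% N)%N x) succ_residue_mod.
  move=> H; have E : ((m + N).+1 %% N = m.+1 %% N)%N by rewrite -addSn modnDr.
  rewrite /residual /boundary_term E.
  rewrite -[X in _ <= X](_ : M * (d / M) / a m = _); last first.
    by rewrite [M * _]mulrC divfK // gt_eqF.
  apply: H => //.
  + exact: sigma_sqr.
  + by rewrite divr_gt0.
  + exact: ltW.
  + exact: limit_mx_trace.
  + by move=> k l; exact: le_trans C'C.
  + by move=> k l; exact: le_trans C'C.
  + exact: le_trans C'C.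
  + exact: H2.
  + exact: H4.
  + by apply: H3; rewrite (leq_trans n3m) ?leq_addr.
Qed.

(** Summing the residual identity, the boundary terms telescope to a bounded
    quantity and the main terms are a weighted mean of an N-periodic sequence. *)
Lemma CDkernel_asymptotics x0 : Lambda N a b sigma x0 ->
  exists2 K, nbhs x0 K & forall d, 0 < d -> exists n0, forall n x,
    (n0 <= n)%N -> K x -> `|CDkernel a b n x - growth x * rho n| <= d * rho n.
Proof.
move=> Lx0; have [K1 [B [nK1 B0 Bg [m1 Hm1] Hres]]] :=
  local_residual Lx0.
have [m2 Hm2] := Hres _ ltr01; pose n1 := maxn m1 m2.
pose c0 := CDkernel a b n1.+1 x0 + 1.
pose K := [set x | K1 x /\ CDkernel a b n1.+1 x <= c0].
exists K.
  have /cvgrPdist_le/(_ _ ltr01) := @continuous_CDkernel n1.+1 x0.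
  move=> H; near=> x; split; first by near: x.
  have : `|CDkernel a b n1.+1 x0 - CDkernel a b n1.+1 x| <= 1 by near: x.
  by rewrite ler_norml /c0 => /andP [h1 h2]; lra.
move=> d d0; have d4 : 0 < d / 4 by rewrite divr_gt0.
have gB x : K1 x -> `|growth x| <= B.
  move=> Kx; have N0 : 0 < N%:R :> R by rewrite ltr0n.
  rewrite /growth normrM [`|_^-1|]gtr0_norm ?invr_gt0 // ler_pdivrMr //.
  apply: (le_trans (ler_norm_sum _ _ _)).
  apply: (@le_trans _ _ (\sum_(i < N) B)); first by apply: ler_sum => i _; apply: Bg.
  by rewrite sumr_const card_ord mulr_natr.
(* The bound of the residual by 1 / a_m holds from n1 on only. *)
pose u m x := if (m < n1)%N then 0 else residual m x.
have uC m x : K1 x -> `|u m x| <= 1 / a m.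
  move=> Kx; rewrite /u; case: ltnP => [_|n1m]; first by rewrite normr0 divr_ge0 // ltW.
  by apply: Hm2 => //; rewrite (leq_trans _ n1m) // leq_maxr.
have usmall e : 0 < e -> exists m0, forall m x, (m0 <= m)%N -> K1 x -> `|u m x| <= e / a m.
  move=> e0; have [m0 Hm0] := Hres _ e0; exists m0 => m x m0m Kx.
  rewrite /u; case: ifP => _; last exact: Hm0.
  by rewrite normr0 divr_ge0 // ltW.
have [n2 Hn2] := cesaro_negligible a_gt0 carleman uC usmall d4.
have [n3 Hn3] := cesaro_periodic N_gt0 a_gt0 a_ratio a_infty carleman B0 d4.
have [Bi Bi0 HBi] := inv_bounded a_gt0 a_infty.
pose cst := c0 + 2 * N%:R * B + B * rho n1 + B * Bi.
have [n4 Hn4] := inv_sum_large carleman (cst / (d / 4)).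
exists (maxn n1.+1 (maxn n2.+1 (maxn n3.+1 n4.+1))) => n x.
case: n => [|n]; first by rewrite geq_max ltn0.
rewrite !geq_max !ltnS => /and4P [n1n n2n n3n n4n] [Kx c0x].
have r0 := inv_sum_ge0 a_gt0 n.
have split_sum (f : R^nat) : \sum_(m < n) f m = \sum_(m < n1) f m + \sum_(n1 <= m < n) f m.
  by rewrite -(big_mkord xpredT f) (@big_cat_nat _ _ _ n1) //= big_mkord.
have E1 : CDkernel a b n.+1 x = CDkernel a b n1.+1 x + \sum_(n1 <= m < n) (p m.+1).[x] ^+ 2.
  have := CDkernel_split n1.+1 (n - n1) x.
  rewrite addSn subnKC // => ->; congr (_ + _).
  by rewrite big_add1.
have E2 : \sum_(n1 <= m < n) (p m.+1).[x] ^+ 2 =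
   \sum_(m < n) u m x - \sum_(i < N) (boundary_term (n + i) x - boundary_term (n1 + i) x)
   + (\sum_(m < n) growth_coef (m %% N) x / a m - \sum_(m < n1) growth_coef (m %% N) x / a m).
  have := sum_shift_telescope (fun m => boundary_term m x) n1 (n - n1).
  rewrite subnKC // => <-.
  rewrite (split_sum (fun m => u m x)) (split_sum (fun m => growth_coef (m %% N) x / a m)).
  have -> : \sum_(m < n1) u m x = 0.
    by apply: big1 => m _; rewrite /u ltn_ord.
  rewrite add0r [X in _ + X]addrAC subrr add0r.
  have -> : \sum_(n1 <= m < n) u m x = \sum_(n1 <= m < n) residual m x.
    by apply: eq_big_nat => m /andP [n1m _]; rewrite /u ltnNge n1m.
  rewrite -sumrB -big_split; apply: eq_bigr => m _ /=.
  by rewrite /residual; ring.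
have b1 := Hn2 n x n2n Kx.
have b2 := Hn3 n (fun i => growth_coef (i %% N)%N x) n3n (fun i => Bg _ x (ltn_pmod i N_gt0) Kx).
have {}b2 : `|\sum_(m < n) growth_coef (m %% N)%N x / a m - growth x * rho n| <= d / 4 * rho n.
  move: b2; under eq_bigr do rewrite modn_mod.
  by under [X in X / _]eq_bigr => i _ do rewrite modn_small //.
have b3 : `|\sum_(i < N) (boundary_term (n + i) x - boundary_term (n1 + i) x)| <= 2 * N%:R * B.
  apply: (le_trans (ler_norm_sum _ _ _)).
  apply: (@le_trans _ _ (\sum_(i < N) (B + B))).
    apply: ler_sum => i _; apply: (le_trans (ler_normB _ _)).
    apply: lerD; apply: Hm1 => //; rewrite (leq_trans (leq_maxl m1 m2)) // -/n1 ?leq_addr //.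
    by rewrite (leq_trans n1n) ?leq_addr.
  by rewrite sumr_const card_ord -[_ *+ N]mulr_natr le_eqVlt; apply/orP; left; apply/eqP; ring.
have b4 : `|\sum_(m < n1) growth_coef (m %% N) x / a m| <= B * rho n1.
  apply: (le_trans (ler_norm_sum _ _ _)); rewrite /inv_sum mulr_sumr; apply: ler_sum => m _.
  rewrite normrM [`|_^-1|]gtr0_norm ?invr_gt0 // ler_wpM2r ?invr_ge0 ?(ltW (a_gt0 m)) //.
  by apply: Bg => //; rewrite ltn_mod.
have b5 : `|growth x / a n| <= B * Bi.
  rewrite normrM [`|_^-1|]gtr0_norm ?invr_gt0 //.
  by apply: ler_pM; rewrite ?invr_ge0 ?(ltW (a_gt0 n)) ?gB.
have b6 : 0 <= CDkernel a b n1.+1 x by rewrite (le_trans ler01) // CDkernel_ge1.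
have b7 := Hn4 n n4n; rewrite ler_pdivrMr // in b7.
rewrite inv_sumS mulrDr; have an0 : 0 <= d * (a n)^-1 by rewrite mulr_ge0 ?(ltW d0) // invr_ge0 ltW.
rewrite E1 E2; move: b1 b2 b3 b4 b5; rewrite !ler_norml /cst in b7 *.
set s1 := \sum_(m < n) u m x; set s2 := \sum_(m < n) _; set s3 := \sum_(i < N) _.
set s4 := \sum_(m < n1) _ => /andP [? ?] /andP [? ?] /andP [? ?] /andP [? ?] /andP [? ?].
by apply/andP; split; lra.
Unshelve. all: end_near. Qed.

(** * Mass of small intervals *)

Lemma turan_lim_neq0 i x : (i < N)%N -> Lambda N a b sigma x -> turan_lim i x != 0.
Proof.
move=> iN Lx; have [K [eta [kappa [C [m1 [nK _ Hloc cS]]]]]] :=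
  turan_local' Lx.
have [_ _ h _ _] := local_bounds_lim Hloc cS iN (nbhs_singleton nK).
have [_ k0 _ _ _] := Hloc.
by rewrite -normr_gt0; exact: lt_le_trans k0 h.
Qed.

Lemma limit_det_gt0 i x : (i < N)%N -> Lambda N a b sigma x -> 0 < limit_det i x.
Proof.
move=> iN /(_ i iN) /=; rewrite (discr_limit_mx) oppr_lt0; lra.
Qed.

Lemma limit_mx10_neq0 i x : (i < N)%N -> Lambda N a b sigma x -> lmx i x 1 0 != 0.
Proof.
move=> iN Lx; apply/eqP => Y10; have := limit_det_gt0 iN Lx.
have Y00 := limit_mx_trace i x.
rewrite /limit_det Y10 (_ : lmx i x 0 0 = - lmx i x 1 1); last by lra.
by rewrite mulr0 subr0 mulNr oppr_gt0 -expr2 ltNge sqr_ge0.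
Qed.

Lemma continuous_turan_lim i x : (i < N)%N -> Lambda N a b sigma x ->
  {for x, continuous (turan_lim i)}.
Proof.
move=> iN Lx; have [K [eta [kappa [C [m1 [nK _ _ cS]]]]]] :=
  turan_local' Lx.
apply: (continuous_periodic_lim N_gt0 iN _ cS nK).
exact: (continuous_turan N_gt0 a_gt0 D1N_a D1N_b D1N_inv sigma_mx).
Qed.

Let clmx := continuous_limit_mx N_gt0 a_gt0 D1N_a D1N_b D1N_inv sigma_mx.

Lemma continuous_limit_det i : (i < N)%N -> continuous (limit_det i).
Proof.
by move=> iN x; apply: cvgB; apply: cvgM; exact: clmx.
Qed.

Lemma continuous_growth x : Lambda N a b sigma x -> {for x, continuous growth}.
Proof.
move=> Lx; apply: cvgM; last exact: cvg_cst.
apply: (continuous_sum (f := growth_coef)) => i iN.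
have niN := succ_residue_lt i.
apply: cvgM; first by apply: cvgM; [exact: clmx|exact: continuous_turan_lim].
apply: cvgV; first by rewrite gt_eqF // mulr_gt0 // limit_det_gt0.
by apply: cvgMr; exact: continuous_limit_det.
Qed.

Lemma limit_sign i x : (i < N)%N -> Lambda N a b sigma x ->
  0 <= lmx (succ_residue i) x 1 0 * turan_lim i x.
Proof.
move=> iN Lx; have [K [eta [kappa [C [m1 [nK _ Hloc cS]]]]]] :=
  turan_local' Lx.
by have [_ _ _ _ h] := local_bounds_lim Hloc cS iN (nbhs_singleton nK).
Qed.

Lemma growth_gt0 x : Lambda N a b sigma x -> 0 < growth x.
Proof.
move=> Lx; rewrite divr_gt0 ?ltr0n //.
have pos i : (i < N)%N -> 0 < growth_coef i x.
  move=> iN; have niN := succ_residue_lt i.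
  apply: divr_gt0; last by rewrite mulr_gt0 ?limit_det_gt0.
  by rewrite lt_neqAle limit_sign // andbT eq_sym mulf_neq0 ?limit_mx10_neq0 ?turan_lim_neq0.
rewrite (bigD1 (Ordinal N_gt0)) //=; apply: ltr_pwDl; first exact: pos.
by apply: sumr_ge0 => i _; exact/ltW/pos.
Qed.

(** The form is that of the limit matrix at the fixed point x0, so that the
    spacing lemmas, stated for a constant form, apply near x0. *)
Lemma form_limit x0 i t : (i < N)%N -> Lambda N a b sigma x0 -> 0 < t ->
  exists2 U, nbhs x0 U & exists n0, forall n x, (n0 <= n)%N -> U x ->
    `|a (n * N + i)%N * wronskian_form (lmx (succ_residue i) x0)
        (p (n * N + i)).[x] (p (n * N + i).+1).[x] - turan_lim i x0| <= t.
Proof.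
move=> iN Lx0 t0; have [K [eta [kappa [C [m1 [nK KM Hloc cS]]]]]] :=
  turan_local' Lx0.
have [_ _ C0 _ Hb] := Hloc.
pose d := t / (8 * C); have d0 : 0 < d by rewrite divr_gt0 // mulr_gt0.
have t4 : 0 < t / 4 by rewrite divr_gt0.
have niN := succ_residue_lt i.
have near_lmx k l : \forall x \near x0,
    `|lmx (succ_residue i) x0 k l - lmx (succ_residue i) x k l| <= d.
  by have /cvgrPdist_le/(_ _ d0) := @clmx (succ_residue i) k l niN x0.
have [n1 H1] := limit_mx_uniform' (`|x0| + 1) d0.
have [n2 H2] := periodic_lim_uniform N_gt0 cS t4.
have /cvgrPdist_le/(_ _ t4) near_tlim := continuous_turan_lim iN Lx0.
exists [set x | [/\ K x, forall k l : 'I_2,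
    `|lmx (succ_residue i) x0 k l - lmx (succ_residue i) x k l| <= d &
    `|turan_lim i x0 - turan_lim i x| <= t / 4]].
  have near_all := near_forall_ord (fun k => near_forall_ord (near_lmx k)).
  by near=> x; split; near: x.
exists (maxn m1 (maxn n1 n2)) => n x.
rewrite !geq_max => /and3P [m1n n1n n2n] [Kx Hx tx].
set m := (n * N + i)%N; have nm : (n <= m)%N by exact: leq_progression.
have mi : (m %% N = i)%N by rewrite /m modnMDl modn_small.
have [_ _ _ _ ww] := Hb m x (leq_trans m1n nm) Kx.
have TY k l : `|(T m.+1 x - lmx (succ_residue i) x0) k l| <= 2 * d.
  rewrite mxE [X in _ + X]mxE.
  have h1 := H1 m.+1 x (leq_trans n1n (leqW nm)) (KM x Kx) k l.
  rewrite -succ_residue_mod mi in h1.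
  rewrite (_ : _ - _ = (T m.+1 x k l - lmx (succ_residue i) x k l)
    - (lmx (succ_residue i) x0 k l - lmx (succ_residue i) x k l)); last by ring.
  apply: (le_trans (ler_normB _ _)); have := Hx k l; lra.
have h2 := H2 m x (leq_trans n2n nm) Kx; rewrite mi -/(turan_lim i x) in h2.
have h3 := wronskian_form_le (p m).[x] (p m.+1).[x] TY.
have h4 : `|a m * wronskian_form (T m.+1 x - lmx (succ_residue i) x0) (p m).[x] (p m.+1).[x]| <= t / 2.
  rewrite normrM (gtr0_norm (a_gt0 m)).
  apply: (le_trans (ler_wpM2l (ltW (a_gt0 m)) h3)).
  have h5 : d * (a m * ((p m).[x] ^+ 2 + (p m.+1).[x] ^+ 2)) <= d * C.
    by rewrite ler_wpM2l ?(ltW d0).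
  have dC : d * C = t / 8 by rewrite /d; field; rewrite gt_eqF.
  by rewrite dC in h5; lra.
have E : a m * wronskian_form (lmx (succ_residue i) x0) (p m).[x] (p m.+1).[x] - turan_lim i x0 =
  (turan m x - turan_lim i x) - (turan_lim i x0 - turan_lim i x)
  - a m * wronskian_form (T m.+1 x - lmx (succ_residue i) x0) (p m).[x] (p m.+1).[x].
  rewrite /turan /wronskian_form !mxE; ring.
rewrite E; apply: (le_trans (ler_normB _ _)).
have := ler_normB (turan m x - turan_lim i x) (turan_lim i x0 - turan_lim i x).
lra.
Unshelve. all: end_near. Qed.

Lemma kernel_limit x0 t : Lambda N a b sigma x0 -> 0 < t ->
  exists2 U, nbhs x0 U & exists n0, forall n x, (n0 <= n)%N -> U x ->
    `|CDkernel a b n x - growth x0 * rho n| <= t * rho n.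
Proof.
move=> Lx0 t0; have t2 : 0 < t / 2 by rewrite divr_gt0.
have [K nK /(_ _ t2) [n0 H]] := CDkernel_asymptotics Lx0.
have /cvgrPdist_le/(_ _ t2) near_g := continuous_growth Lx0.
exists (K `&` [set x | `|growth x0 - growth x| <= t / 2]); first exact: filterI.
exists n0 => n x n0n [Kx gx]; have h1 := H n x n0n Kx.
have r0 := inv_sum_ge0 a_gt0 n.
have h2 : `|(growth x0 - growth x) * rho n| <= t / 2 * rho n.
  by rewrite normrM (ger0_norm r0) ler_wpM2r.
rewrite (_ : _ - _ = (CDkernel a b n x - growth x * rho n) - (growth x0 - growth x) * rho n); last by ring.
by apply: (le_trans (ler_normB _ _)); lra.
Qed.

(** The density read off from the zeros of p_(m+1) for m of residue i. *)
Definition density_at i x : R := Num.sqrt (limit_det (succ_residue i) x) / (pi * `|turan_lim i x|).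

Lemma gauss_massE m c d : gauss_mass b a_gt0 m c d =
  \sum_(z <- [seq z <- zeros b a_gt0 m | c <= z <= d]) (CDkernel a b m z)^-1.
Proof.
rewrite /gauss_mass /gauss big_filter [RHS]big_mkcond.
apply: eq_bigr => z _; rewrite indicE.
have -> : (z \in `[c, d]%classic) = (c <= z <= d).
  by apply/idP/idP; rewrite inE /= in_itv.
by case: ifP; rewrite ?mul1r ?mul0r.
Qed.

(** Consecutive zeros are about pi g0 / (de h) apart and each carries a weight of
    about 1/h, hence the mass de / (pi g0) per unit length; the last terms
    account for one zero at the ends of the interval. *)
Lemma gauss_mass_bounds m (Y : 'M[R]_2) (de g0 h t c d : R) :
    0 < de -> 0 < g0 -> 0 < h -> 0 < t -> t < 1 -> c <= d ->
    Y 0 0 = - Y 1 1 -> Y 1 0 != 0 ->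
    Y 0 0 * Y 1 1 - Y 0 1 * Y 1 0 = de ^+ 2 ->
    (forall x, c <= x <= d -> (1 - t) * g0 <=
       `|a m * wronskian_form Y (p m).[x] (p m.+1).[x]| <= (1 + t) * g0) ->
    (forall x, c <= x <= d -> (1 - t) * h <= CDkernel a b m.+1 x <= (1 + t) * h) ->
  de / (pi * g0) * (d - c) * ((1 - t) / (1 + t) ^+ 2) - ((1 + t) * h)^-1
    <= gauss_mass b a_gt0 m.+1 c d <=
  de / (pi * g0) * (d - c) * ((1 + t) / (1 - t) ^+ 2) + ((1 - t) * h)^-1.
Proof.
move=> de0 g00 h0 t0 t1 cd Y00 Y10 detY Fb Kb.
have pi0 : 0 < pi :> R by exact: pi_gt0.
have s1 : 0 < 1 - t by lra.
have s2 : 0 < 1 + t by lra.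
(* The sign makes the definite form positive. *)
pose s := Num.sg (Y 1 0).
have sY : s * Y 1 0 = `|Y 1 0| by rewrite /s -normrEsg.
pose al := s * Y 1 0; pose be := s * Y 1 1; pose ga := - (s * Y 0 1).
have al0 : 0 < al by rewrite /al sY normr_gt0.
have ss : s ^+ 2 = 1 by rewrite /s sqr_sg Y10.
have disc : al * ga - be ^+ 2 = de ^+ 2.
  rewrite -detY Y00 /al /be /ga.
  rewrite (_ : _ - _ = s ^+ 2 * (- Y 1 1 * Y 1 1 - Y 0 1 * Y 1 0)); last by ring.
  by rewrite ss mul1r.
have wr x : poly_wronskian (p m) (p m.+1) x = CDkernel a b m.+1 x / a m.
  by rewrite confluent_christoffel_darboux // /poly_wronskian mulrAC divff ?mul1r // gt_eqF.
have wr0 x : 0 < poly_wronskian (p m) (p m.+1) x.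
  by rewrite wr divr_gt0 // CDkernel_gt0.
have formE x : poly_form (p m) (p m.+1) al be ga x = s * wronskian_form Y (p m).[x] (p m.+1).[x].
  by rewrite /poly_form /wronskian_form /al /be /ga Y00; ring.
have form0 x : 0 < poly_form (p m) (p m.+1) al be ga x by exact: (poly_form_gt0 al0 de0 disc wr0).
have aform x : a m * poly_form (p m) (p m.+1) al be ga x =
    `|a m * wronskian_form Y (p m).[x] (p m.+1).[x]|.
  have sn : `|s| = 1 by apply/eqP; rewrite -(@pexpr_eq1 _ _ 2) // real_normK ?num_real // ss.
  rewrite normrM (gtr0_norm (a_gt0 m)); congr (_ * _).
  by rewrite -[LHS]gtr0_norm // formE normrM sn mul1r.
pose L := de * ((1 - t) * h) / ((1 + t) * g0); pose H := de * ((1 + t) * h) / ((1 - t) * g0).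
have L0 : 0 < L by rewrite /L divr_gt0 // !mulr_gt0.
have H0 : 0 < H by rewrite /H divr_gt0 // !mulr_gt0.
have speed x : c <= x <= d ->
    L <= de * poly_wronskian (p m) (p m.+1) x / poly_form (p m) (p m.+1) al be ga x <= H.
  move=> cxd; have /andP [f1 f2] := Fb x cxd; have /andP [k1 k2] := Kb x cxd.
  rewrite wr (_ : de * _ / _ = de * CDkernel a b m.+1 x /
    (a m * poly_form (p m) (p m.+1) al be ga x)); last first.
    by field; rewrite !gt_eqF.
  rewrite aform; set F := `|_| in f1 f2 *; set K := CDkernel _ _ _ _ in k1 k2 *.
  have F0 : 0 < F by apply: lt_le_trans f1; rewrite mulr_gt0.
  have K0 : 0 < K by exact: CDkernel_gt0.
  by apply/andP; split; apply: ler_pM;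
    rewrite ?(ler_pM2l de0) ?lef_pV2 ?posrE ?invr_ge0 ?mulr_ge0 ?(ltW de0) ?(ltW h0)
      ?(ltW g00) ?(ltW s1) ?(ltW s2) ?(ltW F0) ?(ltW K0) ?mulr_gt0.
rewrite gauss_massE; set Z := [seq z <- _ | _].
pose Zs := sort <=%R Z.
have szZ : size Zs = size Z by rewrite size_sort.
have so : sorted <=%R Zs by apply: sort_sorted; exact: le_total.
have uZ : uniq Zs by rewrite sort_uniq filter_uniq // zeros_uniq.
have memZ z : (z \in Zs) = (c <= z <= d) && root (p m.+1) z.
  by rewrite mem_sort mem_filter mem_zeros.
have Zcd z : z \in Zs -> c <= z <= d by rewrite memZ => /andP [].
have up : (size Z)%:R * (pi / H) <= (d - c) + pi / H.
  rewrite -szZ; apply: count_upper => //; first by rewrite divr_ge0 ?ltW.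
  move=> x y; rewrite !memZ => /andP [/andP [cx _] rx] /andP [/andP [_ yd] ry] xy.
  rewrite ler_pdivrMr // [leRHS]mulrC.
  apply: (zeros_gap al0 de0 disc wr0 (ltW L0) speed (mem_zeros b a_gt0 m.+1)) => //; exact/rootP.
have lo : d - c <= (size Z)%:R * (pi / L) + pi / L.
  rewrite -szZ; apply: count_lower => //; first by rewrite divr_ge0 ?ltW.
    by move=> z /Zcd /andP [].
  move=> x y cx xy yd; rewrite ltr_pdivrMr // => gap.
  apply: contrapT => none.
  have free z : x <= z <= y -> (p m.+1).[z] != 0.
    move=> xzy; apply/eqP => pz; apply: none; exists z => //.
    rewrite memZ; apply/andP; split; last exact/rootP.
    by case/andP: xzy => xz zy; rewrite (le_trans (ltW cx) xz) (le_trans zy yd).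
  have := zero_free_gap al0 de0 disc speed (ltW cx) yd xy free; lra.
have h1 : 0 < (1 - t) * h by rewrite mulr_gt0.
have h2 : 0 < (1 + t) * h by rewrite mulr_gt0.
have wup : \sum_(z <- Z) (CDkernel a b m.+1 z)^-1 <= (size Z)%:R * ((1 - t) * h)^-1.
  rewrite mulr_natl -sumr_const_seq big_seq [leRHS]big_seq; apply: ler_sum => z.
  rewrite mem_filter => /andP [/Kb /andP [k1 _] _].
  by rewrite lef_pV2 ?posrE // (lt_le_trans h1 k1).
have wlo : (size Z)%:R * ((1 + t) * h)^-1 <= \sum_(z <- Z) (CDkernel a b m.+1 z)^-1.
  rewrite mulr_natl -sumr_const_seq big_seq [leRHS]big_seq; apply: ler_sum => z.
  rewrite mem_filter => /andP [/Kb /andP [k1 k2] _].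
  by rewrite lef_pV2 ?posrE // (lt_le_trans h1 k1).
have piL (u : R) : 0 < u -> pi / u * (u / pi) = 1.
  by move=> u0; rewrite mulrA divfK ?divff // gt_eqF.
have piD (k u : R) : 0 < u -> (k + pi / u) * (u / pi) = k * (u / pi) + 1.
  by move=> u0; rewrite mulrDl piL.
have main (P u v : R) : P != 0 -> v != 0 -> h != 0 ->
    de / (P * g0) * (d - c) * (u / v ^+ 2) =
    (d - c) * (de * (u * h) / (v * g0) / P / (v * h)).
  by move=> P0 v0 h0'; field; rewrite v0 P0 h0' gt_eqF.
apply/andP; split.
  apply: le_trans wlo; rewrite lerBlDr main ?gt_eqF // -/L.
  rewrite -[X in _ <= _ + X]mul1r -mulrDl mulrA; apply: ler_wpM2r; first by rewrite invr_ge0 ltW.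
  have := ler_wpM2r (ltW (divr_gt0 L0 pi0)) lo.
  by rewrite piD // -mulrA piL // mulr1.
apply: (le_trans wup); rewrite main ?gt_eqF // -/H.
rewrite -[X in _ <= _ + X]mul1r mulrA -mulrDl; apply: ler_wpM2r; first by rewrite invr_ge0 ltW.
have := ler_wpM2r (ltW (divr_gt0 H0 pi0)) up.
by rewrite piD // -mulrA piL // mulr1.
Qed.

Variable mu : probability (measurableTypeR R) R.
Hypothesis mu_orth : orthonormal_polys mu p.

Lemma density_at_gt0 i x : (i < N)%N -> Lambda N a b sigma x -> 0 < density_at i x.
Proof.
move=> iN Lx; have niN := succ_residue_lt i.
have D0 := limit_det_gt0 niN Lx.
rewrite divr_gt0 ?sqrtr_gt0 // mulr_gt0 ?pi_gt0 // normr_gt0.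
exact: turan_lim_neq0.
Qed.

Lemma distortion_bounds (t : R) : 0 < t -> t <= 1 / 4 ->
  1 - 6 * t <= (1 - t) / (1 + t) ^+ 2 /\ (1 + t) / (1 - t) ^+ 2 <= 1 + 6 * t.
Proof.
move=> t0 t4; have t2 : 0 <= t ^+ 2 by exact: sqr_ge0.
have t3 : 0 <= t ^+ 3 by rewrite exprn_ge0 // ltW.
have tt : t ^+ 2 <= t * (1 / 4) by rewrite expr2 ler_wpM2l // ltW.
split.
  rewrite ler_pdivlMr ?exprn_gt0 //; last by lra.
  have -> : (1 - 6 * t) * (1 + t) ^+ 2 = 1 - 4 * t - 11 * t ^+ 2 - 6 * t ^+ 3 by ring.
  lra.
rewrite ler_pdivrMr ?exprn_gt0 //; last by lra.
have -> : (1 + 6 * t) * (1 - t) ^+ 2 = 1 + 4 * t - 11 * t ^+ 2 + 6 * t ^+ 3 by ring.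
lra.
Qed.

Lemma gauss_mass_local i x0 e : (i < N)%N -> Lambda N a b sigma x0 -> 0 < e ->
  exists2 r, 0 < r & forall c d, x0 - r <= c -> c <= d -> d <= x0 + r ->
    forall e', 0 < e' -> exists n0, forall n, (n0 <= n)%N ->
      (density_at i x0 - e) * (d - c) - e' <= gauss_mass b a_gt0 (n * N + i).+1 c d
      <= (density_at i x0 + e) * (d - c) + e'.
Proof.
move=> iN Lx0 e0; have niN := succ_residue_lt i.
have D0 := limit_det_gt0 niN Lx0.
have g0 : 0 < `|turan_lim i x0|.
  rewrite normr_gt0.
  exact: turan_lim_neq0.
have h0 := growth_gt0 Lx0.
have w0 := density_at_gt0 iN Lx0; set w := density_at i x0 in w0 *.
have [t [t0 t4 te]] : exists t, [/\ 0 < t, t <= 1 / 4 & 6 * t * w <= e].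
  exists (Num.min (1 / 4) (e / (6 * w))); split.
  - by rewrite lt_min !divr_gt0 // mulr_gt0.
  - by rewrite ge_min lexx.
  - have w6 : 0 < 6 * w by rewrite mulr_gt0.
    have : Num.min (1 / 4) (e / (6 * w)) <= e / (6 * w) by rewrite ge_min lexx orbT.
    by rewrite ler_pdivlMr // mulrA [_ * 6]mulrC.
have [U nU [n1 H1]] := form_limit iN Lx0 (mulr_gt0 t0 g0).
have [V nV [n2 H2]] := kernel_limit Lx0 (mulr_gt0 t0 h0).
have /nbhs_ballP [r /= r0 UV] : nbhs x0 (U `&` V) by exact: filterI.
exists (r / 2); first by rewrite divr_gt0.
move=> c d rc cd dr e' e'0.
have inUV x : c <= x <= d -> U x /\ V x.
  move=> /andP [cx xd]; apply: UV; rewrite /ball /= ltr_norml.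
  by apply/andP; split; lra.
have [n3 Hn3] := inv_sum_large carleman (2 / (growth x0 * e')).
exists (maxn n1 (maxn n2 n3)) => n; rewrite !geq_max => /and3P [n1n n2n n3n].
set m := (n * N + i)%N; have nm : (n <= m)%N by exact: leq_progression.
have rho0 : 2 / (growth x0 * e') <= rho m.+1 by apply: Hn3; rewrite (leq_trans n3n) // ltnW.
have h1 : 0 < growth x0 * rho m.+1.
  by rewrite mulr_gt0 // (lt_le_trans _ rho0) // divr_gt0 // mulr_gt0.
have big : 2 / e' <= growth x0 * rho m.+1.
  have := ler_wpM2l (ltW h0) rho0.
  by rewrite (_ : _ * (2 / _) = 2 / e') //; field; rewrite !gt_eqF.
have t1 : t < 1 by lra.
have trace := limit_mx_trace
  (succ_residue i) x0.
have sq0 : 0 < Num.sqrt (limit_det (succ_residue i) x0) by rewrite sqrtr_gt0.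
have Y00 : lmx (succ_residue i) x0 0 0 = - lmx (succ_residue i) x0 1 1 by lra.
have Y10 := limit_mx10_neq0 niN Lx0.
have Fb x : c <= x <= d -> (1 - t) * `|turan_lim i x0| <=
    `|a m * wronskian_form (lmx (succ_residue i) x0) (p m).[x] (p m.+1).[x]| <= (1 + t) * `|turan_lim i x0|.
  move=> /inUV [Ux _]; have := H1 n x n1n Ux; rewrite -/m; set F := a m * _ => hF.
  have := ler_normB F (F - turan_lim i x0); rewrite (_ : F - (F - _) = turan_lim i x0); last by ring.
  have := ler_normD (turan_lim i x0) (F - turan_lim i x0); rewrite (_ : _ + (F - _) = F); last by ring.
  by move=> *; apply/andP; split; lra.
have Kb x : c <= x <= d -> (1 - t) * (growth x0 * rho m.+1) <= CDkernel a b m.+1 x <=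
    (1 + t) * (growth x0 * rho m.+1).
  move=> /inUV [_ Vx]; have := H2 m.+1 x (leq_trans n2n (leqW nm)) Vx.
  by rewrite ler_norml => /andP [k1 k2]; apply/andP; split; lra.
have := gauss_mass_bounds sq0 g0 h1 t0 t1 cd Y00 Y10 (esym (sqr_sqrtr (ltW D0))) Fb Kb.
move=> /andP [lo up]; rewrite -/(density_at i x0) -/w in lo up.
have [b1 b2] := distortion_bounds t0 t4.
have dc : 0 <= d - c by rewrite subr_ge0.
have small u : 1 / 2 <= u -> (u * (growth x0 * rho m.+1))^-1 <= e'.
  move=> u2; have u0 : 0 < u by lra.
  rewrite -[leRHS]invrK lef_pV2 ?posrE ?invr_gt0 //; last exact: mulr_gt0.
  have : 2 / e' * (1 / 2) <= growth x0 * rho m.+1 * u.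
    by apply: ler_pM => //; rewrite ?divr_ge0 ?(ltW e'0).
  by rewrite (_ : 2 / e' * (1 / 2) = e'^-1) ?(mulrC u) //; field; rewrite gt_eqF.
have s1 := small (1 - t) ltac:(lra); have s2 := small (1 + t) ltac:(lra).
have wdc : 0 <= w * (d - c) by rewrite mulr_ge0 // ltW.
have c1 := ler_wpM2l wdc b1; have c2 := ler_wpM2l wdc b2.
have c3 : 6 * t * w * (d - c) <= e * (d - c) by rewrite ler_wpM2r.
by apply/andP; split; lra.
Qed.

(** The portmanteau inequalities carry the estimate of the quadratures over to
    mu; the case c = d excludes atoms. *)
Lemma mass_local i x0 e : (i < N)%N -> Lambda N a b sigma x0 -> 0 < e ->
  exists2 r, 0 < r & forall c d, x0 - r <= c -> c <= d -> d <= x0 + r ->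
    `|fine (mu `[c, d]%classic) - density_at i x0 * (d - c)| <= e * (d - c).
Proof.
move=> iN Lx0 e0; have [r r0 Hr] := gauss_mass_local iN Lx0 e0.
have w0 := density_at_gt0 iN Lx0; set w := density_at i x0 in w0 Hr *.
have hn n : (n < (n * N + i).+1)%N by rewrite ltnS leq_progression.
exists (r / 2); first by rewrite divr_gt0.
move=> c d rc cd dr; rewrite ler_distl; apply/andP; split.
  apply/ler_addgt0Pl => s s0.
  have [<-|cd'] := eqVneq c d.
    by rewrite subrr !mulr0 subr0 addr_ge0 ?fine_ge0 ?(ltW s0).
  have {cd'} cd' : c < d by rewrite lt_neqAle cd' cd.
  have we0 : 0 < w + e by rewrite addr_gt0.
  have [eta [eta0 eta1 eta2]] : exists eta, [/\ 0 < eta, eta <= (d - c) / 4 & eta * (4 * (w + e)) <= s].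
    exists (Num.min ((d - c) / 4) (s / (4 * (w + e)))); split.
    - by rewrite !lt_min !divr_gt0 ?subr_gt0 ?mulr_gt0.
    - by rewrite !ge_min lexx.
    - by rewrite -ler_pdivlMr ?mulr_gt0 // !ge_min lexx !orbT.
  have s2 : 0 < s / 2 by rewrite divr_gt0.
  have [||| n0 Hn0] := Hr (c + eta) (d - eta) _ _ _ _ s2; try lra.
  have := @liminf_le_mass R a b a_gt0 mu mu_orth carleman (fun n => (n * N + i).+1)
    (c + eta) (d - eta) eta ((w - e) * (d - eta - (c + eta)) - s / 2) hn _ eta0 _.
  rewrite addrK subrK => H.
  have : (w - e) * (d - eta - (c + eta)) - s / 2 <= fine (mu `[c, d]%classic).
    by apply: H; [lra|exists n0 => // n /= /Hn0 /andP []].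
  have : (w - e) * eta <= (w + e) * eta by rewrite ler_wpM2r ?(ltW eta0) //; lra.
  lra.
apply/ler_addgt0Pl => s s0.
have we0 : 0 < w + e by rewrite addr_gt0.
have [eta [eta0 eta1 eta2]] : exists eta, [/\ 0 < eta, eta <= r / 4 & eta * (4 * (w + e)) <= s].
  exists (Num.min (r / 4) (s / (4 * (w + e)))); split.
  - by rewrite !lt_min !divr_gt0 ?mulr_gt0.
  - by rewrite !ge_min lexx.
  - by rewrite -ler_pdivlMr ?mulr_gt0 // !ge_min lexx !orbT.
have s2 : 0 < s / 2 by rewrite divr_gt0.
have [||| n0 Hn0] := Hr (c - eta) (d + eta) _ _ _ _ s2; try lra.
have := @mass_le_limsup R a b a_gt0 mu mu_orth carleman (fun n => (n * N + i).+1)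
  c d eta ((w + e) * (d + eta - (c - eta)) + s / 2) hn cd eta0 _.
move=> H; have : fine (mu `[c, d]%classic) <= (w + e) * (d + eta - (c - eta)) + s / 2.
  by apply: H; exists n0 => // n /= /Hn0 /andP [].
lra.
Qed.

(** * The density and the limit *)

(** Both sides are the derivative of the distribution function of mu at x. *)
Lemma density_at_residue i x : (i < N)%N -> Lambda N a b sigma x ->
  density_at i x = density_at 0 x.
Proof.
move=> iN Lx; apply/eqP; rewrite -subr_eq0 -normr_le0; apply/ler_addgt0Pl => e e0.
rewrite addr0; have e2 : 0 < e / 2 by rewrite divr_gt0.
have [r r0 H] := mass_local iN Lx e2.
have [s s0 H0] := mass_local N_gt0 Lx e2.
have [t [t0 tr ts]] : exists t, [/\ 0 < t, t <= r & t <= s].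
  exists (Num.min r s); split; last 2 first.
  - by rewrite ge_min lexx.
  - by rewrite ge_min lexx orbT.
  by rewrite lt_min r0.
have := H x (x + t); have := H0 x (x + t).
rewrite [x + t - x]addrAC subrr add0r; set m := fine _ => h0 h1.
have {h0} h0 : `|m - density_at 0 x * t| <= e / 2 * t by apply: h0; lra.
have {h1} h1 : `|m - density_at i x * t| <= e / 2 * t by apply: h1; lra.
rewrite -(ler_pM2r t0) -{1}(gtr0_norm t0) -normrM.
have := ler_normB (m - density_at 0 x * t) (m - density_at i x * t).
rewrite (_ : m - _ - _ = (density_at i x - density_at 0 x) * t); last by ring.
lra.
Qed.

Lemma open_Lambda : open (Lambda N a b sigma).
Proof.
rewrite openE => x Lx.
have [eta [m0 eta0 H]] := near_definite N_gt0 a_gt0 D1N_a D1N_b D1N_inv sigma_mx Lx.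
rewrite /interior /=; apply: filterS H => y [H _] i iN /=.
by apply: le_lt_trans (H i iN) _; rewrite oppr_lt0.
Qed.

Lemma continuous_density x : Lambda N a b sigma x -> {for x, continuous (density_at 0)}.
Proof.
move=> Lx; have niN := succ_residue_lt 0.
apply: cvgM.
  apply: (@cvg_comp _ _ _ (limit_det (succ_residue 0)) Num.sqrt); last exact: sqrt_continuous.
  exact: (continuous_limit_det niN).
apply: cvgV.
  rewrite mulf_neq0 ?gt_eqF ?pi_gt0 // normr_gt0.
  exact: turan_lim_neq0.
apply: cvgMr; apply: cvg_norm.
exact: (continuous_turan_lim N_gt0 Lx).
Qed.

Lemma density_Lambda : continuous_positive_density mu (Lambda N a b sigma) (density_at 0).
Proof.
have cd : {in Lambda N a b sigma, continuous (density_at 0)}.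
  by move=> x /set_mem; exact: continuous_density.
have pos x : Lambda N a b sigma x -> 0 < density_at 0 x.
  exact: (density_at_gt0 N_gt0).
split=> //; first by rewrite continuous_open_subspace //; exact: open_Lambda.
have pos' x : Lambda N a b sigma x -> 0 <= density_at 0 x by move=> /pos /ltW.
apply: (mass_density open_Lambda cd pos').
apply: (mass_interval cd pos') => x e Lx e0.
exact: (mass_local N_gt0 Lx e0).
Qed.

(** The density evaluates |turan_lim i x| in terms of the limit determinant
    and, being the same for every i, factors out of the sum over residues. *)
Lemma growthE x : Lambda N a b sigma x -> growth x = upsilon N a b sigma x / density_at 0 x.
Proof.
move=> Lx; have w0 : 0 < density_at 0 x.
  exact: (density_at_gt0 N_gt0).
pose F i := `|lmx i x 1 0| / Num.sqrt (- discr (lmx i x)).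
have coef i : (i < N)%N -> growth_coef i x = F (succ_residue i) / (pi * density_at 0 x).
  move=> iN; have niN := succ_residue_lt i.
  have D0 := limit_det_gt0 niN Lx.
  have g0 : 0 < `|turan_lim i x|.
    rewrite normr_gt0.
    exact: turan_lim_neq0.
  have sgn := limit_sign iN Lx.
  rewrite -(density_at_residue iN Lx) /F.
  rewrite discr_limit_mx.
  rewrite opprK sqrtrM // (_ : 4 = 2 ^+ 2 :> R); last by ring.
  rewrite sqrtr_sqr (ger0_norm (ler0n R 2)) /growth_coef -(ger0_norm sgn) normrM /density_at.
  rewrite -{1}(sqr_sqrtr (ltW D0)).
  have s0 : 0 < Num.sqrt (limit_det (succ_residue i) x) by rewrite sqrtr_gt0.
  have p0 : 0 < pi :> R by exact: pi_gt0.
  move: (pi : R) (Num.sqrt _) (`|turan_lim i x|) p0 s0 g0 => P S g P0 S0 g0'.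
  by field; rewrite !gt_eqF.
rewrite /growth /upsilon big_mkord.
rewrite (eq_bigr (fun i : 'I_N => F (succ_residue i) / (pi * density_at 0 x))); last first.
  by move=> i _; exact: coef.
rewrite -mulr_suml (sum_succ_mod F N_gt0).
have p0 : 0 < pi :> R by exact: pi_gt0.
have n0 : 0 < N%:R :> R by rewrite ltr0n.
move: (\sum_(i < N) F i) (pi : R) (density_at 0 x) (N%:R : R) p0 w0 n0 => S P w n P0 w0 n0.
by field; rewrite !gt_eqF.
Qed.

Lemma christoffel_limit : locally_uniform_cvg (Lambda N a b sigma)
  (fun n x => (\sum_(0 <= j < n.+1) (a j)^-1)^-1 * \sum_(0 <= j < n.+1) (p j).[x] ^+ 2)
  (fun x => upsilon N a b sigma x / density_at 0 x).
Proof.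
move=> x0 Lx0; have [K nK H] := CDkernel_asymptotics Lx0.
exists K => // P /uniform_nbhs [E [entE EP]]; apply: (filterS EP).
move: entE; rewrite -entourage_ballE => -[e /= e0 eE].
have e2 : 0 < e / 2 by rewrite divr_gt0.
have [n0 Hn0] := H _ e2.
exists n0 => // n /= n0n x [Kx Lx]; apply: eE; rewrite /ball /=.
rewrite -growthE // !big_mkord -/(CDkernel a b n.+1 x) -/(rho n.+1).
have r0 : 0 < rho n.+1.
  by rewrite inv_sumS ltr_wpDl ?inv_sum_ge0 // invr_gt0.
have := Hn0 n.+1 x (leqW n0n) Kx.
rewrite -ler_pdivrMr // -[X in _ / X](gtr0_norm r0) -normf_div mulrBl mulfK ?gt_eqF // distrC.
by rewrite [_ / rho _]mulrC; lra.
Qed.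

End KernelGrowth.

Theorem corollary2 (R : realType) (N : nat) (a b : R^nat) (q sigma : R)
    (mu : probability (measurableTypeR R) R)
    (N_gt0 : (0 < N)%N)
    (a_gt0 : forall n, 0 < a n)
    (a_ratio : a n.-1 / a n @[n --> \oo] --> (1 : R))
    (b_ratio : b n / a n @[n --> \oo] --> q)
    (a_infty : a n @[n --> \oo] --> +oo)
    (a_diff : a (n + N)%N - a n @[n --> \oo] --> (0 : R))
    (q_cos : exists2 j : nat, (1 <= j <= N.-1)%N &
               q = 2 * cos (j%:R * (pi / N%:R)))
    (D1N_a : D1N N (fun n => a n - a n.-1))
    (D1N_b : D1N N (fun n => b n - q * a n))
    (D1N_inv : D1N N (fun n => (a n)^-1))
    (sigma_sign : sigma = 1 \/ sigma = -1)
    (sigma_mx : mx2 0 1 (-1) (- q) ^+ N = sigma%:M)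
    (mu_orth : orthonormal_polys mu (orthpoly a b)) :
  exists2 mu' : R -> R,
    continuous_positive_density mu (Lambda N a b sigma) mu' &
    locally_uniform_cvg (Lambda N a b sigma)
      (fun n x => (\sum_(0 <= j < n.+1) (a j)^-1)^-1 *
                  \sum_(0 <= j < n.+1) (orthpoly a b j).[x] ^+ 2)
      (fun x => upsilon N a b sigma x / mu' x).
Proof.
have carleman := carleman_condition N_gt0 a_gt0 a_diff.
exists (density_at N a b sigma 0).
  exact: (density_Lambda N_gt0 a_gt0 a_ratio a_infty a_diff carleman sigma_sign
    D1N_a D1N_b D1N_inv sigma_mx mu_orth).
exact: (christoffel_limit N_gt0 a_gt0 a_ratio a_infty a_diff carleman sigma_sign
  D1N_a D1N_b D1N_inv sigma_mx mu_orth).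
Qed.
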